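(* Let $A: C_{c}^{\infty}(G) \rightarrow \mathcal{F}(G)$ be a linear mapping. Then $A$ satisfies the positive maximum principle if and only if there exist functions $c, b_{i}, a_{jk}$ $(1 \leq i,j,k \leq d)$ from $G$ to $\mathbb{R}$, where $c$ is non-negative and the matrix $a(\sigma) := (a_{jk}(\sigma))$ is non-negative definite and symmetric for all $\sigma \in G$, and a Lévy kernel $\mu$ on $G$, such that for all $f \in C_{c}^{\infty}(G)$ and $\sigma \in G$, $$Af(\sigma) = -c(\sigma)f(\sigma) + \sum_{i=1}^{d}b_{i}(\sigma)X_{i}f(\sigma) + \sum_{j,k = 1}^{d}a_{jk}(\sigma)X_{j}X_{k}f(\sigma) + \int_{G}\left(f(\sigma \tau) - f(\sigma) - \sum_{i=1}^{d}x_{i}(\tau)X_{i}f(\sigma)\right)\mu(\sigma, d\tau).$$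
   Context: $G$ is a Lie group of dimension $d$ with neutral element $e$, Lie algebra $\mathfrak{g}$, exponential map $\exp$ and Borel $\sigma$-algebra $\mathcal{B}(G)$. $\mathcal{F}(G)$ is the space of all real-valued functions on $G$, and $C_c^\infty(G)$ is the space of real-valued smooth compactly supported functions on $G$. A basis $\{X_1,\dots,X_d\}$ of $\mathfrak{g}$ is fixed; elements $X\in\mathfrak{g}$ act on smooth functions as left-invariant vector fields, $Xf(\sigma)=\frac{d}{du}f(\sigma\exp(uX))|_{u=0}$. A canonical co-ordinate neighbourhood of $e$ is an open neighbourhood $U$ of $e$ together with co-ordinate functions $x_1,\dots,x_d\in C_c^\infty(G)$ such that $g\mapsto (x_1(g),\dots,x_d(g))$ is a diffeomorphism of $U$ onto an open neighbourhood of $0$ in $\mathbb{R}^d$, sending $e$ to $0$, and $g=\exp(\sum_{i=1}^d x_i(g)X_i)$ for $g\in U$. One such $U$ with functions $x_1,\dots,x_d$ is fixed. Positive maximum principle (PMP) for a linear mapping $A: C_{c}^{\infty}(G) \rightarrow \mathcal{F}(G)$: whenever $f \in C_{c}^{\infty}(G)$ and $\rho\in G$ satisfy $f(\rho) = \sup_{\tau \in G}f(\tau) \geq 0$, then $Af(\rho) \leq 0$. A Borel measure $\mu$ on $G$ is a Lévy measure if $\mu(\{e\})=0$ and, for every canonical co-ordinate neighbourhood $U$ of $e$, $\int_U \sum_{i=1}^d x_i(g)^2\,\mu(dg)<\infty$ and $\mu(U^c)<\infty$. A Lévy kernel on $G$ is a mapping $\mu:G\times\mathcal{B}(G)\to[0,\infty]$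 such that $\mu(g,\cdot)$ is a Lévy measure on $G$ for every $g\in G$. *)

(* Defs.v *)
From HB Require Import structures.
From mathcomp Require Import all_boot all_order all_algebra.
From mathcomp Require Import all_classical all_reals all_analysis.
From mathcomp Require Import ring.

Set Implicit Arguments.
Unset Strict Implicit.
Unset Printing Implicit Defensive.
Import Order.TTheory GRing.Theory Num.Theory.
Import numFieldNormedType.Exports.
Local Open Scope classical_set_scope.
Local Open Scope ring_scope.

Section Smooth.
Context {R : realType} {V W : normedModType R}.

(* For V of finite dimension and D open these are the usual C^k and C^oo
   functions on D; the values of f outside D are irrelevant. *)
Fixpoint Ck_on (k : nat) (D : set V) (f : V -> W) : Prop :=
  match k with
  | 0 => forall x, D x -> {for x, continuous f}
  | k'.+1 => (forall x, D x -> differentiable f x) /\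
             (forall v, Ck_on k' D ('D_v f))
  end.

Definition smooth_on (D : set V) (f : V -> W) : Prop :=
  forall k, Ck_on k D f.

Lemma Ck_onS k (D : set V) (f : V -> W) : Ck_on k.+1 D f -> Ck_on k D f.
Proof.
elim: k f => [|k IH] f [df Df].
  by move=> x Dx; exact: differentiable_continuous (df x Dx).
by split => // v; exact/IH/Df.
Qed.

Lemma near_eq_differentiable (f g : V -> W) (x : V) :
  (\forall y \near x, f y = g y) -> differentiable f x -> differentiable g x.
Proof.
move=> fg df.
have fgx : f x = g x by exact: (nbhs_singleton fg).
have dc : continuous ('d f x) by exact: diff_continuous.
have fg0 : \forall h \near (0:V), f (h + x) = g (h + x).
  move: fg; rewrite (near_shift 0)/= => fg.
  by apply: filterS fg => y /=; rewrite subr0.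
have E' : g \o shift x = cst (g x) + 'd f x +o_ 0 id.
  apply/eqaddoP => e e0.
  have /eqaddoP /(_ e e0) H := diff_locally df.
  near=> h.
  have fgh : f (h + x) = g (h + x) by near: h.
  have : `|((f \o shift x) - (cst (f x) + 'd f x)) h| <= e * `|id h|.
    by near: h.
  by rewrite /= /GRing.opp/= /GRing.add/= /cst fgh fgx.
by apply/diff_locallyP; rewrite (diff_unique dc E').
Unshelve. all: by end_near. Qed.

Lemma eq_Ck_on k (D : set V) (f g : V -> W) : open D ->
  (forall x, D x -> f x = g x) -> Ck_on k D f -> Ck_on k D g.
Proof.
move=> oD; elim: k f g => [|k IH] f g fg.
  move=> cf x Dx; rewrite /prop_for /continuous_at -(fg _ Dx).
  apply: cvg_trans (cf _ Dx); apply: near_eq_cvg.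
  by apply: filterS (open_nbhs_nbhs (conj oD Dx)) => y /fg.
move=> [df Df]; split=> [x Dx|v].
  apply: near_eq_differentiable (df x Dx).
  by apply: filterS (open_nbhs_nbhs (conj oD Dx)) => y /fg.
apply: IH (Df v) => x Dx; apply: near_eq_derive.
by apply: filterS (open_nbhs_nbhs (conj oD Dx)) => y /fg.
Qed.

Lemma Ck_on_cst k (D : set V) (w : W) : Ck_on k D (cst w).
Proof.
elim: k w => [|k IH] w /=; first by move=> x _; exact: cst_continuous.
split=> [x _|v]; first exact: differentiable_cst.
suff -> : 'D_v (cst w : V -> W) = cst 0 by [].
by apply/funext => x; rewrite derive_cst.
Qed.

Lemma Ck_onD k (D : set V) (f g : V -> W) : open D ->
  Ck_on k D f -> Ck_on k D g -> Ck_on k D (f + g).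
Proof.
move=> oD; elim: k f g => [|k IH] f g.
  by move=> cf cg x Dx; apply: continuousD; [exact: cf|exact: cg].
move=> [df Df] [dg Dg]; split=> [x Dx|v].
  by apply: differentiableD; [exact: df|exact: dg].
apply: eq_Ck_on (IH _ _ (Df v) (Dg v)) => // x Dx.
by rewrite deriveD//; apply: diff_derivable; [exact: df|exact: dg].
Qed.

Lemma Ck_onZ k (D : set V) (a : R) (f : V -> W) : open D ->
  Ck_on k D f -> Ck_on k D (a *: f).
Proof.
move=> oD; elim: k f => [|k IH] f.
  by move=> cf x Dx; apply: continuousZr; exact: cf.
move=> [df Df]; split=> [x Dx|v].
  by apply: differentiableZ; exact: df.
apply: eq_Ck_on (IH _ (Df v)) => // x Dx.
by rewrite deriveZ//; apply: diff_derivable; exact: df.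
Qed.

End Smooth.

Lemma Ck_onM (R : realType) (V : normedModType R) k (D : set V)
  (f g : V -> R) : open D ->
  Ck_on k D f -> Ck_on k D g -> Ck_on k D (f * g).
Proof.
move=> oD; elim: k f g => [|k IH] f g.
  by move=> cf cg x Dx; apply: continuousM; [exact: cf|exact: cg].
move=> /[dup] /Ck_onS Cf [df Df] /[dup] /Ck_onS Cg [dg Dg]; split=> [x Dx|v].
  by apply: differentiableM; [exact: df|exact: dg].
apply: eq_Ck_on (Ck_onD oD (IH _ _ Cf (Dg v)) (IH _ _ Cg (Df v))) => // x Dx.
by rewrite deriveM//; apply: diff_derivable; [exact: df|exact: dg].
Qed.

Record chart (R : realType) (d : nat) (M : topologicalType) := Chart {
  chart_dom : set M;
  chart_cod : set 'rV[R]_d;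
  chart_fun : M -> 'rV[R]_d;
  chart_inv : 'rV[R]_d -> M;
  open_chart_dom : open chart_dom;
  open_chart_cod : open chart_cod;
  chart_funS : forall p, chart_dom p -> chart_cod (chart_fun p);
  chart_invS : forall z, chart_cod z -> chart_dom (chart_inv z);
  chart_funK : forall p, chart_dom p -> chart_inv (chart_fun p) = p;
  chart_invK : forall z, chart_cod z -> chart_fun (chart_inv z) = z;
  chart_fun_continuous :
    forall p, chart_dom p -> {for p, continuous chart_fun};
  chart_inv_continuous :
    forall z, chart_cod z -> {for z, continuous chart_inv} }.

Arguments open_chart_dom {R d M} c.
Arguments open_chart_cod {R d M} c.

(* The atlas is not required to be maximal. *)
HB.mixin Record isManifold (R : realType) (d : nat) M of Topological M := {
  atlas : set (chart R d M);
  atlas_cover : forall p : M, exists2 phi, atlas phi & chart_dom phi p;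
  atlas_compatible : forall phi psi, atlas phi -> atlas psi ->
    smooth_on (chart_cod phi `&` chart_inv phi @^-1` chart_dom psi)
      (chart_fun psi \o chart_inv phi);
  manifold_hausdorff : hausdorff_space M;
  manifold_second_countable : @second_countable M }.

#[short(type="manifoldType")]
HB.structure Definition Manifold (R : realType) (d : nat) :=
  {M of PointedTopological M & isManifold R d M}.

Definition smooth_into (R : realType) (d : nat) (M : manifoldType R d)
    (V : normedModType R) (D : set V) (g : V -> M) : Prop :=
  (forall v, D v -> {for v, continuous g}) /\
  (forall phi : chart R d M, atlas phi ->
     smooth_on (D `&` g @^-1` chart_dom phi) (chart_fun phi \o g)).

(* smooth_into includes continuity, so these axioms make G a topological
   group. *)
HB.mixin Record isLieGroup (R : realType) (d : nat) G
    of Manifold R d G & Group G := {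
  mulg_smooth : forall phi psi : chart R d G, atlas phi -> atlas psi ->
    smooth_into (chart_cod phi `*` chart_cod psi)
      (fun z : 'rV[R]_d * 'rV[R]_d =>
         (chart_inv phi z.1 * chart_inv psi z.2)%g : G);
  invg_smooth : forall phi : chart R d G, atlas phi ->
    smooth_into (chart_cod phi) (fun z => (chart_inv phi z)^-1%g : G) }.

#[short(type="lieGroupType")]
HB.structure Definition LieGroup (R : realType) (d : nat) :=
  {G of Manifold R d G & Group G & isLieGroup R d G}.

Section Functions.
Context {R : realType} {d : nat} (G : lieGroupType R d).

Definition smooth (f : G -> R) : Prop :=
  forall phi : chart R d G, atlas phi ->
    smooth_on (chart_cod phi) (f \o chart_inv phi).

Definition compactly_supported (f : G -> R) : Prop :=
  compact (closure [set g | f g != 0]).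

Definition smooth_pred : {pred G -> R} := mem [set f | smooth f].

Definition test_pred : {pred G -> R} :=
  mem [set f | smooth f /\ compactly_supported f].

Lemma smooth_submod_closed : submod_closed smooth_pred.
Proof.
split=> [|a f g]; rewrite !inE /=.
  by move=> phi _ k; exact: (Ck_on_cst k _ (0 : R)).
move=> sf sg phi aphi k; have oD := open_chart_cod phi.
exact: (Ck_onD oD (Ck_onZ a oD (sf _ aphi k)) (sg _ aphi k)).
Qed.

HB.instance Definition _ :=
  GRing.isSubmodClosed.Build _ _ smooth_pred smooth_submod_closed.

Lemma smooth_mulr_closed : mulr_closed smooth_pred.
Proof.
split=> [|f g]; rewrite !inE /=.
  by move=> phi _ k; exact: (Ck_on_cst k _ (1 : R)).
move=> sf sg phi aphi k.
exact: (Ck_onM (open_chart_cod phi) (sf _ aphi k) (sg _ aphi k)).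
Qed.

HB.instance Definition _ :=
  GRing.isMulClosed.Build _ smooth_pred smooth_mulr_closed.

Record smoothFun := SmoothFun {
  smooth_val :> G -> R;
  smooth_valP : smooth_val \in smooth_pred }.

HB.instance Definition _ := [isSub for smooth_val].
HB.instance Definition _ := [Choice of smoothFun by <:].
HB.instance Definition _ := [SubChoice_isSubLmodule of smoothFun by <:].
HB.instance Definition _ := [SubZmodule_isSubNzRing of smoothFun by <:].

Lemma test_submod_closed : submod_closed test_pred.
Proof.
split=> [|a f g]; rewrite !inE /=.
  split; first by have := smooth_submod_closed.1; rewrite inE.
  rewrite /compactly_supported [X in closure X](_ : _ = set0).
    by rewrite closure0; exact: compact0.
  by apply/seteqP; split => x //=; rewrite eqxx.
move=> [sf cf] [sg cg]; split.
  by have := smooth_submod_closed.2 a f g; rewrite !inE; apply.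
apply: subclosed_compact (compactU cf cg) _; first exact: closed_closure.
rewrite -closureU; apply: closureS => x /=.
apply: contra_neqP => /not_orP[/negP/negPn/eqP fx /negP/negPn/eqP gx].
by rewrite -[LHS]/(a * f x + g x) fx gx mulr0 addr0.
Qed.

HB.instance Definition _ :=
  GRing.isSubmodClosed.Build _ _ test_pred test_submod_closed.

Record testFun := TestFun {
  test_val :> G -> R;
  test_valP : test_val \in test_pred }.

HB.instance Definition _ := [isSub for test_val].
HB.instance Definition _ := [Choice of testFun by <:].
HB.instance Definition _ := [SubChoice_isSubLmodule of testFun by <:].

End Functions.

Notation borelType G := (g_sigma_algebraType (@open G)).

Section LieAlgebra.
Context {R : realType} {d : nat} (G : lieGroupType R d).

Definition point_derivation (D : smoothFun G -> R) : Prop :=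
  (forall (a : R) (f h : smoothFun G), D (a *: f + h) = a * D f + D h) /\
  (forall f h : smoothFun G, D (f * h) = D f * h 1%g + f 1%g * D h).

Definition point_derivation_pred : {pred smoothFun G -> R} :=
  mem [set D | point_derivation D].

Lemma point_derivation_submod_closed : submod_closed point_derivation_pred.
Proof.
split=> [|a D E]; rewrite !inE /=.
  by split=> *; rewrite /GRing.zero/= /cst !(mulr0, mul0r, addr0).
move=> [lD mD] [lE mE].
have E0 f : (a *: D + E) f = a * D f + E f by [].
split=> *; rewrite !E0.
  by rewrite lD lE; ring.
by rewrite mD mE; ring.
Qed.

HB.instance Definition _ := GRing.isSubmodClosed.Build _ _
  point_derivation_pred point_derivation_submod_closed.

(* The underlying vector space of the Lie algebra, as the tangent space at the
   neutral element; the bracket plays no role here. *)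
Record lieAlgebra := LieAlgebra {
  lie_val :> smoothFun G -> R;
  lie_valP : lie_val \in point_derivation_pred }.

HB.instance Definition _ := [isSub for lie_val].
HB.instance Definition _ := [Choice of lieAlgebra by <:].
HB.instance Definition _ := [SubChoice_isSubLmodule of lieAlgebra by <:].

Definition one_parameter_subgroup (X : lieAlgebra) (gam : R -> G) : Prop :=
  [/\ smooth_into setT gam,
      (forall s t, gam (s + t) = (gam s * gam t)%g) &
      forall f : smoothFun G, is_derive (0 : R) (1 : R) (f \o gam) (X f)].

(* Every X is the velocity at 0 of exactly one one-parameter subgroup, so that
   the default value of xget plays no role. *)
Definition lie_exp (X : lieAlgebra) : G :=
  xget 1%g [set gam 1 | gam in one_parameter_subgroup X].

Definition left_field (X : lieAlgebra) (f : G -> R) : G -> R :=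
  fun sigma => derive1 (fun u : R => f (sigma * lie_exp (u *: X))%g) 0.

Definition lie_basis (X : 'I_d -> lieAlgebra) : Prop :=
  (forall c : 'I_d -> R, \sum_(i < d) c i *: X i = 0 -> forall i, c i = 0) /\
  (forall Y : lieAlgebra, exists c : 'I_d -> R, Y = \sum_(i < d) c i *: X i).

Definition coord_map (x : 'I_d -> testFun G) (g : G) : 'rV[R]_d :=
  \row_(i < d) x i g.

(* Since the x i are smooth, coord_map x is a diffeomorphism of U onto its
   image as soon as it has a smooth inverse on it. *)
Definition canonical_coordinates (X : 'I_d -> lieAlgebra)
    (U : set G) (x : 'I_d -> testFun G) : Prop :=
  [/\ open U /\ U 1%g,
      coord_map x 1%g = 0,
      open (coord_map x @` U),
      exists2 y : 'rV[R]_d -> G,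
        smooth_into (coord_map x @` U) y &
        forall g, U g -> y (coord_map x g) = g &
      forall g, U g -> g = lie_exp (\sum_(i < d) x i g *: X i)].

(* The supremum is finite: f is continuous with compact support. *)
Definition positive_maximum_principle (A : testFun G -> (G -> R)) : Prop :=
  forall (f : testFun G) (rho : G),
    f rho = sup (range f) -> 0 <= sup (range f) -> A f rho <= 0.

Definition levy_measure (X : 'I_d -> lieAlgebra)
    (mu : {measure set (borelType G) -> \bar R}) : Prop :=
  mu [set 1%g] = 0%E /\
  forall (U : set G) (x : 'I_d -> testFun G), canonical_coordinates X U x ->
    (\int[mu]_(g in U) (\sum_(i < d) x i g ^+ 2)%:E < +oo)%E /\
    (mu (~` U) < +oo)%E.

Definition levy_kernel (X : 'I_d -> lieAlgebra)
    (mu : G -> {measure set (borelType G) -> \bar R}) : Prop :=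
  forall g, levy_measure X (mu g).

End LieAlgebra.

(* Main.v *)
(* By left translation it is enough to treat, at the point 1, a linear
   functional L on test functions with L f <= 0 whenever f has a nonnegative
   maximum at 1. Such an L is nonnegative on f >= 0 with f 1 = 0; on test
   functions vanishing near 1 it is therefore integration against a Borel
   measure mu, built as a Daniell upper integral and made additive by
   Caratheodory's theorem. Comparing with cut-offs gives that mu is a Levy
   measure and that the integral of f is at most L f for all f >= 0 with
   f 1 = 0. Subtracting from f its second order Taylor polynomial in canonical
   coordinates (with constants replaced by a plateau function zeta) leaves a
   function that is o(sum x_i^2), on which L and mu agree. Hence the diffusion
   matrix is a_jk = (L(x_j x_k) - int x_j x_k dmu) / 2 and the killing rate is
   c = - L zeta - int (1 - zeta) dmu >= 0. Conversely, at a maximum the first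
   order terms vanish, the Hessian is nonpositive and pairs nonpositively with
   a nonnegative matrix, and the integrand is nonpositive. *)
Require Import Defs.
From HB Require Import structures.
From mathcomp Require Import all_boot all_order all_algebra.
From mathcomp Require Import all_classical all_reals all_analysis.
From mathcomp Require Import measurable_realfun.
From mathcomp Require Import ring lra.
Set Implicit Arguments.
Unset Strict Implicit.
Unset Printing Implicit Defensive.
Import Order.TTheory GRing.Theory Num.Theory.
Import numFieldNormedType.Exports.
Local Open Scope classical_set_scope.
Local Open Scope ring_scope.

(** * Calculus of C^k functions *)

(** The test functions vanishing near 1 form no lattice: minima and absolute values leave the smooth
    class. The Daniell construction therefore works with products f beta by smooth cut-offs, under
    which this space is stable, and indicators of open sets arise as limits of polynomials in such
    beta. The weight w of the upper integral stays variable: the indicator of the complement of 1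
    gives mu, a function f gives an upper integral of f, and comparing the two gives int f <= L f.

    These functions see nothing at 1, so mu accounts only for a share of L; the rest is concentrated
    at 1. The inequality int f <= L f for f >= 0 with f 1 = 0, applied to squares of linear
    combinations of coordinates, is what makes the second order part of the rest non-negative.

    At 1 the operator X_j X_k differs from the coordinate Hessian by a first order operator, which
    the drift b absorbs. Outside U the functions x_i are arbitrary, so bounds by sum x_i^2 are
    available only near 1, and cut-offs must separate off the rest. *)

Section CkTheory.
Context {R : realType}.

(** Each clause of [Ck_on] concerns single points, so smoothness can be checked with another set D'
    around each point; this is how charts are glued. *)
Lemma Ck_on_pointwise (V W : normedModType R) k (D : set V) (f : V -> W) :
  (forall x, D x -> exists2 D', D' x & Ck_on k D' f) -> Ck_on k D f.
Proof.
elim: k f => [|k IH] f H.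
  by move=> x /H[D' D'x cf]; exact: cf.
split=> [x /H[D' D'x [df _]]|v]; first exact: df.
by apply: IH => x /H[D' D'x [_ Df]]; exists D' => //; exact: Df.
Qed.

Lemma is_derive_bigsum (V W : normedModType R) (I : Type) (s : seq I)
    (h : I -> V -> W) (dh : I -> W) (x v : V) :
  (forall i, is_derive x v (h i) (dh i)) ->
  is_derive x v (fun y => \sum_(i <- s) h i y) (\sum_(i <- s) dh i).
Proof.
move=> dhi; elim: s => [|i s IH].
  rewrite big_nil [X in is_derive _ _ X _](_ : _ = cst 0).
    exact: is_derive_cst.
  by apply/funext => y; rewrite big_nil.
rewrite big_cons [X in is_derive _ _ X _]
  (_ : _ = h i + (fun y => \sum_(i <- s) h i y)).
  exact: is_deriveD.
by apply/funext => y; rewrite big_cons.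
Qed.

Lemma differentiable_bigsum (V W : normedModType R) (I : Type) (s : seq I)
    (h : I -> V -> W) (x : V) :
  (forall i, differentiable (h i) x) ->
  differentiable (fun y => \sum_(i <- s) h i y) x.
Proof.
move=> dh; elim: s => [|i s IH].
  rewrite [X in differentiable X _](_ : _ = cst 0).
    exact: differentiable_cst.
  by apply/funext => y; rewrite big_nil.
rewrite [X in differentiable X _]
  (_ : _ = h i + (fun y => \sum_(i <- s) h i y)).
  exact: differentiableD.
by apply/funext => y; rewrite big_cons.
Qed.

Lemma continuous_bigsum (V W : normedModType R) (I : Type) (s : seq I)
    (h : I -> V -> W) (x : V) :
  (forall i, {for x, continuous (h i)}) ->
  {for x, continuous (fun y => \sum_(i <- s) h i y)}.
Proof.
move=> ch; rewrite /prop_for; elim: s => [|i s IH].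
  rewrite [X in continuous_at _ X](_ : _ = cst 0); first exact: cst_continuous.
  by apply/funext => y; rewrite big_nil.
rewrite [X in continuous_at _ X](_ : _ = h i + (fun y => \sum_(i <- s) h i y)).
  exact: continuousD.
by apply/funext => y; rewrite big_cons.
Qed.

Lemma Ck_on_bigsum (V W : normedModType R) (I : Type) (s : seq I)
    (h : I -> V -> W) k (D : set V) : open D ->
  (forall i, Ck_on k D (h i)) -> Ck_on k D (fun y => \sum_(i <- s) h i y).
Proof.
move=> oD ch; elim: s => [|i s IH].
  rewrite [X in Ck_on _ _ X](_ : _ = cst 0); first exact: Ck_on_cst.
  by apply/funext => y; rewrite big_nil.
rewrite [X in Ck_on _ _ X](_ : _ = h i + (fun y => \sum_(i <- s) h i y)).
  exact: Ck_onD.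
by apply/funext => y; rewrite big_cons.
Qed.

Section Affine.
Variables (V V1 : normedModType R) (I : finType) (a : V1) (e : I -> V1).
Variable c : I -> V -> R.

Let h (x : V) : V1 := a + \sum_i c i x *: e i.

Lemma affine_comb_continuous (x : V) :
  (forall i, {for x, continuous (c i)}) -> {for x, continuous h}.
Proof.
move=> cc; apply: (@continuousD _ _ _ (cst a) (fun x => \sum_i c i x *: e i)).
  exact: cst_continuous.
apply: continuous_bigsum => i.
by apply: cvgZr_tmp; exact: cc.
Qed.

Lemma affine_comb_differentiable (x : V) :
  (forall i, differentiable (c i) x) -> differentiable h x.
Proof.
move=> dc; apply: (@differentiableD _ _ _ (cst a)) => //.
by apply: differentiable_bigsum => i; apply: differentiableZl.
Qed.

Lemma affine_comb_derive (x v : V) : (forall i, differentiable (c i) x) ->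
  'D_v h x = \sum_i 'D_v (c i) x *: e i.
Proof.
move=> dc.
have H : is_derive x v (fun x => \sum_i c i x *: e i)
   (\sum_i 'D_v (c i) x *: e i).
  apply: is_derive_bigsum => i.
  have dci : derivable (c i) x v by apply: diff_derivable.
  apply: DeriveDef; first by apply: diff_derivable; exact: differentiableZl.
  by rewrite !deriveE ?diffZl//; exact: differentiableZl.
have := @is_deriveD _ _ _ _ _ _ _ _ _ (is_derive_cst a x v) H.
by rewrite add0r => /@derive_val.
Qed.

Lemma derive_affine_comb (W : normedModType R) (g : V1 -> W) (x v : V) :
  (forall i, differentiable (c i) x) -> differentiable g (h x) ->
  'D_v (fun y => g (h y)) x = \sum_i 'D_v (c i) x *: 'D_(e i) g (h x).
Proof.
move=> dc dg.
have dh := affine_comb_differentiable dc.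
rewrite deriveE; last exact: (differentiable_comp dh dg).
rewrite (diff_comp dh dg) /= -(deriveE v dh) affine_comb_derive//.
rewrite linear_sum; apply: eq_bigr => i _.
by rewrite linearZ /= -deriveE.
Qed.

(* Allowing arbitrary vectors e i, with no basis of V1 in sight, makes this
   chain rule cover at once linear maps, partial maps and maps into products. *)
Lemma Ck_on_comp k (g : V1 -> R) (D : set V) (D1 : set V1) :
  open D -> open D1 -> (forall i, Ck_on k D (c i)) -> Ck_on k D1 g ->
  (forall x, D x -> D1 (h x)) -> Ck_on k D (fun x => g (h x)).
Proof.
move=> oD oD1 + + hD; elim: k g => [|k IH] g cc cg.
  move=> x Dx; apply: (@continuous_comp _ _ _ h g).
    by apply: affine_comb_continuous => i; exact: cc.
  by apply: cg; exact: hD.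
have dcx x : D x -> forall i, differentiable (c i) x.
  by move=> Dx i; have [+ _] := cc i; exact.
have [dg Dg] := cg; split=> [x Dx|v].
  apply: (@differentiable_comp _ _ _ _ h g); last exact/dg/hD.
  exact/affine_comb_differentiable/dcx.
have Dcc i : Ck_on k D ('D_v (c i)) by have [_] := cc i; exact.
apply: (@eq_Ck_on _ _ _ _ _
  (fun x => \sum_i 'D_v (c i) x * 'D_(e i) g (h x))) => //.
  by move=> x Dx; rewrite derive_affine_comb//; [exact: dcx|exact/dg/hD].
apply: (@Ck_on_bigsum V R I _ (fun i x => 'D_v (c i) x * 'D_(e i) g (h x))) => // i.
apply: (@Ck_onM _ _ _ _ ('D_v (c i)) (fun x => 'D_(e i) g (h x))) => //.
by apply: (IH ('D_(e i) g)); [move=> j; exact/Ck_onS/cc|exact: Dg].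
Qed.

End Affine.

Lemma Ck_on_linear (V : normedModType R) (l : {linear V -> R}) k (D : set V) :
  continuous l -> Ck_on k D l.
Proof.
move=> cl; case: k => [|k]; first by move=> x _; exact: cl.
split=> [x _|v]; first exact: linear_differentiable.
rewrite (_ : 'D_v l = cst (l v)); first exact: Ck_on_cst.
apply/funext => x; rewrite deriveE; last exact: linear_differentiable.
by rewrite diff_lin.
Qed.

Definition rV_coord d (i : 'I_d) (z : 'rV[R]_d) : R := z 0 i.

Lemma rV_coord_is_linear d (i : 'I_d) : linear (rV_coord i).
Proof. by move=> a u v; rewrite /rV_coord !mxE. Qed.

HB.instance Definition _ d (i : 'I_d) :=
  GRing.isLinear.Build R 'rV[R]_d R _ (rV_coord i) (rV_coord_is_linear i).

Lemma rV_coord_continuous d (i : 'I_d) : continuous (rV_coord i).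
Proof. exact: coord_continuous. Qed.

Lemma Ck_on_rV_coord (V : normedModType R) d k (D : set V) (f : V -> 'rV[R]_d)
    (i : 'I_d) : open D -> Ck_on k D f -> Ck_on k D (fun x => f x 0 i).
Proof.
move=> oD; elim: k f => [|k IH] f cf.
  move=> x Dx; apply: (@continuous_comp _ _ _ f (rV_coord i)); first exact: cf.
  exact: rV_coord_continuous.
have [df Df] := cf.
have dl z : differentiable (rV_coord i) z.
  exact/linear_differentiable/rV_coord_continuous.
split=> [x Dx|v].
  by apply: (@differentiable_comp _ _ _ _ f (rV_coord i)) => //; exact: df.
apply: eq_Ck_on (IH _ (Df v)) => // x Dx.
rewrite -[RHS]/('D_v (rV_coord i \o f) x) !deriveE; first last.
- exact: df.
- by apply: differentiable_comp; [exact: df|].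
rewrite (diff_comp (df _ Dx) (dl _)) /=.
have -> : 'd (rV_coord i) (f x) = rV_coord i :> ('rV[R]_d -> R).
  by apply: diff_lin; exact: rV_coord_continuous.
by [].

Qed.

(** Puts a row in the affine form on which the chain rule [Ck_on_comp] is stated. *)
Lemma row_affine_comb d (z : 'rV[R]_d) :
  z = 0 + \sum_(i < d) z 0 i *: delta_mx 0 i.
Proof. by rewrite add0r -row_sum_delta. Qed.

Lemma Ck_on_comp_rV (V : normedModType R) d k (f : V -> 'rV[R]_d)
    (g : 'rV[R]_d -> R) (D : set V) (D1 : set 'rV[R]_d) :
  open D -> open D1 -> Ck_on k D f -> Ck_on k D1 g ->
  (forall x, D x -> D1 (f x)) -> Ck_on k D (g \o f).
Proof.
move=> oD oD1 cf cg fD.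
apply: (@eq_Ck_on _ _ _ _ _
  (fun x => g (0 + \sum_(i < d) f x 0 i *: delta_mx 0 i))) => //.
  by move=> x _; rewrite -row_affine_comb.
apply: (Ck_on_comp (D1 := D1)) => //.
- by move=> i; exact: Ck_on_rV_coord.
- by move=> x Dx; rewrite -row_affine_comb; exact: fD.
Qed.

Lemma derive_comp_rV (V : normedModType R) d (f : V -> 'rV[R]_d)
    (g : 'rV[R]_d -> R) x v :
  (forall i, differentiable (fun y => f y 0 i) x) -> differentiable g (f x) ->
  'D_v (g \o f) x =
  \sum_(i < d) 'D_v (fun y => f y 0 i) x * 'D_(delta_mx 0 i) g (f x).
Proof.
move=> df dg.
rewrite (_ : g \o f = fun x => g (0 + \sum_(i < d) f x 0 i *: delta_mx 0 i)).
  rewrite derive_affine_comb//; last by rewrite -row_affine_comb.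
  by rewrite -row_affine_comb.
by apply/funext => y /=; rewrite -row_affine_comb.
Qed.

Lemma Ck_on_comp_R (V : normedModType R) k (f : V -> R) (g : R -> R)
    (D : set V) (D1 : set R) : open D -> open D1 ->
  Ck_on k D f -> Ck_on k D1 g -> (forall x, D x -> D1 (f x)) ->
  Ck_on k D (g \o f).
Proof.
move=> oD oD1 cf cg fD.
have E x : 0 + \sum_(i < 1) (fun i : 'I_1 => f) i x *: (1 : R) = f x.
  by rewrite add0r big_ord1 [LHS]mulr1.
apply: (@eq_Ck_on _ _ _ _ _
   (fun x => g (0 + \sum_(i < 1) (fun i : 'I_1 => f) i x *: (1 : R)))) => //.
  by move=> x _; rewrite E.
by apply: (Ck_on_comp (D1 := D1)) => // x Dx; rewrite E; exact: fD.
Qed.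

End CkTheory.

(** * Second order calculus at a point: Taylor remainder and maxima *)

Section Calculus.
Context {R : realType}.

Lemma derive_row d (F : 'rV[R]_d -> R) (z v : 'rV[R]_d) : differentiable F z ->
  'D_v F z = \sum_(i < d) v 0 i * 'D_(delta_mx 0 i) F z.
Proof.
move=> dF; rewrite deriveE// {1}(row_sum_delta v) linear_sum.
by apply: eq_bigr => i _; rewrite linearZ /= -deriveE.
Qed.

Lemma is_derive_line (V : normedModType R) (F : V -> R) (v : V) (t : R) :
  differentiable F (t *: v) ->
  is_derive t 1 (fun s : R => F (s *: v)) ('D_v F (t *: v)).
Proof.
move=> dF.
have dl : is_diff t (fun s : R => s *: v) (fun s : R => s *: v).
  exact: is_diff_scalel.
have dc : differentiable (F \o (fun s : R => s *: v)) t by exact: differentiable_comp.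
apply: DeriveDef; first by apply: diff_derivable.
rewrite deriveE// (diff_comp (ex_diff (is_diff_def := dl)) dF) /=.
by rewrite diff_val scale1r -deriveE.
Qed.

Lemma diff_small (V : normedModType R) (f : V -> R) :
  differentiable f 0 -> f 0 = 0 ->
  forall e, 0 < e -> \forall z \near (0 : V), `|f z - 'D_z f 0| <= e * `|z|.
Proof.
move=> df f0 e e0.
have /eqaddoP /(_ e e0) := diff_locally df; apply: filterS => z.
have -> : (f \o shift 0 - (cst (f 0) + 'd f 0)) z = f (z + 0) - (f 0 + 'd f 0 z) by [].
by rewrite addr0 f0 add0r -deriveE.
Qed.

(** The norm on rows is the maximum norm, attained at one entry. *)
Lemma norm_row_sqr d (z : 'rV[R]_d) : `|z| ^+ 2 <= \sum_(i < d) z 0 i ^+ 2.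
Proof.
have [->|/mx_norm_neq0[[i j]/= zij]] := eqVneq `|z| 0.
  by rewrite expr0n/=; apply: sumr_ge0 => i _; exact: sqr_ge0.
rewrite /Num.norm/= zij /= (ord1 i) (bigD1 j)//= real_normK ?num_real//.
by rewrite lerDl; apply: sumr_ge0 => k _; exact: sqr_ge0.
Qed.

Lemma norm_coord_le d (z : 'rV[R]_d) i : `|z 0 i| <= `|z|.
Proof.
rewrite [leRHS]mx_normrE.
by apply: (@le_trans _ _ `|z (ord0, i).1 (ord0, i).2|) => //; exact: le_bigmax.
Qed.

(** The mean value theorem on the segment from 0 to z gives F z = sum z_i (D_i F)(c z), and each D_i
    F is differentiable at 0. Its linear parts add up to c times the Hessian form at z, which sees
    only the symmetrised Hessian and so vanishes. *)
Lemma taylor_small d (F : 'rV[R]_d -> R) (D : set 'rV[R]_d) : open D -> D 0 ->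
  Ck_on 2 D F -> F 0 = 0 -> (forall i, 'D_(delta_mx 0 i) F 0 = 0) ->
  (forall i j, 'D_(delta_mx 0 j) ('D_(delta_mx 0 i) F) 0 +
               'D_(delta_mx 0 i) ('D_(delta_mx 0 j) F) 0 = 0) ->
  forall e, 0 < e ->
  \forall z \near (0 : 'rV[R]_d), `|F z| <= e * \sum_(i < d) z 0 i ^+ 2.
Proof.
move=> oD D0 [dF DF] F0 DF0 DDF0 e e0.
have d1 : 0 < d%:R + 1 :> R by rewrite ltr_wpDl.
pose H i j := 'D_(delta_mx 0 j) ('D_(delta_mx 0 i) F) 0.
pose g i (z : 'rV[R]_d) := 'D_(delta_mx 0 i) F z - 'D_z ('D_(delta_mx 0 i) F) 0.
have quad0 (z : 'rV[R]_d) : \sum_i z 0 i * 'D_z ('D_(delta_mx 0 i) F) 0 = 0.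
  have E : \sum_i z 0 i * 'D_z ('D_(delta_mx 0 i) F) 0 =
      \sum_i \sum_j z 0 i * z 0 j * H i j.
    apply: eq_bigr => i _; rewrite derive_row; last by have [+ _] := DF (delta_mx 0 i); exact.
    by rewrite mulr_sumr; apply: eq_bigr => j _; rewrite mulrA.
  rewrite E; set S := \sum_i _; suff : S + S = 0 by lra.
  rewrite {1}/S exchange_big -big_split; apply: big1 => i _ /=.
  rewrite -big_split; apply: big1 => j _ /=.
  by rewrite [z 0 j * _]mulrC -mulrDr DDF0 mulr0.
(* There are d such errors to add; d + 1 instead of d keeps the constant positive for d = 0. *)
have small i : \forall z \near (0 : 'rV[R]_d),
    `|g i z| <= e / (d%:R + 1) * `|z|.
  have [dG _] := DF (delta_mx 0 i).
  apply: diff_small => //; first exact: dG.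
  by rewrite divr_gt0.
have {}small : \forall z \near (0 : 'rV[R]_d),
    forall i, `|g i z| <= e / (d%:R + 1) * `|z|.
  exact: (@filter_forall _ _ _ (nbhs (0 : 'rV[R]_d)) _ small).
have nD : \forall z \near (0 : 'rV[R]_d), D z by exact: open_nbhs_nbhs.
have /nbhs_ballP[r r0 Hr] : nbhs (0 : 'rV[R]_d) ([set z | forall i,
    `|g i z| <= e / (d%:R + 1) * `|z|] `&` D).
  exact: filterI.
have {}Hr z : `|z| < r -> (forall i, `|g i z| <= e / (d%:R + 1) * `|z|) /\ D z.
  by move=> zr; apply: Hr; rewrite -ball_normE /= sub0r normrN.
apply/nbhs_ballP; exists r => // z; rewrite -ball_normE /= sub0r normrN => zr.
have tz (t : R) : t \in `[0, 1] -> `|t *: z| < r.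
  rewrite in_itv /= => /andP[t0 t1]; apply: le_lt_trans zr.
  by rewrite normrZ ger0_norm// ler_piMl.
have dl (t : R) : t \in `[0, 1] ->
    is_derive t 1 (fun s : R => F (s *: z)) ('D_z F (t *: z)).
  by move=> /tz/Hr[_ /dF ?]; exact: is_derive_line.
have dl' (t : R) : t \in `]0, 1[ ->
    is_derive t 1 (fun s : R => F (s *: z)) ('D_z F (t *: z)).
  by move=> /subset_itv_oo_cc; exact: dl.
have cl : {within `[0, 1], continuous (fun s : R => F (s *: z))}.
  apply: derivable_within_continuous => t /dl dt; exact: ex_derive.
have [c] := MVT (@ltr01 R) dl' cl.
move=> /subset_itv_oo_cc c01; rewrite scale1r scale0r F0 !subr0 mulr1 => ->.
have [gc Dc] := Hr _ (tz _ c01).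
rewrite derive_row; last exact: dF.
have -> : \sum_(i < d) z 0 i * 'D_(delta_mx 0 i) F (c *: z) =
    \sum_(i < d) z 0 i * g i (c *: z).
  apply/eqP; rewrite -subr_eq0 -sumrB; apply/eqP.
  rewrite (eq_bigr (fun i => c * (z 0 i * 'D_z ('D_(delta_mx 0 i) F) 0))).
    by rewrite -mulr_sumr quad0 mulr0.
  move=> i _; rewrite -mulrBr /g subKr mulrCA.
  have [+ _] := DF (delta_mx 0 i) => dG.
  by rewrite !deriveE ?linearZ//; exact: dG.
apply: (@le_trans _ _ (\sum_(i < d) e / (d%:R + 1) * `|z| * `|z|)).
  apply: (le_trans (ler_norm_sum _ _ _)); apply: ler_sum => i _.
  rewrite normrM mulrC; apply: ler_pM => //; last exact: norm_coord_le.
  apply: (le_trans (gc i)); rewrite ler_wpM2l ?(divr_ge0 (ltW e0) (ltW d1))// normrZ.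
  have c1 : `|c| <= 1 by move: c01; rewrite in_itv /= => /andP[? ?]; rewrite ger0_norm.
  by rewrite -[leRHS]mul1r ler_wpM2r.
rewrite sumr_const card_ord -[_ *+ d]mulr_natl -mulrA -expr2 mulrA.
apply: (@le_trans _ _ (e * `|z| ^+ 2)).
  rewrite ler_wpM2r ?sqr_ge0//.
  by rewrite mulrCA ler_piMr ?(ltW e0)// ler_pdivrMr// mul1r lerDl.
by rewrite ler_wpM2l ?(ltW e0)//; exact: norm_row_sqr.
Qed.

(** If the second derivative l were positive, the derivative along v would be at least s l / 2 at s
    v for small s > 0, and by the mean value theorem F would exceed F 0 there. *)
Lemma second_derivative_test (V : normedModType R) (F : V -> R) (D : set V)
    (v : V) : open D -> D 0 -> Ck_on 2 D F -> (forall z, D z -> F z <= F 0) ->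
  'D_v F 0 = 0 /\ 'D_v ('D_v F) 0 <= 0.
Proof.
move=> oD D0 [dF DF] Fmax.
have nD : \forall t \near (0 : R), D (t *: v).
  have H : {for (0 : R), continuous (fun t : R => t *: v)} by exact: scalel_continuous.
  by apply: H; rewrite /= scale0r; exact: open_nbhs_nbhs.
have /nbhs_ballP[r /= r0 Hr] := nD.
have {}Hr (t : R) : `|t| < r -> D (t *: v).
  by move=> tr; apply: Hr; rewrite -ball_normE /= sub0r normrN.
have dl (t : R) : `|t| < r ->
    is_derive t 1 (fun s : R => F (s *: v)) ('D_v F (t *: v)).
  by move=> /Hr/dF; exact: is_derive_line.
have DF0 : 'D_v F 0 = 0.
  have := @derive1_at_max R (fun s : R => F (s *: v)) (- r) r 0.
  have -> : - r <= r by lra.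
  have -> : 0 \in `]- r, r[ by rewrite in_itv /= r0 oppr_lt0 r0.
  move=> /(_ isT) H.
  have {}H : is_derive (0 : R) 1 (fun s : R => F (s *: v)) 0.
    apply: H => // t; rewrite in_itv /= -ltr_norml => tr.
      exact: (@ex_derive _ _ _ _ _ _ _ (dl _ tr)).
    by rewrite scale0r; apply: Fmax; exact: Hr.
  have := dl 0; rewrite normr0 scale0r => /(_ r0) /@derive_val <-.
  by rewrite (@derive_val _ _ _ _ _ _ _ H).
split=> //; rewrite leNgt; apply/negP => pos.
have [dG _] := DF v.
have dp : is_derive (0 : R) 1 (fun s : R => 'D_v F (s *: v)) ('D_v ('D_v F) 0).
  have := @is_derive_line _ ('D_v F) v 0; rewrite scale0r; apply; exact: dG.
pose l := 'D_v ('D_v F) 0.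
have : \forall t \near (0 : R), `|'D_v F (t *: v) - t * l| <= l / 2 * `|t|.
  have dd : differentiable (fun s : R => 'D_v F (s *: v)) 0.
    by apply/derivable1_diffP; exact: (@ex_derive _ _ _ _ _ _ _ dp).
  have D0' : 'D_v F (0 *: v) = 0 by rewrite scale0r.
  have l2 : 0 < l / 2 by rewrite divr_gt0.
  apply: filterS (diff_small dd D0' l2) => t.
  have -> // : 'D_t (fun s : R => 'D_v F (s *: v)) 0 = t * l.
  rewrite (deriveE (t : R) dd) (_ : 'd _ _ t = 'd (fun s : R => 'D_v F (s *: v)) 0 (t *: 1)).
    by rewrite linearZ -(deriveE (1 : R) dd) (@derive_val _ _ _ _ _ _ _ dp).
  by rewrite [t *: 1]mulr1.
move=> /nbhs_ballP[r' /= r'0 Hr'].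
pose t := Num.min r r' / 2.
have m0 : 0 < Num.min r r' by rewrite lt_min r0.
have t0 : 0 < t by rewrite divr_gt0.
have [tr tr'] : t < r /\ t < r'.
  by apply/andP; rewrite -lt_min /t ltr_pdivrMr//; lra.
have dl' (s : R) : s \in `]0, t[ ->
    is_derive s 1 (fun s : R => F (s *: v)) ('D_v F (s *: v)).
  rewrite in_itv /= => /andP[s0 st]; apply: dl.
  by rewrite gtr0_norm// (lt_trans st).
have cl : {within `[0, t], continuous (fun s : R => F (s *: v))}.
  apply: derivable_within_continuous => s; rewrite in_itv /= => /andP[s0 st].
  have sr : `|s| < r by rewrite ger0_norm// (le_lt_trans st).
  exact: (@ex_derive _ _ _ _ _ _ _ (dl _ sr)).
have [s] := MVT t0 dl' cl.
rewrite in_itv /= => /andP[s0 st] E.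
have : F (t *: v) - F (0 *: v) <= 0.
  by rewrite scale0r subr_le0; apply/Fmax/Hr; rewrite gtr0_norm.
rewrite E leNgt subr0 pmulr_lgt0//; apply/negP; rewrite negbK.
have := Hr' s; rewrite -ball_normE /= sub0r normrN gtr0_norm// => /(_ (lt_trans st tr')).
rewrite ler_distl => /andP[+ _]; apply: lt_le_trans.
have : 0 < s * l by rewrite mulr_gt0.
lra.
Qed.

End Calculus.

(** * The flat functions t^-n exp (-1/t) *)

Section FlatExp.
Context {R : realType}.

(** The parameter n closes the family under differentiation, up to linear combinations, so that
    smoothness follows by induction on the order. The member n = 0 is the building block of all
    cut-offs. *)
Definition flat_exp (n : nat) (t : R) : R :=
  if 0 < t then t^-1 ^+ n * expR (- t^-1) else 0.

Lemma flat_exp_pos n t : 0 < t -> flat_exp n t = t^-1 ^+ n * expR (- t^-1).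
Proof. by rewrite /flat_exp => ->. Qed.

Lemma flat_exp_npos n t : t <= 0 -> flat_exp n t = 0.
Proof. by rewrite /flat_exp leNgt => /negbTE ->. Qed.

(** One term of the exponential series bounds (1/t)^(n+2) by (n+2)! exp (1/t). The square on the
    right makes the derivative at 0 vanish. *)
Lemma flat_exp_le_sqr n t : `|flat_exp n t| <= n.+2`!%:R * t ^+ 2.
Proof.
have [t0|t0] := leP t 0.
  by rewrite flat_exp_npos// normr0 mulr_ge0// sqr_ge0.
have s0 : 0 < t^-1 by rewrite invr_gt0.
rewrite flat_exp_pos// ger0_norm; last first.
  by rewrite mulr_ge0 ?expR_ge0// exprn_ge0// ltW.
rewrite expRN ler_pdivrMr ?expR_gt0//.
have := expR_ge1Dxn n.+1 (ltW s0); set E := expR _ => H.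
have {}H : t^-1 ^+ n.+2 <= n.+2`!%:R * E.
  rewrite mulrC -ler_pdivrMr ?ltr0n ?fact_gt0//.
  by apply: le_trans H; rewrite lerDr.
have -> : t^-1 ^+ n = t^-1 ^+ n.+2 * t ^+ 2.
  by rewrite -addn2 exprD -mulrA -exprMn mulVf ?gt_eqF// expr1n mulr1.
by rewrite [leRHS]mulrAC ler_wpM2r// sqr_ge0.
Qed.

Lemma is_derive_flat_exp n (t : R) :
  is_derive t 1 (flat_exp n) (flat_exp n.+2 t - n%:R * flat_exp n.+1 t).
Proof.
have [t0|t0|->] := ltgtP t 0.
- rewrite !flat_exp_npos ?ltW// mulr0 subrr.
  apply: (@near_eq_is_derive _ R R (cst 0)).
  have := lt_nbhsl t0; apply: filterS => s s0.
  by rewrite flat_exp_npos ?ltW.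
- have tn0 : t != 0 by rewrite gt_eqF.
  apply: (@near_eq_is_derive _ R R (fun s => s^-1 ^+ n * expR (- s^-1))).
    have := lt_nbhsr t0; apply: filterS => s s0.
    by rewrite flat_exp_pos.
  have dV : is_derive t 1 (fun s : R => s^-1) (- t ^- 2).
    have -> : - t ^- 2 = - t ^- 2 *: 1 :> R by rewrite [_ *: _]mulr1.
    apply: DeriveDef; first exact: derivableV.
    by rewrite deriveV// derive_id.
  have dX : is_derive t 1 (fun s : R => s^-1 ^+ n)
      ((n%:R * t^-1 ^+ n.-1) *: (- t ^- 2)).
    by have := is_deriveX n dV; rewrite exprfctE.
  have dE : is_derive t 1 (fun s : R => expR (- s^-1))
      (expR (- t^-1) * t ^- 2).
    have dN : is_derive t 1 (fun s : R => - s^-1) (t ^- 2).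
      by rewrite -[X in is_derive _ _ _ X]opprK; exact: is_deriveN.
    have := @is_derive1_comp R expR (fun s : R => - s^-1) t _ _
      (is_derive_expR (- t^-1)) dN.
    by [].
  have := is_deriveM dX dE; rewrite /=.
  congr (is_derive _ _ _ _); rewrite !flat_exp_pos//.
  rewrite /GRing.scale/= -exprVn; move: (t^-1) (expR _) => s E.
  by case: n {dX} => [|n] /=; rewrite ?exprS; ring.
- rewrite !flat_exp_npos// mulr0 subrr.
  have c0 : h^-1 *: (flat_exp n (h *: 1 + 0) - flat_exp n 0) @[h --> 0^'] --> 0.
    apply/cvgr0Pnorm_le => e e0.
    have f0 : 0 < n.+2`!%:R :> R by rewrite ltr0n fact_gt0.
    near=> h.
    have h0 : h != 0 by near: h; exact: nbhs_dnbhs_neq.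
    rewrite addr0 (flat_exp_npos _ (lexx 0)) subr0 [h *: 1]mulr1 normrZ normfV.
    rewrite ler_pdivrMl ?normr_gt0//.
    apply: (le_trans (flat_exp_le_sqr _ _)).
    rewrite -[h ^+ 2]real_normK ?num_real// expr2 mulrA mulrC.
    rewrite ler_wpM2l// -ler_pdivlMl//.
    near: h; apply: dnbhs0_le; rewrite mulr_gt0// invr_gt0//.
  apply: DeriveDef; first by apply/cvg_ex; exists 0.
  exact: cvg_lim c0.
Unshelve. all: by end_near. Qed.

Lemma Ck_on_flat_exp k n : Ck_on k setT (flat_exp n).
Proof.
have df m t : differentiable (flat_exp m) t.
  by apply/derivable1_diffP; exact: (@ex_derive _ _ _ _ _ _ _ (is_derive_flat_exp m t)).
elim: k n => [|k IH] n; first by move=> t _; exact: differentiable_continuous.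
split=> [t _ //|v].
have -> : 'D_v (flat_exp n) =
    v *: (flat_exp n.+2 + (- n%:R) *: flat_exp n.+1).
  apply/funext => t; rewrite deriveE// -[v in LHS]mulr1 -[v * 1]/(v *: 1).
  rewrite linearZ /= -deriveE//.
  have := is_derive_flat_exp n t => /@derive_val ->.
  by rewrite -[RHS]/(v * (flat_exp n.+2 t + - n%:R * flat_exp n.+1 t)) mulNr.
apply: Ck_onZ; first exact: openT.
by apply: Ck_onD; [exact: openT|exact: IH|apply: Ck_onZ; [exact: openT|exact: IH]].
Qed.

Lemma flat_exp0E t : 0 < t -> flat_exp 0 t = expR (- t^-1).
Proof. by move=> t0; rewrite flat_exp_pos// expr0 mul1r. Qed.

Lemma flat_exp0_gt0 t : 0 < t -> 0 < flat_exp 0 t.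
Proof. by move=> t0; rewrite flat_exp0E// expR_gt0. Qed.

Lemma flat_exp0_ge0 t : 0 <= flat_exp 0 t.
Proof.
by have [t0|t0] := leP t 0; [rewrite flat_exp_npos|exact/ltW/flat_exp0_gt0].
Qed.

Lemma flat_exp0_le1 t : flat_exp 0 t <= 1.
Proof.
have [t0|t0] := leP t 0; first by rewrite flat_exp_npos.
by rewrite flat_exp0E// expR_le1 oppr_le0 invr_ge0 ltW.
Qed.

Lemma flat_exp0_lt s t : 0 < t -> s < t -> flat_exp 0 s < flat_exp 0 t.
Proof.
move=> t0 st; have [s0|s0] := leP s 0.
  by rewrite flat_exp_npos// flat_exp0_gt0.
by rewrite !flat_exp0E// ltr_expR ltrN2 ltf_pV2.
Qed.

Lemma flat_exp0_le s t : s <= t -> flat_exp 0 s <= flat_exp 0 t.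
Proof.
rewrite le_eqVlt => /predU1P[->//|st].
have [t0|t0] := leP t 0; last exact/ltW/flat_exp0_lt.
by rewrite !flat_exp_npos// (le_trans (ltW st)).
Qed.

Lemma flat_exp0_lower t : 0 < t -> 1 - t^-1 <= flat_exp 0 t.
Proof. by move=> t0; rewrite flat_exp0E// expR_ge1Dx. Qed.

End FlatExp.

(** * Smooth functions on the group *)

Lemma open_preimage_within (T1 T2 : topologicalType) (D : set T1)
    (g : T1 -> T2) (O : set T2) :
  open D -> (forall v, D v -> {for v, continuous g}) -> open O ->
  open (D `&` g @^-1` O).
Proof.
move=> oD cg oO; rewrite openE => v [Dv Ov]; rewrite /interior.
apply: filterI; first exact: open_nbhs_nbhs.
by apply: cg => //; exact: open_nbhs_nbhs.
Qed.

Section Manifold.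
Context {R : realType} {d : nat} {G : lieGroupType R d}.
Implicit Types (f : G -> R) (phi psi : chart R d G).

Lemma smooth_continuous f : smooth f -> continuous f.
Proof.
move=> sf p; have [phi aphi php] := atlas_cover p.
have E : \forall q \near p, (f \o chart_inv phi \o chart_fun phi) q = f q.
  have : nbhs p (chart_dom phi) by apply: open_nbhs_nbhs; split => //; exact: open_chart_dom.
  by apply: filterS => q phq /=; rewrite chart_funK.
rewrite /continuous_at -(nbhs_singleton E).
apply: cvg_trans (near_eq_cvg E) _.
apply: (@continuous_comp _ _ _ (chart_fun phi)); first exact: chart_fun_continuous.
exact: (sf _ aphi 0) (chart_funS php).
Qed.

Lemma smooth_comp_into (V : normedModType R) (D : set V) (g : V -> G) f :
  open D -> smooth_into D g -> smooth f -> smooth_on D (f \o g).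
Proof.
move=> oD [cg sg] sf k; apply: Ck_on_pointwise => v Dv.
have [phi aphi phv] := atlas_cover (g v).
have oD' : open (D `&` g @^-1` chart_dom phi).
  by apply: open_preimage_within => //; exact: open_chart_dom.
exists (D `&` g @^-1` chart_dom phi) => //.
apply: (@eq_Ck_on _ _ _ _ _ ((f \o chart_inv phi) \o (chart_fun phi \o g))) => //.
  by move=> x [_ /= phx]; rewrite chart_funK.
apply: (Ck_on_comp_rV (D1 := chart_cod phi)) => //.
- exact: open_chart_cod.
- exact: sg.
- exact: sf.
- by move=> x [_ phx]; exact: chart_funS.
Qed.

Lemma open_chart_codX phi psi : open (chart_cod phi `*` chart_cod psi).
Proof.
rewrite openE => -[z w] [/= pz pw]; exists (chart_cod phi, chart_cod psi) => //=.
by split; apply: open_nbhs_nbhs; split => //; exact: open_chart_cod.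
Qed.

Lemma mul_chart_smooth f phi psi : atlas phi -> atlas psi -> smooth f ->
  smooth_on (chart_cod phi `*` chart_cod psi)
    (fun z => f (chart_inv phi z.1 * chart_inv psi z.2)%g).
Proof.
move=> aphi apsi sf.
have := smooth_comp_into (@open_chart_codX phi psi) (@mulg_smooth _ _ G phi psi aphi apsi) sf.
exact.
Qed.

(** Writes the slice z |-> (a, z) as an affine combination, ready for [Ck_on_comp]. *)
Lemma sum_delta_pair0 (a z : 'rV[R]_d) :
  (a, 0) + \sum_(i < d) z 0 i *: ((0, delta_mx 0 i) : 'rV[R]_d * 'rV[R]_d) =
  (a, z).
Proof.
have -> : \sum_(i < d) z 0 i *: ((0, delta_mx 0 i) : 'rV[R]_d * 'rV[R]_d) = (0, z).
  rewrite {2}(row_sum_delta z).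
  elim/big_rec2: _ => [//|i u v _ ->].
  by rewrite -[LHS]/(z 0 i *: 0 + 0, z 0 i *: delta_mx 0 i + u) scaler0 add0r.
by rewrite -[LHS]/(a + 0, 0 + z) addr0 add0r.
Qed.

Lemma sum_delta_0pair (a z : 'rV[R]_d) :
  (0, a) + \sum_(i < d) z 0 i *: ((delta_mx 0 i, 0) : 'rV[R]_d * 'rV[R]_d) =
  (z, a).
Proof.
have -> : \sum_(i < d) z 0 i *: ((delta_mx 0 i, 0) : 'rV[R]_d * 'rV[R]_d) = (z, 0).
  rewrite {2}(row_sum_delta z).
  elim/big_rec2: _ => [//|i u v _ ->].
  by rewrite -[LHS]/(z 0 i *: delta_mx 0 i + u, z 0 i *: 0 + 0) scaler0 add0r.
by rewrite -[LHS]/(0 + z, a + 0) addr0 add0r.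
Qed.

Lemma smooth_translate f (s : G) : smooth f -> smooth (fun g => f (s * g)%g).
Proof.
move=> sf phi aphi k; have [psi apsi pss] := atlas_cover s.
pose m (z : 'rV[R]_d * 'rV[R]_d) := f (chart_inv psi z.1 * chart_inv phi z.2)%g.
(* In charts, left translation is the product map with the first argument frozen at the coordinates
   of s. *)
apply: (@eq_Ck_on _ _ _ _ _ (fun z =>
   m ((chart_fun psi s, 0) + \sum_(i < d) rV_coord i z *: (0, delta_mx 0 i)))).
- exact: open_chart_cod.
- by move=> z _; rewrite /rV_coord sum_delta_pair0 /m /= chart_funK.
apply: (@Ck_on_comp _ _ _ _ _ _ (fun i => rV_coord i) k m _
  (chart_cod psi `*` chart_cod phi)).
- exact: open_chart_cod.
- exact: open_chart_codX.
- by move=> i; apply: Ck_on_linear; exact: rV_coord_continuous.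
- exact: mul_chart_smooth.
- by move=> z pz; rewrite /rV_coord sum_delta_pair0; split => //; exact: chart_funS.
Qed.

Lemma mulg_continuousl (s : G) : continuous (fun g : G => (s * g)%g).
Proof.
move=> p; have [psi apsi pss] := atlas_cover s; have [phi aphi php] := atlas_cover p.
pose m (z : 'rV[R]_d) := (chart_inv psi (chart_fun psi s) * chart_inv phi z)%g.
have E : \forall q \near p, (m \o chart_fun phi) q = (s * q)%g.
  have : nbhs p (chart_dom phi) by apply: open_nbhs_nbhs; split => //; exact: open_chart_dom.
  by apply: filterS => q phq /=; rewrite /m !chart_funK.
rewrite /continuous_at -(nbhs_singleton E).
apply: cvg_trans (near_eq_cvg E) _.
apply: (@continuous_comp _ _ _ (chart_fun phi)); first exact: chart_fun_continuous.
have [cM _] := @mulg_smooth _ _ G psi phi apsi aphi.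
have /cM : (chart_cod psi `*` chart_cod phi) (chart_fun psi s, chart_fun phi p).
  by split; exact: chart_funS.
move=> c; apply: (@continuous_comp _ _ _ (fun z : 'rV[R]_d => (chart_fun psi s, z)) _ _ _ c).
rewrite /continuous_at /=.
have H := @cvg_pair _ _ _ (nbhs (chart_fun phi p)) (nbhs (chart_fun psi s))
  (nbhs (chart_fun phi p)) _ _ _ (cst (chart_fun psi s)) id
  (@cvg_cst _ _ _ _ _) (@cvg_id _ _).
exact: H.
Qed.

Lemma compact_support_subset f (K : set G) : compact K ->
  [set g | f g != 0] `<=` K -> compactly_supported f.
Proof.
move=> cK fK; apply: (subclosed_compact _ cK); first exact: closed_closure.
have /closure_id -> : closed K by apply: compact_closed => //; exact: manifold_hausdorff.
exact: closureS.
Qed.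

(** Unbundled counterpart of [testFun]: the functionals below act on plain functions, whose sums and
    products can be written pointwise. *)
Definition test f := smooth f /\ compactly_supported f.

Lemma testP (f : G -> R) : test f <-> f \in @test_pred _ _ G.
Proof. by rewrite inE. Qed.

Lemma test_translate f (s : G) : test f -> test (fun g => f (s * g)%g).
Proof.
move=> [sf cf]; split; first exact: smooth_translate.
apply: (@compact_support_subset _ ((fun g => s^-1 * g)%g @` closure [set g | f g != 0])).
  apply: continuous_compact => //; apply: continuous_subspaceT.
  exact: mulg_continuousl.
move=> g /= fg; exists (s * g)%g; last by rewrite mulKg.
exact: subset_closure.
Qed.

Lemma smoothD f1 f2 : smooth f1 -> smooth f2 -> smooth (fun g => f1 g + f2 g).
Proof.
move=> s1 s2 phi aphi k.
exact: (Ck_onD (open_chart_cod phi) (s1 _ aphi k) (s2 _ aphi k)).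
Qed.

Lemma smoothM f1 f2 : smooth f1 -> smooth f2 -> smooth (fun g => f1 g * f2 g).
Proof.
move=> s1 s2 phi aphi k.
exact: (Ck_onM (open_chart_cod phi) (s1 _ aphi k) (s2 _ aphi k)).
Qed.

Lemma smooth_cst (a : R) : smooth (fun _ : G => a).
Proof. by move=> phi aphi k; exact: Ck_on_cst. Qed.

Lemma smooth_compR (h : R -> R) f : (forall k, Ck_on k setT h) -> smooth f ->
  smooth (fun g => h (f g)).
Proof.
move=> sh sf phi aphi k.
apply: (@Ck_on_comp_R _ _ k (f \o chart_inv phi) h _ setT) => //.
- exact: open_chart_cod.
- exact: openT.
- exact: sf.
Qed.

Lemma testD f1 f2 : test f1 -> test f2 -> test (fun g => f1 g + f2 g).
Proof.
move=> [s1 c1] [s2 c2]; split; first exact: smoothD.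
apply: (compact_support_subset (compactU c1 c2)) => g /= fg.
have [f1g|f1g] := eqVneq (f1 g) 0; last by left; exact: subset_closure.
by right; apply: subset_closure => /=; rewrite f1g add0r in fg.
Qed.

Lemma testMl f1 f2 : test f1 -> smooth f2 -> test (fun g => f1 g * f2 g).
Proof.
move=> [s1 c1] s2; split; first exact: smoothM.
apply: (compact_support_subset c1) => g /= fg; apply: subset_closure => /=.
by apply: contra_neq fg => ->; rewrite mul0r.
Qed.

Lemma testZ (a : R) f : test f -> test (fun g => a * f g).
Proof.
move=> tf; have := testMl tf (smooth_cst a).
by congr test; apply/funext => g; rewrite mulrC.
Qed.

Lemma test_cst0 : test (fun _ : G => 0).
Proof.
split; first exact: smooth_cst.
by apply: (compact_support_subset compact0) => g /=; rewrite eqxx.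
Qed.

Lemma testN f : test f -> test (fun g => - f g).
Proof.
move=> /(testZ (-1)); congr test; apply/funext => g; exact: mulN1r.
Qed.

Lemma testB f1 f2 : test f1 -> test f2 -> test (fun g => f1 g - f2 g).
Proof. by move=> t1 t2; apply: testD => //; exact: testN. Qed.

Lemma test_sum (I : Type) (s : seq I) (F : I -> G -> R) :
  (forall i, test (F i)) -> test (fun g => \sum_(i <- s) F i g).
Proof.
move=> tF; elim: s => [|i s IH].
  have := test_cst0; congr test; apply/funext => g; by rewrite big_nil.
have := testD (tF i) IH; congr test; apply/funext => g; by rewrite big_cons.
Qed.

Lemma test_testFun (x : testFun G) : test x.
Proof. by apply/testP; exact: test_valP. Qed.

Lemma test_bounded f : test f -> exists2 M, 0 < M & forall g, `|f g| <= M.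
Proof.
move=> [sf cf].
have cK : compact (f @` closure [set g | f g != 0]).
  apply: continuous_compact => //; apply: continuous_subspaceT.
  exact: smooth_continuous.
have /= [M [_ HM]] := compact_bounded cK.
exists (`|M| + 1); first by rewrite ltr_wpDl.
move=> g; have [->|fg] := eqVneq (f g) 0; first by rewrite normr0 addr_ge0.
apply: HM; first by rewrite (le_lt_trans (ler_norm M))// ltrDl.
by exists g => //; exact: subset_closure.
Qed.

End Manifold.

(** * Bump functions on R^d *)

Section Bump1.
Context {R : realType}.

(** The factor e normalises the maximum, attained at 0, to 1. *)
Definition bump1 (t : R) : R := expR 1 * flat_exp 0 (1 - t ^+ 2).

Lemma bump1_0 : bump1 0 = 1.
Proof.
by rewrite /bump1 expr0n /= subr0 flat_exp0E// invr1 expRN mulfV// gt_eqF// expR_gt0.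
Qed.

Lemma bump1_ge0 t : 0 <= bump1 t.
Proof. by rewrite mulr_ge0 ?expR_ge0// flat_exp0_ge0. Qed.

Lemma bump1_lt1 t : t != 0 -> bump1 t < 1.
Proof.
move=> t0; rewrite -[ltRHS]bump1_0 /bump1 ltr_pM2l ?expR_gt0//.
rewrite expr0n /= subr0; apply: flat_exp0_lt => //.
by rewrite ltrBlDr ltrDl exprn_even_gt0.
Qed.

Lemma bump1_le1 t : bump1 t <= 1.
Proof.
by have [->|/bump1_lt1/ltW//] := eqVneq t 0; rewrite bump1_0.
Qed.

Lemma bump1_supp t : bump1 t != 0 -> `|t| <= 1.
Proof.
apply: contra_neqT; rewrite -ltNge => t1; rewrite /bump1 flat_exp_npos ?mulr0//.
by rewrite subr_le0 -real_normK ?num_real// expr_ge1// ltW.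
Qed.

Lemma Ck_on_bump1 k : Ck_on k setT bump1.
Proof.
suff cf : Ck_on k setT (fun t : R => flat_exp 0 (1 - t ^+ 2)).
  exact: (Ck_onZ (expR 1) openT cf).
have cid : Ck_on k setT (id : R -> R).
  by apply: (@Ck_on_linear _ _ idfun) => x; exact: cvg_id.
apply: (@Ck_on_comp_R _ _ _ (fun t : R => 1 - t ^+ 2) _ _ setT) => //.
- exact: openT.
- exact: openT.
- have := Ck_onD openT (Ck_on_cst k setT (1 : R))
    (Ck_onZ (-1) openT (Ck_onM openT cid cid)).
  congr Ck_on; apply/funext => t.
  by rewrite -[LHS]/(1 + (-1) * (t * t)) mulN1r expr2.
- exact: Ck_on_flat_exp.
Qed.

Lemma Ck_on_bigprod (V : normedModType R) (I : Type) (s : seq I)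
    (h : I -> V -> R) k (D : set V) : open D ->
  (forall i, Ck_on k D (h i)) -> Ck_on k D (fun y => \prod_(i <- s) h i y).
Proof.
move=> oD ch; elim: s => [|i s IH].
  have := Ck_on_cst k D (1 : R); congr Ck_on; apply/funext => y.
  by rewrite big_nil.
have := Ck_onM oD (ch i) IH; congr Ck_on; apply/funext => y.
by rewrite big_cons.
Qed.

(** A product over the coordinates is supported in a cube, which is a ball of the maximum norm and
    compact as a product of segments. *)
Definition cube_bump d (z0 : 'rV[R]_d) (r : R) (z : 'rV[R]_d) : R :=
  \prod_(i < d) bump1 ((z 0 i - z0 0 i) / r).

Lemma Ck_on_cube_bump d (z0 : 'rV[R]_d) (r : R) k :
  Ck_on k setT (cube_bump z0 r).
Proof.
apply: Ck_on_bigprod => [|i]; first exact: openT.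
apply: (@Ck_on_comp_R _ _ _ (fun z : 'rV[R]_d => (z 0 i - z0 0 i) / r) _ _ setT) => //.
- exact: openT.
- exact: openT.
- have := Ck_onZ (r^-1) openT (Ck_onD openT
    (Ck_on_linear k setT (@rV_coord_continuous R d i)) (Ck_on_cst k setT (- z0 0 i))).
  congr Ck_on; apply/funext => z.
  by rewrite -[LHS]/(r^-1 * (z 0 i - z0 0 i)) mulrC.
- exact: Ck_on_bump1.
Qed.

Lemma cube_bump_center d (z0 : 'rV[R]_d) (r : R) : cube_bump z0 r z0 = 1.
Proof. by rewrite /cube_bump big1// => i _; rewrite subrr mul0r bump1_0. Qed.

Lemma cube_bump_ge0 d (z0 : 'rV[R]_d) (r : R) z : 0 <= cube_bump z0 r z.
Proof. by apply: prodr_ge0 => i _; exact: bump1_ge0. Qed.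

Lemma cube_bump_lt1 d (z0 : 'rV[R]_d) (r : R) z : 0 < r ->
  z != z0 -> cube_bump z0 r z < 1.
Proof.
move=> r0 zz0; have [i zi] : exists i, z 0 i != z0 0 i.
  apply/existsP; apply: contra_neqT zz0 => /existsPn H.
  by apply/rowP => i; apply/eqP; have := H i; rewrite negbK.
rewrite /cube_bump (bigD1 i)//=.
apply: (@le_lt_trans _ _ (bump1 ((z 0 i - z0 0 i) / r))).
  rewrite ler_piMr ?bump1_ge0//; apply: prodr_ile1 => j _.
  by rewrite bump1_ge0 bump1_le1.
by apply: bump1_lt1; rewrite mulf_neq0 ?subr_eq0// invr_eq0 gt_eqF.
Qed.

Lemma cube_bump_supp d (z0 : 'rV[R]_d) (r : R) z : 0 < r ->
  cube_bump z0 r z != 0 -> forall i, `|z 0 i - z0 0 i| <= r.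
Proof.
move=> r0 /prodf_neq0 H i; have /bump1_supp := H i isT.
by rewrite normrM normfV (gtr0_norm r0) ler_pdivrMr// mul1r.
Qed.

Lemma compact_cube d (z0 : 'rV[R]_d) (r : R) :
  compact [set z : 'rV[R]_d | forall i, `|z 0 i - z0 0 i| <= r].
Proof.
have := @rV_compact R d (fun i => `[z0 0 i - r, z0 0 i + r]%classic).
rewrite [X in compact X](_ : _ = [set z : 'rV[R]_d | forall i, `|z 0 i - z0 0 i| <= r]).
  by apply=> i; exact: segment_compact.
by apply/seteqP; split => z /= H i; have := H i; rewrite in_itv /= ler_distl.
Qed.

End Bump1.

(** * Bump functions on the group *)

Section Bump.
Context {R : realType} {d : nat} {G : lieGroupType R d}.

(** A cube bump is carried over by a chart and extended by 0. That the maximum at p is strict serves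
    [punctured_exhaustion], where 1 has to be told apart from every other point. *)
Lemma bump_exists (p : G) (O : set G) : open O -> O p ->
  exists eta : G -> R, [/\ test eta, eta p = 1, forall g, g != p -> eta g < 1,
    forall g, 0 <= eta g & forall g, eta g != 0 -> O g].
Proof.
move=> oO Op; have [phi aphi php] := atlas_cover p.
set z0 := chart_fun phi p.
have W0 : nbhs z0 (chart_cod phi `&` chart_inv phi @^-1` O).
  apply: open_nbhs_nbhs; split.
    apply: open_preimage_within => //; first exact: open_chart_cod.
    by move=> z; exact: chart_inv_continuous.
  by split; [exact: chart_funS|rewrite /= chart_funK].
have /nbhs_ballP[r /= r0 rW] := W0.
(* Half the radius puts the closed cube inside the open ball. *)
pose s := r / 2.
have s0 : 0 < s by rewrite divr_gt0.
pose Q := [set z : 'rV[R]_d | forall i, `|z 0 i - z0 0 i| <= s].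
have QW : Q `<=` chart_cod phi `&` chart_inv phi @^-1` O.
  move=> z Qz; apply: rW; rewrite -ball_normE /=.
  have [->//|/mx_norm_neq0[[i j]]] := eqVneq `|z0 - z| 0.
  move=> /= E; have -> : `|z0 - z| = `|(z0 - z) i j| by exact: E.
  rewrite (ord1 i) !mxE distrC.
  by apply: (le_lt_trans (Qz j)); rewrite /s ltr_pdivrMr// mulr_natr mulr2n ltrDl.
pose K := chart_inv phi @` Q.
have cK : compact K.
  apply: continuous_compact; last exact: compact_cube.
  apply: continuous_in_subspaceT => z /[1!inE] /QW[cz _].
  exact: chart_inv_continuous.
have clK : closed K by apply: compact_closed => //; exact: manifold_hausdorff.
pose eta (g : G) := if `[< chart_dom phi g >] then cube_bump z0 s (chart_fun phi g) else 0.
have etaK g : eta g != 0 -> K g.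
  rewrite /eta; case: asboolP => [phg|_]; last by rewrite eqxx.
  move=> /(cube_bump_supp s0) Qg; exists (chart_fun phi g) => //.
  by rewrite chart_funK.
have KO : K `<=` O by move=> _ [z /QW[_ Oz] <-].
exists eta; split.
- split; last exact: compact_support_subset cK etaK.
  move=> psi apsi k; apply: Ck_on_pointwise => z cz.
  (* Inside the chart domain eta is a bump after a change of charts; elsewhere the point lies off K,
     which is closed as a compact set in a Hausdorff space, and eta vanishes off K. *)
  have [pz|npz] := pselect (chart_dom phi (chart_inv psi z)).
  + exists (chart_cod psi `&` chart_inv psi @^-1` chart_dom phi) => //.
    have oD : open (chart_cod psi `&` chart_inv psi @^-1` chart_dom phi).
      apply: open_preimage_within => [|v|]; first exact: open_chart_cod.
        exact: chart_inv_continuous.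
      exact: open_chart_dom.
    apply: (@eq_Ck_on _ _ _ _ _ (cube_bump z0 s \o (chart_fun phi \o chart_inv psi))) => //.
      by move=> w [cw pw] /=; rewrite /eta asboolT.
    apply: (Ck_on_comp_rV (D1 := setT)) => //; first exact: openT.
      exact: atlas_compatible.
    exact: Ck_on_cube_bump.
  + exists (chart_cod psi `&` chart_inv psi @^-1` (~` K)).
      split=> // -[w /QW[cw _] wz]; apply: npz; rewrite -wz; exact: chart_invS.
    apply: (@eq_Ck_on _ _ _ _ _ (cst 0)).
    * apply: open_preimage_within => [|v|]; first exact: open_chart_cod.
        exact: chart_inv_continuous.
      exact: closed_openC.
    * move=> w [cw Kw] /=; apply/esym/eqP/negPn/negP => /etaK; exact: Kw.
    * exact: Ck_on_cst.
- by rewrite /eta asboolT// cube_bump_center.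
- move=> g gp; rewrite /eta; case: asboolP => // phg.
  apply: cube_bump_lt1 => //; apply: contra_neq gp => E.
  by rewrite -(chart_funK phg) E chart_funK.
- by move=> g; rewrite /eta; case: asboolP => // _; exact: cube_bump_ge0.
- by move=> g /etaK/KO.
Qed.

(** Second countability lets a sequence of test functions suffice, so that every open set is a
    countable union of sets {beta > 0}. *)
Lemma bump_cover (O : set G) : open O ->
  exists beta : nat -> G -> R,
    [/\ forall n, test (beta n), forall n g, 0 <= beta n g <= 1,
      forall n g, beta n g != 0 -> O g &
      forall g, O g -> exists n, 0 < beta n g].
Proof.
move=> oO; have [B cB [oB bB]] := @manifold_second_countable R d G.
pose good (b : set G) (be : G -> R) := [/\ test be, forall g, 0 <= be g <= 1,
  forall g, be g != 0 -> O g & forall g, b g -> 0 < be g].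
have [e he] : exists e : nat -> set G, forall b, B b -> exists n, e n = b.
  have [->|/set0P[b0 Bb0]] := eqVneq B set0.
    by exists (fun _ => set0) => b.
  have /countable_injP[f injf] := cB.
  exists (fun n => if pselect (exists2 b, B b & f b = n) is left p
    then projT1 (cid2 p) else set0).
  move=> b Bb; exists (f b); case: pselect => [p|]; last by case; exists b.
  case: (cid2 p) => c Bc fc /=; apply: injf => //; exact/mem_set.
pose zero (g : G) : R := 0.
(* A basic set with no such function contributes the zero function. Every point of O lies in a basic
   set that has one: any basic neighbourhood inside {eta > 0} for a bump eta at that point. *)
exists (fun n => if pselect (exists be, good (e n) be) is left p
  then projT1 (cid p) else zero).
split.
- move=> n; case: pselect => [p|_]; last exact: test_cst0.
  by case: (cid p) => be [].
- move=> n g; case: pselect => [p|_]; last by rewrite lexx ler01.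
  by case: (cid p) => be [].
- move=> n g; case: pselect => [p|_]; last by rewrite eqxx.
  by case: (cid p) => be [? ? H' ?] /= /H'.
- move=> g Og; have [eta [te e1 el e0 eO]] := bump_exists oO Og.
  have oE : nbhs g [set h | 0 < eta h].
    have /(_ g) cg := smooth_continuous te.1.
    by apply: (cg [set t | 0 < t]); rewrite e1; exact: lt_nbhsr.
  have [b /= [Bb bg] bE] := bB _ _ oE.
  have [n en] := he _ Bb; exists n; case: pselect => [p|np].
    by case: (cid p) => be [? ? ? H'] /=; apply: H'; rewrite en.
  exfalso; apply: np; exists eta; split => // [h|h].
    rewrite e0 /=; have [->|/el/ltW//] := eqVneq h g.
    by rewrite e1.
  by rewrite en => /bE.
Qed.

End Bump.

(** * Canonical coordinates *)

Section CanonicalCoordinates.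
Context {R : realType} {d : nat} {G : lieGroupType R d}.
Variables (X : 'I_d -> lieAlgebra G) (U : set G) (x : 'I_d -> testFun G).
Hypothesis hx : canonical_coordinates X U x.

Let V : set 'rV[R]_d := coord_map x @` U.

Lemma canonical_chart_exists : exists y : 'rV[R]_d -> G,
  [/\ smooth_into V y, forall g, U g -> y (coord_map x g) = g,
      forall z, V z -> U (y z) & forall z, V z -> coord_map x (y z) = z].
Proof.
have [_ _ _ [y sy yK] _] := hx; exists y; split => // z [g Ug <-].
  by rewrite yK.
by rewrite yK.
Qed.

Definition canonical_chart : 'rV[R]_d -> G := projT1 (cid canonical_chart_exists).

Local Notation y := canonical_chart.

Lemma canonical_chart_smooth : smooth_into V y.
Proof. by rewrite /y; case: cid => ? []. Qed.

Lemma canonical_chartK g : U g -> y (coord_map x g) = g.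
Proof. by rewrite /y; case: cid => ? [] ? H ? ? /=; exact: H. Qed.

Lemma canonical_chartU z : V z -> U (y z).
Proof. by rewrite /y; case: cid => ? [] ? ? H ? /=; exact: H. Qed.

Lemma coord_mapK z : V z -> coord_map x (y z) = z.
Proof. by rewrite /y; case: cid => ? [] ? ? ? H /=; exact: H. Qed.

Lemma open_canonical_cod : open V.
Proof. by have [_ _ oV _ _] := hx. Qed.

Lemma canonical_cod0 : V 0.
Proof. by have [[_ U1] c1 _ _ _] := hx; exists 1%g. Qed.

Lemma canonical_dom1 : U 1%g.
Proof. by have [[_ U1] _ _ _ _] := hx. Qed.

Lemma open_canonical_dom : open U.
Proof. by have [[oU _] _ _ _ _] := hx. Qed.

Lemma coord1 i : x i 1%g = 0.
Proof.
have [_ c1 _ _ _] := hx.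
by have /rowP/(_ i) := c1; rewrite !mxE.
Qed.

Lemma canonical_chart0 : y 0 = 1%g.
Proof.
have [[_ U1] c1 _ _ _] := hx.
by rewrite -c1 canonical_chartK.
Qed.

Lemma nbhs_canonical_cod0 : nbhs (0 : 'rV[R]_d) V.
Proof.
apply: open_nbhs_nbhs; split; [exact: open_canonical_cod|exact: canonical_cod0].
Qed.

Lemma smooth_chart f : smooth f -> smooth_on V (f \o y).
Proof.
by move=> sf; apply: smooth_comp_into => //;
  [exact: open_canonical_cod|exact: canonical_chart_smooth].
Qed.

Lemma smooth_chart_translate f g : smooth f -> smooth_on V (fun w => f (g * y w)%g).
Proof. by move=> /(smooth_translate g)/smooth_chart. Qed.

Lemma differentiable_chart_translate f g w : smooth f -> V w ->
  differentiable (fun w => f (g * y w)%g) w.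
Proof.
by move=> sf Vw; have [+ _] := smooth_chart_translate g sf 1; exact.
Qed.

(* Near 0 the canonical coordinates identify lie_exp (u *: X k) with the point
   of coordinates u e_k, so that neither existence nor uniqueness of
   one-parameter subgroups is needed. *)
Lemma left_fieldE k f g : smooth f ->
  left_field (X k) f g = 'D_(delta_mx 0 k) (fun w => f (g * y w)%g) 0.
Proof.
move=> sf; rewrite /left_field derive1E.
have dF := differentiable_chart_translate g sf canonical_cod0.
transitivity ('D_1 (fun u : R => f (g * y (u *: delta_mx 0 k))%g) 0); last first.
  have := @is_derive_line _ _ (fun w => f (g * y w)%g) (delta_mx 0 k) 0.
  by rewrite scale0r => /(_ dF) /@derive_val.
apply: near_eq_derive.
have H : {for (0 : R), continuous (fun t : R => t *: (delta_mx 0 k : 'rV[R]_d))}.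
  exact: scalel_continuous.
have : \forall u \near (0 : R), V (u *: delta_mx 0 k).
  by apply: H; rewrite /= scale0r; exact: nbhs_canonical_cod0.
apply: filterS => u [h Uh hu].
rewrite -hu canonical_chartK//; congr (f (g * _)%g).
have [_ _ _ _ /(_ _ Uh) ->] := hx; congr lie_exp.
rewrite (bigD1 k)//= big1 ?addr0 => [|i ik].
  by have /rowP/(_ k) := hu; rewrite !mxE !eqxx/= mulr1 => ->.
by have /rowP/(_ i) := hu; rewrite !mxE (negbTE ik) andbF mulr0 => ->; rewrite scale0r.
Qed.

Lemma left_field_translate k f s g : left_field (X k) (fun h => f (s * h)%g) g =
  left_field (X k) f (s * g)%g.
Proof.
rewrite /left_field; apply: (congr1 (fun F : R -> R => derive1 F 0)).
by apply/funext => u; rewrite mulgA.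
Qed.

Lemma Ck_on_coord_pair k (D : set ('rV[R]_d * 'rV[R]_d)) i :
  Ck_on k D (fun z => z.1 0 i) /\ Ck_on k D (fun z => z.2 0 i).
Proof.
have l1 : linear (fun z : 'rV[R]_d * 'rV[R]_d => z.1 0 i).
  by move=> a u v; rewrite /= !mxE.
have l2 : linear (fun z : 'rV[R]_d * 'rV[R]_d => z.2 0 i).
  by move=> a u v; rewrite /= !mxE.
pose m1 := GRing.isLinear.Build _ _ _ _ _ l1.
pose m2 := GRing.isLinear.Build _ _ _ _ _ l2.
pose L1 : {linear _ -> _} := HB.pack (fun z : 'rV[R]_d * 'rV[R]_d => z.1 0 i) m1.
pose L2 : {linear _ -> _} := HB.pack (fun z : 'rV[R]_d * 'rV[R]_d => z.2 0 i) m2.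
split.
- apply: (@Ck_on_linear _ _ L1) => z.
  apply: (@continuous_comp _ _ _ fst (rV_coord i)); first exact: cvg_fst.
  exact: rV_coord_continuous.
- apply: (@Ck_on_linear _ _ L2) => z.
  apply: (@continuous_comp _ _ _ snd (rV_coord i)); first exact: cvg_snd.
  exact: rV_coord_continuous.
Qed.

Lemma Ck_on_snd k (D : set 'rV[R]_d) (E : set ('rV[R]_d * 'rV[R]_d))
    (g : 'rV[R]_d -> R) : open D -> open E -> Ck_on k D g ->
  (forall z, E z -> D z.2) -> Ck_on k E (fun z => g z.2).
Proof.
move=> oD oE cg ED.
apply: (@eq_Ck_on _ _ _ _ _ (fun z : 'rV[R]_d * 'rV[R]_d =>
   g (0 + \sum_(i < d) (fun (i : 'I_d) (z : 'rV[R]_d * 'rV[R]_d) => z.2 0 i) i z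
          *: delta_mx 0 i))) => //.
  by move=> z _; rewrite /= -row_affine_comb.
apply: (Ck_on_comp (D1 := D)) => //.
  by move=> i; exact: (Ck_on_coord_pair _ _ _).2.
by move=> z Ez; rewrite -row_affine_comb; exact: ED.
Qed.

Lemma open_codX (phi : chart R d G) : open (chart_cod phi `*` V).
Proof.
rewrite openE => -[z w] [/= pz pw]; exists (chart_cod phi, V) => //=.
split; apply: open_nbhs_nbhs; split => //; [exact: open_chart_cod|exact: open_canonical_cod].
Qed.

(** Smoothness of the product is given in atlas charts, and the canonical chart need not be one of
    them; near each w it is therefore expressed through an atlas chart around y w. *)
Lemma mul_canonical_smooth f (phi : chart R d G) : atlas phi -> smooth f ->
  smooth_on (chart_cod phi `*` V)
    (fun z : 'rV[R]_d * 'rV[R]_d => f (chart_inv phi z.1 * y z.2)%g).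
Proof.
move=> aphi sf k; apply: Ck_on_pointwise => -[z w] [/= cz Vw].
have [psi apsi pw] := atlas_cover (y w).
have [cy sy] := canonical_chart_smooth.
pose W := V `&` y @^-1` chart_dom psi.
have oW : open W.
  apply: open_preimage_within => //; first exact: open_canonical_cod.
  exact: open_chart_dom.
have oD : open (chart_cod phi `*` W).
  rewrite openE => -[z' w'] [/= pz' pw']; exists (chart_cod phi, W) => //=.
  by split; apply: open_nbhs_nbhs; split => //; exact: open_chart_cod.
exists (chart_cod phi `*` W) => //.
pose m (z : 'rV[R]_d * 'rV[R]_d) := f (chart_inv phi z.1 * chart_inv psi z.2)%g.
pose c (i : 'I_d + 'I_d) (z : 'rV[R]_d * 'rV[R]_d) : R :=
  match i with inl i => z.1 0 i | inr i => chart_fun psi (y z.2) 0 i end.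
pose e (i : 'I_d + 'I_d) : 'rV[R]_d * 'rV[R]_d :=
  match i with inl i => (delta_mx 0 i, 0) | inr i => (0, delta_mx 0 i) end.
have E u : 0 + \sum_i c i u *: e i = (u.1, chart_fun psi (y u.2)).
  rewrite add0r big_sumType /=.
  have := sum_delta_0pair 0 u.1; rewrite [(0, 0)]/(0 : 'rV[R]_d * 'rV[R]_d) add0r => ->.
  exact: sum_delta_pair0.
apply: (@eq_Ck_on _ _ _ _ _ (fun u => m (0 + \sum_i c i u *: e i))) => //.
  by move=> u [_ [_ pu]]; rewrite E /m /= chart_funK.
apply: (@Ck_on_comp _ _ _ _ _ _ c k m _ (chart_cod phi `*` chart_cod psi)) => //.
- exact: open_chart_codX.
- case=> i; first exact: (Ck_on_coord_pair _ _ _).1.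
  apply: (@Ck_on_snd k W _ (fun w => chart_fun psi (y w) 0 i)) => //.
  + apply: Ck_on_rV_coord => //; exact: sy.
  + by move=> u [].
- exact: mul_chart_smooth.
- by move=> u [cu [_ pu]]; rewrite E; split => //=; exact: chart_funS.
Qed.

(** In a chart, X_k f is a partial derivative in the second variable of the smooth function m of two
    variables, restricted to the slice where that variable is 0. *)
Lemma left_field_smooth k f : smooth f -> smooth (left_field (X k) f).
Proof.
move=> sf phi aphi n.
pose m (z : 'rV[R]_d * 'rV[R]_d) := f (chart_inv phi z.1 * y z.2)%g.
pose m' : 'rV[R]_d * 'rV[R]_d -> R := 'D_((0, delta_mx 0 k)) m.
apply: (@eq_Ck_on _ _ _ _ _ (fun z =>
   m' ((0, 0) + \sum_(i < d) rV_coord i z *: (delta_mx 0 i, 0)))).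
- exact: open_chart_cod.
- move=> z cz; rewrite /rV_coord sum_delta_0pair /= left_fieldE// /m' /derive.
  apply: (congr1 (fun F : R -> R => lim (F @ 0^'))); apply/funext => h.
  by rewrite /m /= scaler0 !add0r.
apply: (@Ck_on_comp _ _ _ _ _ _ (fun i => rV_coord i) n m' _ (chart_cod phi `*` V)).
- exact: open_chart_cod.
- exact: open_codX.
- by move=> i; apply: Ck_on_linear; exact: rV_coord_continuous.
- by have [_] := mul_canonical_smooth aphi sf n.+1; exact.
- move=> z cz; rewrite /rV_coord sum_delta_0pair; split => //.
  exact: canonical_cod0.
Qed.

(** Partial derivatives at 1 in canonical coordinates; [hcoord] takes the k-th derivative first. *)
Definition dcoord (i : 'I_d) (f : G -> R) : R := 'D_(delta_mx 0 i) (f \o y) 0.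
Definition hcoord (j k : 'I_d) (f : G -> R) : R :=
  'D_(delta_mx 0 j) ('D_(delta_mx 0 k) (f \o y)) 0.

Lemma left_field1 k f : smooth f -> left_field (X k) f 1%g = dcoord k f.
Proof.
move=> sf; rewrite left_fieldE// /dcoord.
apply: (congr1 (fun F => 'D_(delta_mx 0 k) F (0 : 'rV[R]_d))).
by apply/funext => w /=; rewrite mul1g.
Qed.

(** Chain rule: on U the function f factors through the coordinates, so X_k is determined by its
    values on them. The formula holds on all of U and can thus be differentiated once more. *)
Lemma left_field_coord k f g : smooth f -> U g ->
  left_field (X k) f g =
  \sum_(i < d) 'D_(delta_mx 0 i) (f \o y) (coord_map x g) * left_field (X k) (x i) g.
Proof.
move=> sf Ug; rewrite left_fieldE//.
have sx i : smooth (x i) by case: (test_testFun (x i)).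
have cg w : V w -> {for w, continuous (fun w => (g * y w)%g)}.
  move=> Vw; apply: (@continuous_comp _ _ _ y (fun h => g * h)%g).
    by have [cy _] := canonical_chart_smooth; exact: cy.
  exact: mulg_continuousl.
have VU : \forall w \near (0 : 'rV[R]_d), U (g * y w)%g.
  apply: (cg _ canonical_cod0); rewrite /= canonical_chart0 mulg1.
  by apply: open_nbhs_nbhs; split => //; exact: open_canonical_dom.
rewrite (@near_eq_derive _ _ _ _ ((f \o y) \o (fun w => coord_map x (g * y w)%g))); last first.
  by apply: filterS VU => w Uw /=; rewrite canonical_chartK.
have cg0 : coord_map x (g * y 0)%g = coord_map x g by rewrite canonical_chart0 mulg1.
rewrite derive_comp_rV.
- rewrite cg0; apply: eq_bigr => i _; rewrite mulrC left_fieldE//.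
  congr (_ * _); apply: (congr1 (fun F => 'D_(delta_mx 0 k) F (0 : 'rV[R]_d))).
  by apply/funext => w; rewrite mxE.
- move=> i; rewrite (_ : (fun _ => _) = (fun w => x i (g * y w)%g)); last first.
    by apply/funext => w; rewrite mxE.
  exact: differentiable_chart_translate canonical_cod0.
- rewrite cg0; have [+ _] := smooth_chart sf 1; apply.
  by exists g.
Qed.

Lemma coord_chart i z : V z -> x i (y z) = z 0 i.
Proof. by move=> /coord_mapK/rowP/(_ i); rewrite mxE. Qed.

Lemma near_coord_chart i z : V z -> \forall w \near z, (x i \o y) w = rV_coord i w.
Proof.
move=> Vz; have : nbhs z V by apply: open_nbhs_nbhs; split => //; exact: open_canonical_cod.
by apply: filterS => w Vw /=; rewrite coord_chart.
Qed.

Lemma derive_coord_chart i k z : V z ->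
  'D_(delta_mx 0 k) (x i \o y) z = (i == k)%:R.
Proof.
move=> Vz; rewrite (near_eq_derive _ (near_coord_chart i Vz)).
rewrite deriveE; last exact/linear_differentiable/rV_coord_continuous.
have -> : 'd (rV_coord i) z = rV_coord i :> ('rV[R]_d -> R).
  by apply: diff_lin; exact: rV_coord_continuous.
by rewrite /rV_coord mxE eqxx.
Qed.

Lemma dcoord_coord i k : dcoord k (x i) = (i == k)%:R.
Proof. by rewrite /dcoord derive_coord_chart//; exact: canonical_cod0. Qed.

Lemma hcoord_coord i j k : hcoord j k (x i) = 0.
Proof.
rewrite /hcoord (@near_eq_derive _ _ _ _ (cst ((i == k)%:R : R))) ?derive_cst//.
by apply: filterS nbhs_canonical_cod0 => z Vz; rewrite derive_coord_chart.
Qed.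

(** Comes from differentiating [left_field_coord] at 1, where X_k x_i is the Kronecker delta. The
    sum is the first order discrepancy between X_j X_k and the coordinate Hessian. *)
Lemma left_field2 j k f : smooth f ->
  left_field (X j) (left_field (X k) f) 1%g =
  hcoord j k f +
  \sum_(i < d) dcoord i f * left_field (X j) (left_field (X k) (x i)) 1%g.
Proof.
move=> sf; have sx i : smooth (x i) by case: (test_testFun (x i)).
rewrite left_field1; last exact: left_field_smooth.
rewrite /dcoord (@near_eq_derive _ _ _ _ (fun w => \sum_(i < d)
  ('D_(delta_mx 0 i) (f \o y) * (left_field (X k) (x i) \o y)) w)); last first.
  apply: filterS nbhs_canonical_cod0 => z Vz.
  rewrite /= left_field_coord//; last exact: canonical_chartU.
  by rewrite coord_mapK.
have V0 := canonical_cod0.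
have d1 i : derivable ('D_(delta_mx 0 i) (f \o y)) 0 (delta_mx 0 j).
  by apply: diff_derivable; have [_ /(_ (delta_mx 0 i))[+ _]] := smooth_chart sf 2; exact.
have d2 i : derivable (left_field (X k) (x i) \o y) 0 (delta_mx 0 j).
  apply: diff_derivable.
  by have [+ _] := smooth_chart (left_field_smooth k (sx i)) 1; exact.
have := @derive_val _ _ _ _ _ _ _ (is_derive_bigsum (index_enum 'I_d) (fun i =>
  is_deriveM (derivableP (d1 i)) (derivableP (d2 i)))).
move=> ->.
transitivity (\sum_(i < d) ((i == k)%:R * hcoord j i f +
    dcoord i f * left_field (X j) (left_field (X k) (x i)) 1%g)).
  apply: eq_bigr => i _.
  rewrite [RHS]addrC (left_field1 j (left_field_smooth k (sx i))).
  have -> : (i == k)%:R = (left_field (X k) (x i) \o y) 0.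
    by rewrite /= canonical_chart0 (left_field1 k (sx i)) dcoord_coord.
  by [].
rewrite big_split; apply: (congr2 +%R _ erefl).
rewrite (bigD1 k) //= eqxx mul1r big1 ?addr0 // => i ik.
by rewrite (negbTE ik) mul0r.
Qed.

Lemma differentiable_chart f : smooth f -> differentiable (f \o y) 0.
Proof. by move=> sf; have [+ _] := smooth_chart sf 1; apply; exact: canonical_cod0. Qed.

Lemma differentiable2_chart f k : smooth f ->
  differentiable ('D_(delta_mx 0 k) (f \o y)) 0.
Proof.
move=> sf; have [_ /(_ (delta_mx 0 k))[+ _]] := smooth_chart sf 2.
by apply; exact: canonical_cod0.
Qed.

Lemma near_differentiable_chart f : smooth f ->
  \forall z \near (0 : 'rV[R]_d), differentiable (f \o y) z.
Proof.
move=> sf; apply: filterS nbhs_canonical_cod0 => z.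
by have [+ _] := smooth_chart sf 1; exact.
Qed.

Lemma dcoordD (i : 'I_d) f g : smooth f -> smooth g ->
  dcoord i (fun h => f h + g h) = dcoord i f + dcoord i g.
Proof.
move=> sf sg; apply: (@deriveD _ _ _ (f \o y) (g \o y));
  by apply: diff_derivable; exact: differentiable_chart.
Qed.

Lemma dcoordM (i : 'I_d) f g : smooth f -> smooth g ->
  dcoord i (fun h => f h * g h) = f 1%g * dcoord i g + g 1%g * dcoord i f.
Proof.
move=> sf sg; rewrite -canonical_chart0.
apply: (@deriveM _ _ (f \o y) (g \o y));
  by apply: diff_derivable; exact: differentiable_chart.
Qed.

Lemma hcoordD (j k : 'I_d) f g : smooth f -> smooth g ->
  hcoord j k (fun h => f h + g h) = hcoord j k f + hcoord j k g.
Proof.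
move=> sf sg; rewrite /hcoord.
have H := @deriveD _ _ _ ('D_(delta_mx 0 k) (f \o y)) ('D_(delta_mx 0 k) (g \o y)) 0
  (delta_mx 0 j) (diff_derivable (differentiable2_chart k sf))
  (diff_derivable (differentiable2_chart k sg)).
rewrite -[RHS]H; apply: near_eq_derive.
apply: filterS2 (near_differentiable_chart sf) (near_differentiable_chart sg).
move=> z df dg; apply: (@deriveD _ _ _ (f \o y) (g \o y)); exact: diff_derivable.
Qed.

Lemma hcoordM (j k : 'I_d) f g : smooth f -> smooth g -> f 1%g = 0 -> g 1%g = 0 ->
  hcoord j k (fun h => f h * g h) =
  dcoord j f * dcoord k g + dcoord j g * dcoord k f.
Proof.
move=> sf sg f1 g1; rewrite /hcoord.
have df : derivable (f \o y) 0 (delta_mx 0 j).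
  exact: diff_derivable (differentiable_chart sf).
have dg : derivable (g \o y) 0 (delta_mx 0 j).
  exact: diff_derivable (differentiable_chart sg).
have df2 : derivable ('D_(delta_mx 0 k) (f \o y)) 0 (delta_mx 0 j).
  exact: diff_derivable (differentiable2_chart k sf).
have dg2 : derivable ('D_(delta_mx 0 k) (g \o y)) 0 (delta_mx 0 j).
  exact: diff_derivable (differentiable2_chart k sg).
pose P := (f \o y) * 'D_(delta_mx 0 k) (g \o y).
pose Q := (g \o y) * 'D_(delta_mx 0 k) (f \o y).
rewrite (@near_eq_derive _ _ _ _ (P + Q)); last first.
  apply: filterS2 (near_differentiable_chart sf) (near_differentiable_chart sg).
  move=> z dfz dgz; apply: (@deriveM _ _ (f \o y) (g \o y)); exact: diff_derivable.
rewrite -[LHS]/('D_(delta_mx 0 j) (P + Q) 0).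
transitivity ('D_(delta_mx 0 j) P 0 + 'D_(delta_mx 0 j) Q 0).
  exact: deriveD (derivableM df dg2) (derivableM dg df2).
have -> := deriveM df dg2; have -> := deriveM dg df2.
have fy0 : (f \o y) 0 = 0 by rewrite /= canonical_chart0.
have gy0 : (g \o y) 0 = 0 by rewrite /= canonical_chart0.
have aux (u v h1 h2 d1 d2 d3 d4 : R) : u = 0 -> v = 0 ->
    u * h1 + d1 * d2 + (v * h2 + d3 * d4) = d2 * d1 + d4 * d3.
  by move=> -> ->; ring.
exact: aux fy0 gy0.
Qed.

Lemma dcoord_near_cst (i : 'I_d) f (a : R) :
  (\forall g \near (1%g : G), f g = a) -> dcoord i f = 0.
Proof.
move=> fa; rewrite /dcoord (@near_eq_derive _ _ _ _ (cst a)) ?derive_cst//.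
have [cy _] := canonical_chart_smooth.
by apply: (cy 0 canonical_cod0 [set g | f g = a]); rewrite /= canonical_chart0.
Qed.

Lemma hcoord_near_cst (j k : 'I_d) f (a : R) :
  (\forall g \near (1%g : G), f g = a) -> hcoord j k f = 0.
Proof.
move=> fa; rewrite /hcoord (@near_eq_derive _ _ _ _ (cst (0 : R))) ?derive_cst//.
have [cy _] := canonical_chart_smooth.
have : \forall z \near (0 : 'rV[R]_d), (f \o y) z = a.
  by apply: (cy 0 canonical_cod0 [set g | f g = a]); rewrite /= canonical_chart0.
move=> /near_join; apply: filterS => z fz.
by rewrite (@near_eq_derive _ _ _ _ (cst a)) ?derive_cst.
Qed.

Lemma dcoordZ (i : 'I_d) (a : R) f : smooth f ->
  dcoord i (fun h => a * f h) = a * dcoord i f.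
Proof.
move=> sf; rewrite (@dcoordM i (fun=> a))//; last exact: smooth_cst.
by rewrite (@dcoord_near_cst i (fun=> a) a) ?mulr0 ?addr0//; exact: nearW.
Qed.

Lemma hcoordZ (j k : 'I_d) (a : R) f : smooth f ->
  hcoord j k (fun h => a * f h) = a * hcoord j k f.
Proof.
move=> sf; rewrite /hcoord.
rewrite (@near_eq_derive _ _ _ _ (a \*: 'D_(delta_mx 0 k) (f \o y))).
  by rewrite deriveZ//; exact: diff_derivable (differentiable2_chart k sf).
apply: filterS (near_differentiable_chart sf) => z df.
by apply: (@deriveZ _ _ _ (f \o y) a); exact: diff_derivable.
Qed.

Lemma dcoordB (i : 'I_d) f g : smooth f -> smooth g ->
  dcoord i (fun h => f h - g h) = dcoord i f - dcoord i g.
Proof.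
move=> sf sg; have sN := smoothM (smooth_cst (-1)) sg.
transitivity (dcoord i (fun h => f h + (fun h => -1 * g h) h)).
  by apply: (congr1 (dcoord i)); apply/funext => h; rewrite mulN1r.
transitivity (dcoord i f + dcoord i (fun h => -1 * g h)); first exact: dcoordD.
apply: (congr2 +%R erefl); transitivity (-1 * dcoord i g); first exact: dcoordZ.
exact: mulN1r.
Qed.

Lemma hcoordB (j k : 'I_d) f g : smooth f -> smooth g ->
  hcoord j k (fun h => f h - g h) = hcoord j k f - hcoord j k g.
Proof.
move=> sf sg; have sN := smoothM (smooth_cst (-1)) sg.
transitivity (hcoord j k (fun h => f h + (fun h => -1 * g h) h)).
  by apply: (congr1 (hcoord j k)); apply/funext => h; rewrite mulN1r.
transitivity (hcoord j k f + hcoord j k (fun h => -1 * g h)); first exact: hcoordD.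
apply: (congr2 +%R erefl); transitivity (-1 * hcoord j k g); first exact: hcoordZ.
exact: mulN1r.
Qed.

Lemma smooth_sum (I : Type) (s : seq I) (F : I -> G -> R) :
  (forall i, smooth (F i)) -> smooth (fun g => \sum_(i <- s) F i g).
Proof.
move=> sF phi aphi k; apply: (@Ck_on_bigsum _ _ _ _ s (fun i => F i \o chart_inv phi)).
  exact: open_chart_cod.
by move=> i; exact: sF.
Qed.

Lemma dcoord_sum (I : Type) (s : seq I) (i : 'I_d) (F : I -> G -> R) :
  (forall l, smooth (F l)) ->
  dcoord i (fun h => \sum_(l <- s) F l h) = \sum_(l <- s) dcoord i (F l).
Proof.
move=> sF; elim: s => [|l s IH].
  rewrite big_nil (@dcoord_near_cst i _ 0)//.
  by apply: nearW => g; exact: big_nil.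
rewrite big_cons -IH.
transitivity (dcoord i (fun h => F l h + (fun h => \sum_(l <- s) F l h) h)).
  by apply: (congr1 (dcoord i)); apply/funext => g; rewrite big_cons.
by apply: dcoordD => //; exact: smooth_sum.
Qed.

Lemma hcoord_sum (I : Type) (s : seq I) (j k : 'I_d) (F : I -> G -> R) :
  (forall l, smooth (F l)) ->
  hcoord j k (fun h => \sum_(l <- s) F l h) = \sum_(l <- s) hcoord j k (F l).
Proof.
move=> sF; elim: s => [|l s IH].
  rewrite big_nil (@hcoord_near_cst j k _ 0)//.
  by apply: nearW => g; exact: big_nil.
rewrite big_cons -IH.
transitivity (hcoord j k (fun h => F l h + (fun h => \sum_(l <- s) F l h) h)).
  by apply: (congr1 (hcoord j k)); apply/funext => g; rewrite big_cons.
by apply: hcoordD => //; exact: smooth_sum.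
Qed.

(** The bound is local because outside U the sum of squares may vanish. *)
Lemma coord_taylor q : smooth q -> q 1%g = 0 -> (forall i, dcoord i q = 0) ->
  (forall j k, hcoord j k q + hcoord k j q = 0) ->
  forall e, 0 < e ->
  \forall g \near (1%g : G), `|q g| <= e * \sum_(i < d) x i g ^+ 2.
Proof.
move=> sq q1 Dq Hq e e0.
have qy0 : (q \o y) 0 = 0 by rewrite /= canonical_chart0.
have /nbhs_ballP[r /= r0 Hr] := taylor_small open_canonical_cod canonical_cod0
  (smooth_chart sq 2) qy0 Dq (fun i j => Hq j i) e0.
have U1 : \forall g \near (1%g : G), U g.
  by apply: open_nbhs_nbhs; split; [exact: open_canonical_dom|exact: canonical_dom1].
have xr i : \forall g \near (1%g : G), `|x i g| < r.
  have sx : smooth (x i) by case: (test_testFun (x i)).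
  have /(_ 1%g) cx := smooth_continuous sx.
  by apply: (cx [set t | `|t| < r]); rewrite coord1; apply/nbhs_ballP; exists r => //= t;
    rewrite -ball_normE /= sub0r normrN.
have {}xr : \forall g \near (1%g : G), forall i, `|x i g| < r.
  exact: (@filter_forall _ _ _ (nbhs (1%g : G)) _ xr).
apply: filterS2 U1 xr => g Ug xg.
have : ball (0 : 'rV[R]_d) r (coord_map x g).
  rewrite -ball_normE /= sub0r normrN.
  have [->//|/mx_norm_neq0[[i j]] /= E] := eqVneq `|coord_map x g| 0.
  have -> : `|coord_map x g| = `|coord_map x g i j| by exact: E.
  by rewrite mxE.
move=> /Hr /=; rewrite canonical_chartK//; congr (_ <= _ * _).
by apply: eq_bigr => i _; rewrite mxE.
Qed.

Lemma coord_max f : smooth f -> (forall g, f g <= f 1%g) ->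
  (forall i, dcoord i f = 0) /\
  (forall v : 'I_d -> R, \sum_(j < d) \sum_(k < d) v j * v k * hcoord j k f <= 0).
Proof.
move=> sf fmax.
have H v := second_derivative_test v open_canonical_cod canonical_cod0
  (smooth_chart sf 2) (fun z (_ : V z) => ltac:(by rewrite /= canonical_chart0)).
split=> [i|v]; first by have [] := H (delta_mx 0 i).
pose w : 'rV[R]_d := \row_i v i.
have [_] := H w; apply: le_trans; rewrite le_eqVlt; apply/orP; left; apply/eqP.
have -> : 'D_w ('D_w (f \o y)) 0 =
    'D_w (fun z => \sum_(k < d) (v k \*: 'D_(delta_mx 0 k) (f \o y)) z) 0.
  apply: near_eq_derive; apply: filterS (near_differentiable_chart sf) => z df.
  by rewrite derive_row//; apply: eq_bigr => k _; rewrite mxE.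
have dk k : derivable ('D_(delta_mx 0 k) (f \o y)) 0 w.
  exact: diff_derivable (differentiable2_chart k sf).
have := @derive_val _ _ _ _ _ _ _ (is_derive_bigsum (index_enum 'I_d) (fun k =>
  is_deriveZ (v k) (derivableP (dk k)))).
move=> ->; rewrite exchange_big; apply: eq_bigr => k _ /=.
rewrite (derive_row w (differentiable2_chart k sf)) scaler_sumr.
by apply: eq_bigr => j _; rewrite mxE /GRing.scale /= mulrCA mulrA.
Qed.

End CanonicalCoordinates.

(** * Measures from positive functionals *)

Import HBNNSimple.

Section UpperMeasure.
Context {R : realType} {T : ptopologicalType}.
Variables (K : set (T -> R)) (L : (T -> R) -> R).

(** The last clause says that sup_n g n >= w on A without naming the supremum, which may be
    infinite. *)
Definition upper_bound_on (w : T -> R) (A : set T) (M : R) : Prop :=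
  exists g : nat -> T -> R,
    [/\ forall n, K (g n) /\ L (g n) <= M,
      forall n x, 0 <= g n x,
      forall n x, g n x <= g n.+1 x &
      forall x, A x -> forall t, t < w x -> exists n, t < g n x].

(* The Daniell upper integral of the function equal to w on A and to 0
   elsewhere. *)
Definition upper_measure (w : T -> R) (A : set T) : \bar R :=
  ereal_inf [set M%:E | M in upper_bound_on w A].

Hypothesis K0 : K (fun=> 0).
Hypothesis KD : forall f g, K f -> K g -> K (fun x => f x + g x).
Hypothesis KZ : forall a f, K f -> K (fun x => a * f x).
Hypothesis LD : forall f g, K f -> K g -> L (fun x => f x + g x) = L f + L g.
Hypothesis LZ : forall a f, K f -> L (fun x => a * f x) = a * L f.
Hypothesis L_ge0 : forall f, K f -> (forall x, 0 <= f x) -> 0 <= L f.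

Lemma daniell_domB f g : K f -> K g -> K (fun x => f x - g x).
Proof.
move=> Kf Kg; have := KD Kf (KZ (-1) Kg).
by congr K; apply/funext => x; rewrite mulN1r.
Qed.

Lemma daniellB f g : K f -> K g -> L (fun x => f x - g x) = L f - L g.
Proof.
move=> Kf Kg; rewrite -mulN1r -LZ// -LD//; last exact: KZ.
by congr L; apply/funext => x; rewrite mulN1r.
Qed.

Lemma daniell_le f g : K f -> K g -> (forall x, f x <= g x) -> L f <= L g.
Proof.
move=> Kf Kg fg; rewrite -subr_ge0 -daniellB//; apply: L_ge0; first exact: daniell_domB.
by move=> x; rewrite subr_ge0.
Qed.

Lemma daniell0 : L (fun=> 0) = 0.
Proof.
rewrite -[RHS](mul0r (L (fun=> 0))) -LZ//; congr L.
by apply/funext => x; rewrite mulr0.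
Qed.

Lemma daniell_dom_sum n (F : nat -> T -> R) : (forall i, K (F i)) ->
  K (fun x => \sum_(i < n) F i x).
Proof.
move=> KF; elim: n => [|n IH].
  by have := K0; congr K; apply/funext => x; rewrite big_ord0.
have := KD IH (KF n); congr K; apply/funext => x; by rewrite big_ord_recr.
Qed.

Lemma daniell_sum n (F : nat -> T -> R) : (forall i, K (F i)) ->
  L (fun x => \sum_(i < n) F i x) = \sum_(i < n) L (F i).
Proof.
move=> KF; elim: n => [|n IH].
  by rewrite big_ord0 -[RHS]daniell0; congr L; apply/funext => x; rewrite big_ord0.
rewrite big_ord_recr /= -IH -LD//; last exact: daniell_dom_sum.
by congr L; apply/funext => x; rewrite big_ord_recr.
Qed.

Lemma upper_bound_ge0 w A M : upper_bound_on w A M -> 0 <= M.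
Proof.
move=> [g [KL g0 _ _]]; have [Kg LM] := KL 0%N.
by apply: le_trans LM; exact: L_ge0.
Qed.

Lemma upper_measure_le w A M : upper_bound_on w A M -> (upper_measure w A <= M%:E)%E.
Proof. by move=> H; apply: ereal_inf_lbound; exists M. Qed.

Lemma upper_measure_ge w A z :
  (forall M, upper_bound_on w A M -> (z <= M%:E)%E) -> (z <= upper_measure w A)%E.
Proof. by move=> H; apply: le_ereal_inf_tmp => _ [M HM <-]; exact: H. Qed.

Lemma upper_measure_ge0 w A : (0 <= upper_measure w A)%E.
Proof. by apply: upper_measure_ge => M /upper_bound_ge0; rewrite lee_fin. Qed.

Lemma upper_measure_adherent w A e : 0 < e -> (upper_measure w A < +oo)%E ->
  exists2 M, upper_bound_on w A M & (M%:E <= upper_measure w A + e%:E)%E.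
Proof.
move=> e0 fin.
have fn : upper_measure w A \is a fin_num.
  by rewrite ge0_fin_numE// upper_measure_ge0.
have [_ [M HM <-] /ltW Me] := lb_ereal_inf_adherent e0 fn.
by exists M.
Qed.

Lemma upper_bound_subset w A B M : A `<=` B ->
  upper_bound_on w B M -> upper_bound_on w A M.
Proof.
by move=> AB [g [KL g0 gS gw]]; exists g; split => // x /AB; exact: gw.
Qed.

(** Chebyshev's inequality in terms of covers: on a level set {h = r} of a simple function h <= f, r
    times the indicator lies below f. *)
Lemma upper_bound_scale w1 w2 A M r : 0 < r ->
  (forall x, A x -> r * w1 x <= w2 x) ->
  upper_bound_on w2 A M -> upper_bound_on w1 A (M / r).
Proof.
move=> r0 w12 [g [KL g0 gS gw]]; exists (fun n x => r^-1 * g n x); split.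
- move=> n; have [Kg LM] := KL n; split; first exact: KZ.
  by rewrite LZ// mulrC ler_pM2r// invr_gt0.
- by move=> n x; rewrite mulr_ge0// invr_ge0 ltW.
- by move=> n x; rewrite ler_pM2l// invr_gt0.
- move=> x Ax t tw; have [|n tn] := gw x Ax (r * t).
    by apply: lt_le_trans (w12 _ Ax); rewrite ltr_pM2l.
  by exists n; rewrite ltr_pdivlMl.
Qed.

Lemma upper_measure0 w : upper_measure w set0 = 0%E.
Proof.
apply/eqP; rewrite eq_le upper_measure_ge0 andbT; apply: upper_measure_le.
by exists (fun _ _ => 0); split => // n; rewrite daniell0.
Qed.

Lemma le_upper_measure w :
  {homo upper_measure w : A B / A `<=` B >-> (A <= B)%E}.
Proof.
move=> A B AB; apply: upper_measure_ge => M HM; apply: upper_measure_le.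
exact: upper_bound_subset HM.
Qed.

Lemma upper_mono (g : nat -> T -> R) : (forall n x, g n x <= g n.+1 x) ->
  forall m n x, (m <= n)%N -> g m x <= g n x.
Proof.
move=> gS m n x /subnKC <-; elim: (n - m)%N => [|k IH]; first by rewrite addn0.
by rewrite addnS; exact: le_trans IH (gS _ _).
Qed.

(** Choose for the i-th set a cover within e / 2^(i+1) of optimal. The diagonal sums of these covers
    increase and cover the union, and as each is a finite sum, additivity of L bounds them. *)
Lemma upper_measure_sigma_subadditive w : sigma_subadditive (upper_measure w).
Proof.
move=> F; set S := (\sum_(i <oo) _)%E.
have S0 : (0 <= S)%E by apply: nneseries_ge0 => i _ _; exact: upper_measure_ge0.
have [->|Soo] := eqVneq S +oo%E; first exact: leey.
have Slty : (S < +oo)%E by rewrite ltey.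
have Ffin i : (upper_measure w (F i) < +oo)%E.
  apply: le_lt_trans Slty; rewrite /S.
  apply: (@le_trans _ _ (\sum_(0 <= j < i.+1) upper_measure w (F j))%E).
    by rewrite big_nat_recr//= leeDr// sume_ge0// => j _; exact: upper_measure_ge0.
  by apply: nneseries_lim_ge => j _ _; exact: upper_measure_ge0.
apply/lee_addgt0Pr => e e0.
have ei i : 0 < e / (2 ^ i.+1)%:R by rewrite divr_gt0// ltr0n expn_gt0.
have /choice[M HM] : forall i, exists M, upper_bound_on w (F i) M /\
    (M%:E <= upper_measure w (F i) + (e / (2 ^ i.+1)%:R)%:E)%E.
  by move=> i; have [M ? ?] := upper_measure_adherent (ei i) (Ffin i); exists M.
have M0 i : 0 <= M i by have [/upper_bound_ge0] := HM i.
have /choice[g Hg] : forall i, exists g : nat -> T -> R,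
    [/\ forall n, K (g n) /\ L (g n) <= M i,
      forall n x, 0 <= g n x, forall n x, g n x <= g n.+1 x &
      forall x, F i x -> forall t, t < w x -> exists n, t < g n x].
  by move=> i; have [] := HM i.
pose B := (\sum_(i <oo) (M i)%:E)%E.
have BS : (B <= S + e%:E)%E.
  apply: (@le_trans _ _ (\sum_(i <oo) (upper_measure w (F i) + (e / (2 ^ i.+1)%:R)%:E))%E).
    by apply: lee_nneseries => i; [rewrite lee_fin|move=> _; have [] := HM i].
  by apply: epsilon_trick; [move=> n; exact: upper_measure_ge0|exact: ltW].
have B0 : (0 <= B)%E by apply: nneseries_ge0 => i _ _; rewrite lee_fin.
have Bfin : B \is a fin_num.
  rewrite ge0_fin_numE//; apply: le_lt_trans BS _.
  by rewrite lte_add_pinfty// ltry.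
apply: le_trans BS; rewrite -(fineK Bfin); apply: upper_measure_le.
exists (fun n x => \sum_(i < n.+1) g i n x); split.
- move=> n; have Kn i : K (g i n) by have [/(_ n)[]] := Hg i.
  split; first exact: (@daniell_dom_sum n.+1 (fun i => g i n)).
  rewrite (@daniell_sum n.+1 (fun i => g i n))// -lee_fin fineK//.
  apply: (@le_trans _ _ (\sum_(0 <= i < n.+1) (M i)%:E)%E).
    rewrite big_mkord sumEFin lee_fin; apply: ler_sum => i _.
    by have [/(_ n)[]] := Hg i.
  by apply: nneseries_lim_ge => i _ _; rewrite lee_fin.
- by move=> n x; apply: sumr_ge0 => i _; have [_ + _ _] := Hg i; exact.
- move=> n x; rewrite [leRHS]big_ord_recr /=.
  apply: (@le_trans _ _ (\sum_(i < n.+1) g i n.+1 x)).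
    by apply: ler_sum => i _; have [_ _ + _] := Hg i; exact.
  by rewrite lerDl; have [_ + _ _] := Hg n.+1; exact.
- move=> x [i _ Fix] t tw; have [_ gi0 giS /(_ x Fix t tw)[n tn]] := Hg i.
  (* The diagonal sum must include the i-th cover and take it at a stage at least n. *)
  exists (maxn n i); have im : (i < (maxn n i).+1)%N by rewrite ltnS leq_maxr.
  rewrite (bigD1 (Ordinal im))//=; apply: ltr_wpDr.
    by apply: sumr_ge0 => j _; have [_ + _ _] := Hg j; exact.
  by apply: (lt_le_trans tn); apply: upper_mono => //; exact: leq_maxl.
Qed.

Definition upper_outer_measure w : {outer_measure set T -> \bar R} :=
  HB.pack (upper_measure w) (isOuterMeasure.Build R T (upper_measure w)
    (upper_measure0 w) (upper_measure_ge0 w) (@le_upper_measure w)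
    (@upper_measure_sigma_subadditive w)).

(* The functions 1 - (1 - beta)^n increase to the indicator of {beta > 0}; a
   cover g of A is cut into g_n (1 - (1 - beta)^n) and, for one large m, into
   g_(n + m) - g_m (1 - (1 - beta)^m). *)
Lemma caratheodory_cozero w (beta : T -> R) : (forall x, 0 <= w x) ->
  (forall x, 0 <= beta x <= 1) -> (forall f, K f -> K (fun x => f x * beta x)) ->
  (upper_measure w).-caratheodory [set x | 0 < beta x].
Proof.
move=> w0 b01 Kb; set O := [set x | _].
apply: (@le_caratheodory_measurable _ _ (upper_outer_measure w)) => A /=.
have [->|] := eqVneq (upper_measure w A) +oo%E; first exact: leey.
rewrite -ltey => Afin.
have c01 x : 0 <= 1 - beta x <= 1.
  by have /andP[? ?] := b01 x; rewrite subr_ge0 lerBlDr lerDl; apply/andP.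
have cn01 n x : 0 <= (1 - beta x) ^+ n <= 1.
  by have /andP[? ?] := c01 x; rewrite exprn_ge0//= exprn_ile1.
have Kc f n : K f -> K (fun x => f x * (1 - beta x) ^+ n).
  move=> Kf; elim: n => [|n IH].
    by congr K : Kf; apply/funext => x; rewrite expr0 mulr1.
  have := daniell_domB IH (Kb _ IH); congr K; apply/funext => x.
  by rewrite exprSr mulrA mulrBr mulr1.
apply/lee_addgt0Pr => e e0.
have e2 : 0 < e / 2 by rewrite divr_gt0.
have [M [g [KL g0 gS gw]] MA] := upper_measure_adherent e2 Afin.
pose h n x := g n x * (1 - (1 - beta x) ^+ n).
have Kg n : K (g n) by have [] := KL n.
have Kh n : K (h n).
  have := daniell_domB (Kg n) (Kc _ n (Kg n)); congr K; apply/funext => x.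
  by rewrite /h mulrBr mulr1.
have h0 n x : 0 <= h n x.
  by rewrite mulr_ge0// subr_ge0; have /andP[] := cn01 n x.
have hg n x : h n x <= g n x.
  by rewrite /h ler_piMr// gerBl; have /andP[] := cn01 n x.
have hS n x : h n x <= h n.+1 x.
  rewrite ler_pM// ?subr_ge0; first by have /andP[] := cn01 n x.
  rewrite lerD2l lerN2 exprS ler_piMl//; first by have /andP[] := cn01 n x.
  by have /andP[] := c01 x.
have LhM n : L (h n) <= M.
  by have [_ /(le_trans _)] := KL n; apply; exact: daniell_le.
pose S := [set L (h n) | n in [set: nat]].
have supS : has_sup S.
  by split; [exists (L (h 0%N)); exists 0%N|exists M => _ [n _ <-]; exact: LhM].
(* With L (h m) within e / 2 of the supremum, the remainders g_(n + m) - h_m have L at most M - sup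
   S + e / 2, and the bounds for the two pieces add up to M + e / 2. *)
have [_ [m _ <-] Hm] := sup_adherent e2 supS.
have HO : upper_bound_on w (A `&` O) (sup S).
  exists h; split => //.
    move=> n; split; first exact: Kh.
    by apply: sup_upper_bound => //; exists n.
  move=> x [Ax Ox] t tw; have [t0|t0] := ltP t 0.
    by exists 0%N; exact: lt_le_trans t0 (h0 _ _).
  have [n tn] := gw x Ax t tw; have gn0 : 0 < g n x by exact: le_lt_trans tn.
  have c1 : `|1 - beta x| < 1.
    have /andP[? _] := c01 x; rewrite ger0_norm// gtrBl; exact: Ox.
  have d0 : 0 < 1 - t / g n x by rewrite subr_gt0 ltr_pdivrMr// mul1r.
  have /cvgr0Pnorm_lt/(_ _ d0)[N _ HN] := cvg_expr c1.
  exists (maxn n N); have := HN (maxn n N) (leq_maxr _ _).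
  rewrite /= ger0_norm; last by have /andP[] := cn01 (maxn n N) x.
  rewrite ltrBrDr -ltrBrDl ltr_pdivrMr// => /lt_le_trans; apply.
  rewrite /h mulrC ler_wpM2r//; first by rewrite subr_ge0; have /andP[] := cn01 (maxn n N) x.
  by apply: upper_mono => //; exact: leq_maxl.
have HC : upper_bound_on w (A `&` ~` O) (M - sup S + e / 2).
  exists (fun n x => g (n + m)%N x - h m x); split.
  - move=> n; split; first exact: daniell_domB.
    rewrite daniellB//; have [_ Lg] := KL (n + m)%N; lra.
  - by move=> n x; rewrite subr_ge0 (le_trans (hg _ _))// upper_mono// leq_addl.
  - by move=> n x; rewrite lerD2r addSn.
  - move=> x [Ax /= Ox] t tw; have [n tn] := gw x Ax t tw; exists n.
    have bx : beta x = 0.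
      by apply/eqP; have /andP[b0 _] := b01 x; rewrite eq_le b0 andbT leNgt; apply/negP.
    rewrite /h bx subr0 expr1n subrr mulr0 subr0 (lt_le_trans tn)//.
    by apply: upper_mono => //; exact: leq_addr.
apply: (@le_trans _ _ (M%:E + (e / 2)%:E)%E).
  apply: (le_trans (leeD (upper_measure_le HO) (upper_measure_le HC))).
  by rewrite -!EFinD lee_fin; lra.
rewrite [e in leRHS]splitr EFinD addeA; exact: leeD.
Qed.

Hypothesis Kcover : forall O : set T, open O ->
  exists beta : nat -> T -> R,
    [/\ forall n f, K f -> K (fun x => f x * beta n x),
      forall n x, 0 <= beta n x <= 1,
      forall n x, beta n x != 0 -> O x & forall x, O x -> exists n, 0 < beta n x].

(** Open sets are countable unions of sets {beta n > 0}, each measurable by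
    [caratheodory_cozero]. *)
Lemma caratheodory_borel w (A : set (borelType T)) : (forall x, 0 <= w x) ->
  measurable A -> (upper_measure w).-caratheodory (A : set T).
Proof.
move=> w0; set mu := upper_outer_measure w.
suff H : <<s @open T >> `<=` (@measurable _ (caratheodory_type mu)) by exact: H.
apply: smallest_sub; first exact: (@sigma_algebra_measurable _ (caratheodory_type mu)).
move=> O oO; have [beta [Kb b01 bO Ob]] := Kcover oO.
have -> : O = \bigcup_n [set x | 0 < beta n x].
  apply/seteqP; split => [x /Ob[n nx]|x [n _ /= nx]]; first by exists n.
  by apply: (bO n); rewrite gt_eqF.
apply: bigcup_measurable => n _.
by apply: (@caratheodory_cozero w (beta n) w0) => // f; exact: Kb.
Qed.

Lemma upper_measure_semi_sigma_additive w : (forall x, 0 <= w x) ->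
  semi_sigma_additive (upper_measure w : set (borelType T) -> \bar R).
Proof.
move=> w0 A mA tA mbA.
apply: (@caratheodory_measure_sigma_additive _ _ (upper_outer_measure w)) => //.
  by move=> n; exact: caratheodory_borel.
exact: caratheodory_borel.
Qed.

Definition upper_borel_measure w (w0 : forall x, 0 <= w x) :
    {measure set (borelType T) -> \bar R} :=
  HB.pack (upper_measure w : set (borelType T) -> \bar R)
    (isMeasure.Build _ (borelType T) R (upper_measure w)
      (upper_measure0 w) (upper_measure_ge0 w)
      (upper_measure_semi_sigma_additive w0)).

Hypothesis T_hausdorff : hausdorff_space T.
Hypothesis K_continuous : forall f, K f -> continuous f.
Hypothesis K_bounded : forall f, K f -> exists2 b, 0 < b & forall x, `|f x| <= b.
Hypothesis K_support : forall f, K f -> exists C chi,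
  [/\ compact C, K chi, forall x, 0 <= chi x, forall x, C x -> 1 <= chi x &
    forall x, f x != 0 -> C x].

(** The open sets {u < g n} increase with n and cover C, so a single one contains C. *)
Lemma dini (u : T -> R) (g : nat -> T -> R) (C : set T) :
  continuous u -> (forall n, continuous (g n)) ->
  (forall n x, g n x <= g n.+1 x) -> compact C ->
  (forall x, C x -> exists n, u x < g n x) ->
  exists N, forall x, C x -> u x < g N x.
Proof.
move=> cu cg gS; rewrite compact_cover => cC ug.
have oD n : open [set x | u x < g n x].
  rewrite (_ : mkset _ = (fun x => g n x - u x) @^-1` [set t | 0 < t]).
    apply: open_comp; last exact: open_gt.
    by move=> x _; apply: continuousB; [exact: cg|exact: cu].
  by apply/seteqP; split => x /=; rewrite subr_gt0.
have [|D' _ CD'] := cC _ setT (fun n => [set x | u x < g n x]) (fun n _ => oD n).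
  by move=> x /ug[n nx]; exists n.
exists (\max_(n <- finmap.enum_fset D') n)%N => x /CD'[n /= nD' nx].
apply: (lt_le_trans nx); apply: upper_mono => //.
exact: (@leq_bigmax_seq _ (finmap.enum_fset D') xpredT id n).
Qed.

Lemma continuous_measurable_borel (f : T -> R) : continuous f ->
  measurable_fun [set: borelType T] f.
Proof.
move=> /continuousP cf; apply: (measurability _ (RGenOpens.measurableE R)).
move=> _ [_ [a [b ->] <-]]; rewrite setTI; apply: sub_sigma_algebra.
exact/cf/interval_open.
Qed.

(** The weight defining the measure: it is 1 wherever some function of K is non-zero, and may drop
    below 1 at points that K does not see. *)
Variable w1 : T -> R.
Hypothesis w1_ge0 : forall x, 0 <= w1 x.
Hypothesis w1_le1 : forall x, w1 x <= 1.
Hypothesis K_w1 : forall f x, K f -> f x != 0 -> w1 x = 1.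

Let mu := upper_borel_measure w1_ge0.

(** The upper measure with weight f is itself a measure. For a simple h <= f it dominates r mu on
    each level set {h = r}, and its masses of these disjoint sets add up to at most the total. *)
Lemma integral_le_upper f : (forall x, 0 <= f x) ->
  (\int[mu]_x (f x)%:E <= upper_measure f setT)%E.
Proof.
move=> f0; rewrite ge0_integralTE; last by move=> x; rewrite lee_fin.
apply: ge_ereal_sup => _ [h hf <-]; rewrite sintegralE.
pose nuf := upper_borel_measure f0.
apply: (@le_trans _ _ (\sum_(r \in range h) nuf (h @^-1` [set r]))%E).
  apply: lee_fsum; first exact: fimfunP.
  move=> _ [y _ <-]; have := @fun_ge0 _ _ h y; rewrite le_eqVlt => /predU1P[<-|hy0].
    by rewrite mul0e; exact: measure_ge0.
  apply: upper_measure_ge => M HM.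
  have H : upper_bound_on w1 (h @^-1` [set h y]) (M / h y).
    apply: upper_bound_scale HM => // x /= hx.
    apply: (le_trans (ler_piMr (ltW hy0) (w1_le1 x))).
    by rewrite -lee_fin; have := hf x; rewrite hx.
  apply: (@le_trans _ _ ((h y)%:E * (M / h y)%:E)%E).
    by rewrite lee_pmul2l//; exact: upper_measure_le.
  by rewrite -EFinM mulrCA mulfV ?mulr1// gt_eqF.
rewrite -measure_fin_bigcup; first exact: le_upper_measure.
- exact: fimfunP.
- exact: trivIset_preimage1.
- by move=> r _; exact: measurable_sfunP.
Qed.

Lemma integral_leL f : K f -> (forall x, 0 <= f x) ->
  (\int[mu]_x (f x)%:E <= (L f)%:E)%E.
Proof.
move=> Kf f0; apply: (le_trans (integral_le_upper f0)).
apply: upper_measure_le; exists (fun _ => f); split => // x _ t tf.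
by exists 0%N.
Qed.

(* By outer regularity some p in K dominates both f and b on C, with L p close
   to b mu(C); the reverse inequality for f follows from the one for p - f. *)
Lemma integral_geL f : K f -> (forall x, 0 <= f x) ->
  ((L f)%:E <= \int[mu]_x (f x)%:E)%E.
Proof.
move=> Kf f0.
have [C [chi [cC Kchi chi0 chi1 fC]]] := K_support Kf.
have [b b0 fb] := K_bounded Kf.
have Cfin : (mu C < +oo)%E.
  apply: (@le_lt_trans _ _ (L chi)%:E); last exact: ltry.
  apply: upper_measure_le; exists (fun _ => chi); split => // x Cx t tw.
  exists 0%N; apply: (lt_le_trans tw); exact: le_trans (w1_le1 x) (chi1 _ Cx).
have mC : measurable (C : set (borelType T)).
  rewrite -[C]setCK; apply: measurableC; apply: sub_sigma_algebra.
  by apply: closed_openC; exact: compact_closed.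
have fC0 : (0 <= mu C)%E by exact: measure_ge0.
have Ifin : (\int[mu]_x (f x)%:E < +oo)%E.
  exact: le_lt_trans (integral_leL Kf f0) (ltry _).
have I0 : (0 <= \int[mu]_x (f x)%:E)%E by apply: integral_ge0 => x _; rewrite lee_fin.
have Ifn : (\int[mu]_x (f x)%:E)%E \is a fin_num by rewrite ge0_fin_numE.
have Cfn : mu C \is a fin_num by rewrite ge0_fin_numE.
rewrite -(fineK Ifn) lee_fin.
pose m := fine (mu C).
have m0 : 0 <= m by exact: fine_ge0.
apply/ler_addgt0Pr => e e0.
(* q > 1 provides the strict inequality 1/q < w1 on C that [dini] asks for, and q is so close to 1
   that b m q <= b m + e / 2; m + 1 replaces m because m may be 0. *)
pose q := 1 + e / (2 * b * (m + 1)).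
have bm0 : 0 < 2 * b * (m + 1) by rewrite !mulr_gt0// ltr_wpDl.
have q1 : 1 < q by rewrite ltrDl divr_gt0.
have q0 : 0 < q by exact: lt_trans q1.
have qn0 : q != 0 by rewrite gt_eqF.
have [M HM MC] : exists2 M, upper_bound_on w1 C M & M <= m + e / (2 * b * q).
  have [||M HM MC] := @upper_measure_adherent w1 C (e / (2 * b * q)).
  - by rewrite divr_gt0// !mulr_gt0.
  - exact: Cfin.
  by exists M => //; rewrite -lee_fin EFinD /m fineK.
have [g [KL g0 gS gw]] := HM.
have cu : continuous (fun _ : T => q^-1) by move=> x; exact: cst_continuous.
have cg n : continuous (g n) by apply: K_continuous; have [] := KL n.
have [x Cx|N HN] := dini cu cg gS cC.
  apply: gw => //; rewrite (@K_w1 chi)//; last first.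
    by rewrite gt_eqF// (lt_le_trans _ (chi1 _ Cx)).
  by rewrite invf_lt1.
have [Kg LM] := KL N.
pose p x := b * q * g N x.
have Kp : K p by exact: KZ.
have pb x : C x -> b <= p x.
  move=> /HN/ltW H; rewrite -[leLHS]mulr1 -(mulfV qn0) mulrA.
  by rewrite ler_wpM2l// mulr_ge0// ltW.
have p0 x : 0 <= p x by rewrite !mulr_ge0// ltW.
have fp x : f x <= p x.
  have [->//|/fC Cx] := eqVneq (f x) 0.
  by apply: le_trans (pb _ Cx); apply: le_trans (fb x); exact: ler_norm.
have Kpf : K (fun x => p x - f x) by exact: daniell_domB.
have pf0 x : 0 <= p x - f x by rewrite subr_ge0.
have mf g' : K g' -> measurable_fun [set: borelType T] (EFin \o g').
  move=> Kg'; apply/measurable_EFinP; apply: continuous_measurable_borel.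
  exact: K_continuous.
have Hp : ((b * m)%:E <= \int[mu]_x (p x)%:E)%E.
  apply: (@le_trans _ _ (\int[mu]_(x in C) (p x)%:E)%E); last first.
    by apply: ge0_subset_integral => //; [exact: mf|move=> x _; rewrite lee_fin].
  apply: (@le_trans _ _ (\int[mu]_(x in C) (cst b%:E x))%E).
    by rewrite integral_cst// EFinM /m fineK.
  apply: ge0_le_integral => //.
  - by move=> x _; rewrite lee_fin ltW.
  - by apply: measurable_funTS; exact: mf.
have Ep : (\int[mu]_x (p x)%:E = \int[mu]_x (f x)%:E + \int[mu]_x (p x - f x)%:E)%E.
  rewrite -ge0_integralD//; first last.
  - exact: mf.
  - by move=> x _; rewrite lee_fin.
  - exact: mf.
  - by move=> x _; rewrite lee_fin.
  by apply: eq_integral => x _; rewrite -EFinD addrC subrK.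
have := integral_leL Kpf pf0; rewrite daniellB// => Hpf.
have : ((b * m)%:E <= (fine (\int[mu]_x (f x)%:E))%:E + (L p - L f)%:E)%E.
  by rewrite (le_trans Hp)// Ep fineK// leeD.
rewrite -EFinD lee_fin => H.
have Lp : L p <= b * m + e.
  rewrite /p LZ//; apply: (@le_trans _ _ (b * q * (m + e / (2 * b * q)))).
    by rewrite ler_wpM2l ?mulr_ge0 ?(ltW b0) ?(ltW q0)// (le_trans LM).
  have -> : b * q * (m + e / (2 * b * q)) = b * m * q + e / 2.
    by field; rewrite !gt_eqF.
  have -> : b * m * q = b * m + e / 2 * (m / (m + 1)).
    by rewrite /q; field; rewrite !gt_eqF// ltr_wpDl.
  have : e / 2 * (m / (m + 1)) <= e / 2.
    by rewrite ler_piMr ?divr_ge0 ?(ltW e0)// ler_pdivrMr ?ltr_wpDl// mul1r lerDl.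
  lra.
lra.
Qed.

Lemma integralL_ge0 f : K f -> (forall x, 0 <= f x) ->
  (\int[mu]_x (f x)%:E = (L f)%:E)%E.
Proof.
by move=> Kf f0; apply/eqP; rewrite eq_le integral_leL// integral_geL.
Qed.

Lemma integrableL_ge0 f : K f -> (forall x, 0 <= f x) ->
  mu.-integrable setT (EFin \o f).
Proof.
move=> Kf f0; apply/integrableP; split.
  apply/measurable_EFinP; apply: continuous_measurable_borel.
  exact: K_continuous.
under eq_integral => x _ do rewrite /= ger0_norm//.
by rewrite integralL_ge0// ltry.
Qed.

Theorem integralL f : K f ->
  mu.-integrable setT (EFin \o f) /\ (\int[mu]_x (f x)%:E = (L f)%:E)%E.
Proof.
move=> Kf; have [C [chi [cC Kchi chi0 chi1 fC]]] := K_support Kf.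
have [b b0 fb] := K_bounded Kf.
(* Adding b chi, which dominates |f|, reduces to the non-negative case. *)
have Kc : K (fun x => b * chi x) by exact: KZ.
have c0 x : 0 <= b * chi x by rewrite mulr_ge0// ltW.
have Kfc : K (fun x => f x + b * chi x) by exact: KD.
have fc0 x : 0 <= f x + b * chi x.
  have [->|/fC Cx] := eqVneq (f x) 0; first by rewrite add0r.
  have : b <= b * chi x by rewrite ler_peMr ?chi1// ltW.
  have := fb x; rewrite ler_norml => /andP[]; lra.
have E : EFin \o f = (fun x => ((f x + b * chi x)%:E - (b * chi x)%:E)%E).
  by apply/funext => x /=; rewrite -EFinB addrK.
have i1 := integrableL_ge0 Kfc fc0; have i2 := integrableL_ge0 Kc c0.
split; first by rewrite E; exact: integrableB.
transitivity (\int[mu]_x ((f x + b * chi x)%:E - (b * chi x)%:E))%E.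
  by apply: eq_integral => x _; rewrite -EFinB addrK.
rewrite integralB// !integralL_ge0// -EFinB; congr (_%:E).
by rewrite LD// addrK.
Qed.

End UpperMeasure.

(** * Cut-off functions *)

Section Cutoff.
Context {R : realType} {d : nat} {G : lieGroupType R d}.

Lemma test_compR (h : R -> R) (f : G -> R) : (forall k, Ck_on k setT h) ->
  h 0 = 0 -> test f -> test (fun g => h (f g)).
Proof.
move=> sh h0 [sf cf]; split; first exact: smooth_compR.
apply: (compact_support_subset cf) => g /= hf; apply: subset_closure => /=.
by apply: contra_neq hf => ->.
Qed.

(* The map t |-> flat_exp 0 (s * t) with s -> +oo replaces a smooth step. *)
Lemma flat_exp_approx (a t : R) (s : nat -> R) : 0 <= a -> t < a ->
  (forall M, exists n, M < s n) -> exists n, t < a * flat_exp 0 (s n).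
Proof.
move=> a0 ta sM; have [t0|t0] := ltP t 0.
  by exists 0%N; apply: (lt_le_trans t0); rewrite mulr_ge0// flat_exp0_ge0.
have at0 : 0 < a - t by rewrite subr_gt0.
have apos : 0 < a by exact: le_lt_trans ta.
have [n sn] := sM (a / (a - t)); exists n.
have s0 : 0 < s n by apply: le_lt_trans sn; rewrite divr_ge0// ltW.
apply: (@lt_le_trans _ _ (a * (1 - (s n)^-1))).
  rewrite mulrBr mulr1 ltrBrDl addrC -ltrBrDl ltr_pdivrMr//.
  by rewrite mulrC -ltr_pdivrMr.
by rewrite ler_wpM2l// flat_exp0_lower.
Qed.

Lemma compact_test_ge1 (C : set G) : compact C ->
  exists theta : G -> R, [/\ test theta, forall g, 0 <= theta g &
    forall g, C g -> 1 <= theta g].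
Proof.
move=> cC; have [beta [tb b01 _ bpos]] := bump_cover (@openT G).
(* At each point some beta i is positive, so the factor n drives the increasing sequence to
   infinity. *)
pose s n g := n%:R * \sum_(i < n) beta i g.
have ts n : test (s n).
  by apply: testZ; exact: (test_sum (index_enum 'I_n) (fun i : 'I_n => tb i)).
have b0 i g : 0 <= beta i g by have /andP[] := b01 i g.
have s0 n g : 0 <= s n g by rewrite mulr_ge0// sumr_ge0.
have sS n g : s n g <= s n.+1 g.
  rewrite ler_pM// ?sumr_ge0//; first by rewrite ler_nat.
  by rewrite big_ord_recr /= lerDl.
have cu : continuous (fun _ : G => 1 : R) by move=> g; exact: cst_continuous.
have cs n : continuous (s n) by apply: smooth_continuous; have [] := ts n.
have [g Cg|N HN] := dini cu cs sS cC.
  have [i bi] := bpos g I.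
  have [n _ Hn] := nbhs_infty_gtr (beta i g)^-1.
  exists (maxn n i.+1); rewrite /s.
  apply: (@lt_le_trans _ _ ((maxn n i.+1)%:R * beta i g)).
    by rewrite -ltr_pdivrMr// div1r; apply: Hn; rewrite /= leq_maxl.
  rewrite ler_wpM2l// (bigD1 (Ordinal (leq_maxr n i.+1)))//= lerDl.
  by apply: sumr_ge0 => j _.
by exists (s N); split => // g /HN/ltW.
Qed.

Lemma test_exhaustion : exists s : nat -> G -> R,
  [/\ forall n, test (s n), forall n g, 0 <= s n g,
    forall n g, s n g <= s n.+1 g & forall g M, exists n, M < s n g].
Proof.
have [beta [tb b01 _ bpos]] := bump_cover (@openT G).
pose s n g := n%:R * \sum_(i < n) beta i g.
have b0 i g : 0 <= beta i g by have /andP[] := b01 i g.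
exists s; split.
- move=> n.
  by apply: testZ; exact: (test_sum (index_enum 'I_n) (fun i : 'I_n => tb i)).
- by move=> n g; rewrite mulr_ge0// sumr_ge0.
- move=> n g; rewrite ler_pM// ?sumr_ge0//; first by rewrite ler_nat.
  by rewrite big_ord_recr /= lerDl.
- move=> g M; have [i bi] := bpos g I.
  have [n _ Hn] := nbhs_infty_gtr (M / beta i g).
  exists (maxn n i.+1); rewrite /s.
  apply: (@lt_le_trans _ _ ((maxn n i.+1)%:R * beta i g)).
    by rewrite -ltr_pdivrMr//; apply: Hn; rewrite /= leq_maxl.
  rewrite ler_wpM2l// (bigD1 (Ordinal (leq_maxr n i.+1)))//= lerDl.
  by apply: sumr_ge0 => j _.
Qed.

Lemma plateau_exists (N : set G) : nbhs (1%g : G) N ->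
  exists zeta : G -> R, [/\ test zeta, forall g, 0 <= zeta g <= 1,
    \forall g \near (1%g : G), zeta g = 1 & forall g, zeta g != 0 -> N g].
Proof.
rewrite nbhsE => -[W [oW W1] WN].
have [eta [te e1 el e0 eO]] := bump_exists oW W1.
pose F := @flat_exp R 0.
have F1 : 0 < F 1 by exact: flat_exp0_gt0.
(* F vanishes on negative arguments, so zeta = 1 where eta >= 1/2, and zeta = 0 where eta = 0. *)
pose zeta g := 1 - (F 1)^-1 * F (1 - 2 * eta g).
have se : smooth eta by case: te.
have sz : smooth zeta.
  have s1 : smooth (fun g => 1 + (-2) * eta g).
    by apply: smoothD; [exact: smooth_cst|apply: smoothM => //; exact: smooth_cst].
  have := smoothD (smooth_cst 1) (smoothM (smooth_cst (- (F 1)^-1))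
    (smooth_compR (fun k => Ck_on_flat_exp k 0) s1)).
  by congr smooth; apply/funext => g; rewrite /zeta -/F !mulNr.
have zN g : zeta g != 0 -> eta g != 0.
  apply: contra_neq => eg; rewrite /zeta eg mulr0 subr0 mulVf ?subrr//.
  by rewrite gt_eqF.
have eta1 g : eta g <= 1.
  by have [->|/el/ltW//] := eqVneq g 1%g; rewrite e1.
exists zeta; split.
- split=> //; apply: (compact_support_subset te.2) => g zg.
  by apply: subset_closure; exact: zN.
- move=> g; rewrite /zeta subr_ge0 lerBlDr lerDl.
  rewrite mulr_ge0 ?invr_ge0 ?flat_exp0_ge0 ?(ltW F1)//.
  rewrite andbT mulrC ler_pdivrMr// mul1r flat_exp0_le//.
  by rewrite lerBlDr lerDl mulr_ge0.
- have ce : {for 1%g, continuous eta} by exact: smooth_continuous.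
  have : \forall g \near (1%g : G), 1 / 2 < eta g.
    by apply: (ce [set t | 1 / 2 < t]); rewrite e1; apply: lt_nbhsr; lra.
  apply: filterS => g eg; have {}eg : 1 / 2 < eta g by exact: eg.
  by rewrite /zeta /F (@flat_exp_npos _ 0 (1 - 2 * eta g)) ?mulr0 ?subr0//; lra.
- by move=> g /zN/eO/WN.
Qed.

(** With a bump eta whose strict maximum 1 is at the neutral element, n (1 - eta) - 1 is
    non-positive near it and tends to infinity elsewhere. Composed with [flat_exp 0] these functions
    vanish near 1 and increase to the indicator of the complement of 1. *)
Lemma punctured_exhaustion : exists s : nat -> G -> R,
  [/\ forall n, smooth (s n), forall n, \forall g \near (1%g : G), s n g <= 0,
    forall n g, s n g <= s n.+1 g & forall g, g != 1%g -> forall M, exists n, M < s n g].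
Proof.
have [eta [te e1 el e0 eO]] := bump_exists (@openT G) (I : setT (1%g : G)).
have se : smooth eta by case: te.
have eta1 g : eta g <= 1.
  by have [->|/el/ltW//] := eqVneq g 1%g; rewrite e1.
exists (fun n g => n%:R * (1 - eta g) - 1); split.
- move=> n; have s1 : smooth (fun g => 1 + (-1) * eta g).
    by apply: smoothD; [exact: smooth_cst|apply: smoothM => //; exact: smooth_cst].
  have := smoothD (smoothM (smooth_cst n%:R) s1) (smooth_cst (-1)).
  by congr smooth; apply/funext => g; rewrite mulN1r.
- move=> n; have ce : {for 1%g, continuous eta} by exact: smooth_continuous.
  have n1 : 0 < n%:R + 1 :> R by rewrite ltr_wpDl.
  have : \forall g \near (1%g : G), 1 - (n%:R + 1)^-1 < eta g.
    apply: (ce [set t | 1 - (n%:R + 1)^-1 < t]); rewrite e1; apply: lt_nbhsr.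
    by rewrite ltrBlDr ltrDl invr_gt0.
  apply: filterS => g; rewrite ltrBlDr -ltrBlDl => H; rewrite subr_le0.
  apply: (@le_trans _ _ (n%:R * (n%:R + 1)^-1)); first by rewrite ler_wpM2l// ltW.
  by rewrite ler_pdivrMr// mul1r lerDl.
- move=> n g; rewrite lerD2r ler_wpM2r ?ler_nat// subr_ge0//.
- move=> g g1 M; have eg : 0 < 1 - eta g by rewrite subr_gt0 el.
  have [n _ Hn] := nbhs_infty_gtr ((M + 1) / (1 - eta g)).
  exists n; rewrite ltrBrDr -ltr_pdivrMr//; apply: Hn; exact: leqnn.
Qed.

End Cutoff.

(** * Functionals satisfying the positive maximum principle at 1 *)

Section HasIntegral.
Context {disp : measure_display} {T : measurableType disp} {R : realType}.
Variable mu : {measure set T -> \bar R}.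
Implicit Types f g : T -> R.

(** Bundling integrability with a real value moves the algebra of integrals from the extended reals
    to R. *)
Definition has_integral (f : T -> R) (v : R) : Prop :=
  mu.-integrable setT (EFin \o f) /\ (\int[mu]_x (f x)%:E = v%:E)%E.

Lemma has_integralD f g v w : has_integral f v -> has_integral g w ->
  has_integral (fun x => f x + g x) (v + w).
Proof.
move=> [fi fv] [gi gw]; split; first exact: (integrableD measurableT fi gi).
by rewrite (integralD measurableT fi gi) fv gw.
Qed.

Lemma has_integralZ a f v : has_integral f v ->
  has_integral (fun x => a * f x) (a * v).
Proof.
move=> [fi fv]; split; first exact: (integrableZl measurableT a fi).
by rewrite (integralZl measurableT fi a) fv.
Qed.

Lemma has_integral0 : has_integral (fun=> 0) 0.
Proof. by split; [exact: integrable0|exact: integral0]. Qed.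

Lemma has_integral_sum (I : Type) (s : seq I) (f : I -> T -> R) (v : I -> R) :
  (forall i, has_integral (f i) (v i)) ->
  has_integral (fun x => \sum_(i <- s) f i x) (\sum_(i <- s) v i).
Proof.
move=> fv; elim: s => [|i s IH].
  rewrite big_nil; have := has_integral0; congr has_integral.
  by apply/funext => x; rewrite big_nil.
rewrite big_cons; have := has_integralD (fv i) IH; congr has_integral.
by apply/funext => x; rewrite big_cons.
Qed.

Lemma has_integral_le f g v w : has_integral f v -> has_integral g w ->
  (forall x, f x <= g x) -> v <= w.
Proof.
move=> [fi fv] [gi gw] fg; rewrite -lee_fin -fv -gw.
by apply: le_integral => // x _; rewrite lee_fin.
Qed.

Lemma has_integral_dominated f g w : measurable_fun setT f ->
  (forall x, `|f x| <= g x) -> has_integral g w -> exists v, has_integral f v.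
Proof.
move=> mf fg [gi gw].
have fi : mu.-integrable setT (EFin \o f).
  apply: le_integrable gi => //; first exact/measurable_EFinP.
  move=> x _; rewrite /= lee_fin [leRHS]ger0_norm//.
  exact: le_trans (fg x).
exists (fine (\int[mu]_x (f x)%:E)); split => //.
by rewrite fineK//; exact: integrable_fin_num.
Qed.

Lemma has_integral_bounded f M : measurable_fun setT f -> (forall x, 0 <= f x) ->
  (\int[mu]_x (f x)%:E <= M%:E)%E -> exists2 v, has_integral f v & v <= M.
Proof.
move=> mf f0 fM.
have fi : mu.-integrable setT (EFin \o f).
  apply/integrableP; split; first exact/measurable_EFinP.
  under eq_integral => x _ do rewrite /= ger0_norm//.
  exact: le_lt_trans fM (ltry _).
have E : (\int[mu]_x (f x)%:E)%E = (fine (\int[mu]_x (f x)%:E))%:E.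
  by rewrite fineK//; exact: integrable_fin_num.
by exists (fine (\int[mu]_x (f x)%:E)); [split|rewrite -lee_fin -E].
Qed.

End HasIntegral.

(** * The jump measure of a functional *)

Section Functional.
Context {R : realType} {d : nat} {G : lieGroupType R d}.
Variable L : (G -> R) -> R.
Hypothesis LD : forall f g, test f -> test g -> L (fun h => f h + g h) = L f + L g.
Hypothesis LZ : forall a f, test f -> L (fun h => a * f h) = a * L f.
Hypothesis L_max : forall f, test f -> (forall g, f g <= f 1%g) -> 0 <= f 1%g ->
  L f <= 0.

Lemma functional_ge0 f : test f -> (forall g, 0 <= f g) -> f 1%g = 0 -> 0 <= L f.
Proof.
move=> tf f0 f1; rewrite -oppr_le0 -mulN1r -LZ//; apply: L_max.
- exact: testZ.
- by move=> g; rewrite f1 mulr0 mulN1r oppr_le0.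
- by rewrite f1 mulr0.
Qed.

Lemma functionalB f g : test f -> test g -> L (fun h => f h - g h) = L f - L g.
Proof.
move=> tf tg; rewrite -mulN1r -LZ// -LD//; last exact: testZ.
by congr L; apply/funext => h; rewrite mulN1r.
Qed.

Lemma functional_le f g : test f -> test g -> (forall h, f h <= g h) ->
  f 1%g = g 1%g -> L f <= L g.
Proof.
move=> tf tg fg fg1; rewrite -subr_ge0 -functionalB//; apply: functional_ge0.
- exact: testB.
- by move=> h; rewrite subr_ge0.
- by rewrite fg1 subrr.
Qed.

Lemma functional0 : L (fun=> 0) = 0.
Proof.
rewrite -[RHS](mul0r (L (fun=> 0))) -LZ; last exact: test_cst0.
by congr L; apply/funext => h; rewrite mulr0.
Qed.

Lemma functional_sum (I : Type) (s : seq I) (F : I -> G -> R) :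
  (forall i, test (F i)) ->
  L (fun g => \sum_(i <- s) F i g) = \sum_(i <- s) L (F i).
Proof.
move=> tF; elim: s => [|i s IH].
  by rewrite big_nil -[RHS]functional0; congr L; apply/funext => g; rewrite big_nil.
rewrite big_cons -IH -LD//; last exact: test_sum.
by congr L; apply/funext => g; rewrite big_cons.
Qed.

(** Vanishing on a neighbourhood matters: on functions that merely vanish at 1, L may also involve
    derivatives at 1. *)
Definition punctured_test (f : G -> R) : Prop :=
  test f /\ \forall g \near (1%g : G), f g = 0.

Let K : set (G -> R) := punctured_test.

Lemma punctured_test0 : K (fun=> 0).
Proof. by split; [exact: test_cst0|exact: nearW]. Qed.

Lemma punctured_testD f g : K f -> K g -> K (fun x => f x + g x).
Proof.
move=> [tf f0] [tg g0]; split; first exact: testD.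
by apply: filterS2 f0 g0 => x -> ->; rewrite addr0.
Qed.

Lemma punctured_testZ a f : K f -> K (fun x => a * f x).
Proof.
move=> [tf f0]; split; first exact: testZ.
by apply: filterS f0 => x ->; rewrite mulr0.
Qed.

Lemma punctured_testM f g : K f -> smooth g -> K (fun x => f x * g x).
Proof.
move=> [tf f0] sg; split; first exact: testMl.
by apply: filterS f0 => x ->; rewrite mul0r.
Qed.

Lemma punctured_test1 f : K f -> f 1%g = 0.
Proof. by move=> [_ /nbhs_singleton]. Qed.

Lemma punctured_LD f g : K f -> K g -> L (fun h => f h + g h) = L f + L g.
Proof. by move=> [tf _] [tg _]; exact: LD. Qed.

Lemma punctured_LZ a f : K f -> L (fun h => a * f h) = a * L f.
Proof. by move=> [tf _]; exact: LZ. Qed.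

Lemma punctured_L_ge0 f : K f -> (forall x, 0 <= f x) -> 0 <= L f.
Proof. by move=> Kf f0; apply: functional_ge0 => //; [case: Kf|exact: punctured_test1]. Qed.

Lemma punctured_cover (O : set G) : open O -> exists beta : nat -> G -> R,
  [/\ forall n f, K f -> K (fun x => f x * beta n x),
    forall n x, 0 <= beta n x <= 1,
    forall n x, beta n x != 0 -> O x & forall x, O x -> exists n, 0 < beta n x].
Proof.
move=> /bump_cover[beta [tb b01 bO Ob]]; exists beta; split => // n f Kf.
by apply: punctured_testM => //; case: (tb n).
Qed.

Lemma punctured_continuous f : K f -> continuous f.
Proof. by move=> [[sf _] _]; exact: smooth_continuous. Qed.

Lemma punctured_bounded f : K f -> exists2 b, 0 < b & forall x, `|f x| <= b.
Proof. by move=> [tf _]; exact: test_bounded. Qed.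

(** The support of f is closed and misses a neighbourhood W of 1, so a test function that is at
    least 1 on it can be cut off inside W and still vanish near 1. *)
Lemma punctured_support f : K f -> exists C chi,
  [/\ compact C, K chi, forall x, 0 <= chi x, forall x, C x -> 1 <= chi x &
    forall x, f x != 0 -> C x].
Proof.
move=> [[sf cf] f0].
have : nbhs (1%g : G) [set g | f g = 0] by exact: f0.
rewrite nbhsE => -[W [oW W1] Wf].
have [zeta' [tz' z01' z1' zN']] := plateau_exists (open_nbhs_nbhs (conj oW W1)).
have [theta [tt t0 t1]] := compact_test_ge1 cf.
have sz' : smooth zeta' by case: tz'.
exists (closure [set g | f g != 0]), (fun g => theta g * (1 - zeta' g)).
have CW : closure [set g | f g != 0] `<=` ~` W.
  have /closure_id -> : closed (~` W) by exact: open_closedC.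
  by apply: closureS => g /= fg /Wf; apply/eqP.
split => //.
- split; last by apply: filterS z1' => g ->; rewrite subrr mulr0.
  apply: testMl => //.
  have := smoothD (smooth_cst 1) (smoothM (smooth_cst (-1)) sz').
  by congr smooth; apply/funext => g; rewrite mulN1r.
- by move=> g; rewrite mulr_ge0// subr_ge0; have /andP[] := z01' g.
- move=> g Cg; have -> : zeta' g = 0.
    by apply: contra_notP (CW _ Cg) => /eqP/zN'.
  by rewrite subr0 mulr1; exact: t1.
- by move=> g fg; apply: subset_closure.
Qed.

(** No function of K is positive at 1, so the constant weight 1 would leave {1} without covers and
    give it infinite mass; this weight gives it mass 0. *)
Definition off1 (g : G) : R := (g != 1%g)%:R.

Lemma off1_ge0 g : 0 <= off1 g. Proof. exact: ler0n. Qed.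

Lemma off1_le1 g : off1 g <= 1. Proof. by rewrite /off1; case: (_ != _). Qed.

Lemma punctured_off1 f x : K f -> f x != 0 -> off1 x = 1.
Proof.
move=> /punctured_test1 f1 fx; rewrite /off1 (_ : x != 1%g)//.
by apply: contra_neq fx => ->.
Qed.

Definition jump_measure : {measure set (borelType G) -> \bar R} :=
  upper_borel_measure punctured_test0 punctured_testD punctured_testZ
    punctured_LD punctured_LZ punctured_L_ge0 punctured_cover off1_ge0.

Local Notation mu := jump_measure.
Local Notation upper_bound := (upper_bound_on K L).

Lemma jump_measure_le A M : upper_bound off1 A M -> (mu A <= M%:E)%E.
Proof. exact: upper_measure_le. Qed.

Lemma integral_le_bound f M : (forall x, 0 <= f x) -> upper_bound f setT M ->
  (\int[mu]_x (f x)%:E <= M%:E)%E.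
Proof.
move=> f0 H; apply: le_trans (upper_measure_le H).
exact: (integral_le_upper punctured_test0 punctured_testD punctured_testZ
  punctured_LD punctured_LZ punctured_L_ge0 punctured_cover off1_ge0 off1_le1 f0).
Qed.

Lemma integral_punctured f : K f ->
  mu.-integrable setT (EFin \o f) /\ (\int[mu]_x (f x)%:E = (L f)%:E)%E.
Proof.
exact: (integralL punctured_test0 punctured_testD punctured_testZ punctured_LD
  punctured_LZ punctured_L_ge0 punctured_cover (@manifold_hausdorff R d G)
  punctured_continuous punctured_bounded punctured_support off1_ge0 off1_le1 punctured_off1).
Qed.

Lemma jump_measure1 : mu [set 1%g] = 0%E.
Proof.
apply/eqP; rewrite eq_le measure_ge0 andbT; apply: jump_measure_le.
exists (fun _ _ => 0); split => //.
  by move=> n; split; [exact: punctured_test0|rewrite functional0].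
by move=> x -> t; rewrite /off1 eqxx => t0; exists 0%N.
Qed.

(** Cutting f off near 1 by an increasing sequence keeps the value 0 at 1, and L is monotone among
    test functions with equal values at 1. *)
Lemma upper_bound_at1 f : test f -> (forall g, 0 <= f g) -> f 1%g = 0 ->
  upper_bound f setT (L f).
Proof.
move=> tf f0 f1; have [s [ss s1 sS sM]] := @punctured_exhaustion R d G.
have sF n : smooth (fun g => flat_exp 0 (s n g)).
  by apply: smooth_compR => //; move=> k; exact: Ck_on_flat_exp.
have tg n : test (fun g => f g * flat_exp 0 (s n g)) by exact: testMl.
exists (fun n g => f g * flat_exp 0 (s n g)); split.
- move=> n; split.
    by split => //; apply: filterS (s1 n) => g sg; rewrite flat_exp_npos ?mulr0.
  apply: functional_le => //; last by rewrite f1 mul0r.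
  by move=> g; rewrite ler_piMr// flat_exp0_le1.
- by move=> n g; rewrite mulr_ge0// flat_exp0_ge0.
- by move=> n g; rewrite ler_wpM2l// flat_exp0_le.
- move=> g _ t tf'; have [g1|/sM H] := eqVneq g 1%g; last exact: flat_exp_approx.
  by exists 0%N; rewrite g1 f1 mul0r -f1 -g1.
Qed.

(* zeta + (1 - zeta) F is maximal at 1 for every 0 <= F <= 1, so that L of the
   second summand is at most - L zeta. *)
Lemma upper_bound_plateau zeta : test zeta -> (forall g, 0 <= zeta g <= 1) ->
  (\forall g \near (1%g : G), zeta g = 1) ->
  upper_bound (fun g => 1 - zeta g) setT (- L zeta).
Proof.
move=> tz z01 z1; have [s [ts s0 sS sM]] := @test_exhaustion R d G.
have z11 : zeta 1%g = 1 by exact: nbhs_singleton z1.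
have tF n : test (fun g => flat_exp 0 (s n g)).
  by apply: test_compR => //; [move=> k; exact: Ck_on_flat_exp|exact: flat_exp_npos].
have c0 g : 0 <= 1 - zeta g by rewrite subr_ge0; have /andP[] := z01 g.
have tg n : test (fun g => (1 - zeta g) * flat_exp 0 (s n g)).
  have := testMl (tF n) (smoothD (smooth_cst 1) (testN tz).1).
  by congr test; apply/funext => g; rewrite mulrC.
exists (fun n g => (1 - zeta g) * flat_exp 0 (s n g)); split.
- move=> n; split.
    by split => //; apply: filterS z1 => g ->; rewrite subrr mul0r.
  rewrite -subr_le0 opprK addrC -LD//; apply: L_max.
  + exact: testD.
  + move=> g; rewrite z11 subrr mul0r addr0 -lerBrDl.
    by rewrite ler_piMr// flat_exp0_le1.
  + by rewrite z11 subrr mul0r addr0.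
- by move=> n g; rewrite mulr_ge0// flat_exp0_ge0.
- by move=> n g; rewrite ler_wpM2l// flat_exp0_le.
- by move=> g _ t tf'; apply: flat_exp_approx => // M; exact: sM.
Qed.

(** Off U the mass is controlled by 1 - zeta, for a plateau zeta supported in U; the sum of squares
    is a non-negative test function vanishing at 1, so its integral is at most its value under L. *)
Lemma jump_measure_levy (X : 'I_d -> lieAlgebra G) : levy_measure X mu.
Proof.
split; first exact: jump_measure1.
move=> U x hx; split; last first.
  have UN : nbhs (1%g : G) U.
    apply: open_nbhs_nbhs; split; first exact: (open_canonical_dom hx).
    exact: (canonical_dom1 hx).
  have [zeta [tz z01 z1 zU]] := plateau_exists UN.
  apply: (@le_lt_trans _ _ (- L zeta)%:E); last exact: ltry.
  rewrite -[- L zeta]divr1; apply: jump_measure_le.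
  apply: (@upper_bound_scale _ _ _ _ punctured_testZ punctured_LZ _ _ _ _ 1 ltr01); last first.
    exact: (upper_bound_subset (@subsetT _ _) (upper_bound_plateau tz z01 z1)).
  move=> g Ug; rewrite mul1r; have -> : zeta g = 0.
    by apply: contra_notP Ug => /eqP/zU.
  by rewrite subr0 off1_le1.
pose S g := \sum_(i < d) x i g ^+ 2.
have tS : test S.
  apply: (test_sum (index_enum 'I_d)) => i.
  have tx := test_testFun (x i); have := testMl tx tx.1.
  by congr test; apply/funext => g; rewrite expr2.
have S0 g : 0 <= S g by apply: sumr_ge0 => i _; exact: sqr_ge0.
have S1 : S 1%g = 0.
  by rewrite /S big1// => i _; rewrite (coord1 hx) expr0n.
apply: (@le_lt_trans _ _ (L S)%:E); last exact: ltry.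
apply: le_trans (integral_le_bound S0 (upper_bound_at1 tS S0 S1)).
apply: ge0_subset_integral => //.
- by apply: sub_sigma_algebra; exact: (open_canonical_dom hx).
- apply/measurable_EFinP; apply: continuous_measurable_borel.
  exact: smooth_continuous tS.1.
- by move=> g _; rewrite lee_fin; exact: S0.
Qed.

(** * Diffusion, drift and killing *)

Section Decomposition.
Variables (X : 'I_d -> lieAlgebra G) (U : set G) (x : 'I_d -> testFun G).
Hypothesis hx : canonical_coordinates X U x.

Lemma test_measurable f : test f -> measurable_fun [set: borelType G] f.
Proof. by move=> [sf _]; apply: continuous_measurable_borel; exact: smooth_continuous. Qed.

Let S (g : G) : R := \sum_(i < d) x i g ^+ 2.

Lemma test_coordM j k : test (fun g => x j g * x k g).
Proof. by apply: testMl; [exact: test_testFun|case: (test_testFun (x k))]. Qed.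

Lemma test_coord_sqr : test S.
Proof.
apply: (test_sum (index_enum 'I_d)) => i; have := test_coordM i i.
by congr test; apply/funext => g; rewrite expr2.
Qed.

Lemma coord_sqr_ge0 g : 0 <= S g.
Proof. by apply: sumr_ge0 => i _; exact: sqr_ge0. Qed.

Lemma coord_sqr1 : S 1%g = 0.
Proof. by rewrite /S big1// => i _; rewrite (coord1 hx) expr0n. Qed.

Lemma has_integral_at1 f : test f -> (forall g, 0 <= f g) -> f 1%g = 0 ->
  exists2 v, has_integral mu f v & v <= L f.
Proof.
move=> tf f0 f1; apply: has_integral_bounded => //; first exact: test_measurable.
exact: integral_le_bound (upper_bound_at1 tf f0 f1).
Qed.

(* L may charge the point 1 through the diffusion part, but not on functions
   that are small compared with the squared coordinates. *)
Lemma integral_small q : test q ->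
  (forall e, 0 < e -> \forall g \near (1%g : G), `|q g| <= e * S g) ->
  has_integral mu q (L q).
Proof.
move=> tq qS.
have [s Ss sL] := has_integral_at1 test_coord_sqr coord_sqr_ge0 coord_sqr1.
(* A plateau supported where |q| <= e S splits q: the part away from 1 is in K, where L and mu
   agree, and the part near 1 is bounded by e S everywhere. *)
have split_q e : 0 < e -> exists q1 q2 v, [/\ K q1, test q2,
    has_integral mu q2 v, forall g, q g = q1 g + q2 g & forall g, `|q2 g| <= e * S g].
  move=> e0; have [zeta [tz z01 z1 zN]] := plateau_exists (qS e e0).
  have tq2 : test (fun g => q g * zeta g) by apply: testMl => //; case: tz.
  have q2S g : `|q g * zeta g| <= e * S g.
    have /andP[z0 zle] := z01 g; rewrite normrM (ger0_norm z0).
    have [->|/zN/= qg] := eqVneq (zeta g) 0.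
      by rewrite mulr0 mulr_ge0 ?coord_sqr_ge0// ltW.
    by apply: le_trans qg; rewrite ler_piMr.
  have [v q2v] := has_integral_dominated (test_measurable tq2) q2S (has_integralZ e Ss).
  exists (fun g => q g - q g * zeta g), (fun g => q g * zeta g), v; split => //.
    by split; [exact: testB|apply: filterS z1 => g ->; rewrite mulr1 subrr].
  by move=> g; rewrite subrK.
have [w qw] : exists w, has_integral mu q w.
  have [q1 [q2 [v [Kq1 tq2 q2v E _]]]] := split_q 1 ltr01.
  exists (L q1 + v); have := has_integralD (integral_punctured Kq1) q2v.
  by congr has_integral; apply/funext => g; rewrite E.
suff -> : L q = w by [].
have LS0 : 0 <= L S.
  apply: functional_ge0 coord_sqr1; [exact: test_coord_sqr|exact: coord_sqr_ge0].
apply/eqP; rewrite -subr_eq0 -normr_le0; apply/ler_addgt0Pr => e e0; rewrite add0r.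
(* Both L q2 and the integral of q2 are at most e' L S in absolute value, hence the 2; adding 1
   covers L S = 0. *)
pose e' := e / (2 * (L S + 1)).
have p0 : 0 < 2 * (L S + 1) by rewrite mulr_gt0// ltr_wpDl.
have e'0 : 0 < e' by rewrite divr_gt0.
have [q1 [q2 [v [Kq1 tq2 q2v E q2S]]]] := split_q e' e'0.
have tS' : test (fun g => e' * S g) by apply: testZ; exact: test_coord_sqr.
have q20 : q2 1%g = 0.
  by have := q2S 1%g; rewrite coord_sqr1 mulr0 normr_le0 => /eqP.
have Lq : L q = L q1 + L q2.
  by rewrite -LD//; [congr L; apply/funext|case: Kq1].
have wq : w = L q1 + v.
  have := has_integralD (integral_punctured Kq1) q2v.
  have -> : (fun g => q1 g + q2 g) = q by apply/funext => g; rewrite E.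
  by move=> [_ ]; have [_ ->] := qw => -[].
have q2N g : - (e' * S g) <= q2 g /\ q2 g <= e' * S g.
  by apply/andP; rewrite -ler_norml.
have Lq2 : `|L q2| <= e' * L S.
  have LSe : L (fun g => e' * S g) = e' * L S by apply: LZ; exact: test_coord_sqr.
  rewrite ler_norml -LSe; apply/andP; split.
    rewrite -mulN1r -LZ//; apply: functional_le => //; first exact: testZ.
      by move=> g; rewrite mulN1r; have [] := q2N g.
    by rewrite coord_sqr1 q20 !mulr0.
  apply: functional_le => //; first by move=> g; have [] := q2N g.
  by rewrite coord_sqr1 q20 mulr0.
have v2 : `|v| <= e' * L S.
  have eS := has_integralZ e' Ss.
  have le1 : `|v| <= e' * s.
    rewrite ler_norml; apply/andP; split.
      rewrite -mulN1r; apply: (has_integral_le (has_integralZ (-1) eS) q2v) => g.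
      by rewrite mulN1r; have [] := q2N g.
    by apply: (has_integral_le q2v eS) => g; have [] := q2N g.
  by apply: le_trans le1 _; rewrite ler_wpM2l// ltW.
have -> : L q - w = L q2 - v by rewrite Lq wq; ring.
apply: (le_trans (ler_normB _ _)); apply: (le_trans (lerD Lq2 v2)).
have Ee : e' * (2 * (L S + 1)) = e by rewrite /e' divfK// gt_eqF.
rewrite -Ee; nra.
Qed.

Local Notation dc := (dcoord hx).
Local Notation hc := (hcoord hx).

Lemma coord_integrable j k : exists v, has_integral mu (fun g => x j g * x k g) v.
Proof.
have [s Ss sL] := has_integral_at1 test_coord_sqr coord_sqr_ge0 coord_sqr1.
apply: (has_integral_dominated (test_measurable (test_coordM j k)) _ Ss) => g.
have le_S i : x i g ^+ 2 <= S g.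
  by rewrite /S (bigD1 i)//= lerDl; apply: sumr_ge0 => l _; exact: sqr_ge0.
rewrite normrM; have := le_S j; have := le_S k.
rewrite -[x j g ^+ 2]real_normK ?num_real// -[x k g ^+ 2]real_normK ?num_real//.
have := sqr_ge0 (`|x j g| - `|x k g|); rewrite sqrrB; lra.
Qed.

Definition coord_moment j k : R := projT1 (cid (coord_integrable j k)).

Lemma has_integral_coord j k :
  has_integral mu (fun g => x j g * x k g) (coord_moment j k).
Proof. by rewrite /coord_moment; case: cid. Qed.

(** The half is that of the Taylor polynomial, whose quadratic coefficients are h_jk / 2. *)
Definition diffusion j k : R := (L (fun g => x j g * x k g) - coord_moment j k) / 2.

Lemma diffusion_sym j k : diffusion j k = diffusion k j.
Proof.
rewrite /diffusion.
have E : (fun g => x j g * x k g) = (fun g => x k g * x j g).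
  by apply/funext => g; rewrite mulrC.
have := has_integral_coord j k; rewrite E => -[_ Ij].
by have [_] := has_integral_coord k j; rewrite Ij => -[->].
Qed.

(** The form at v is half of L f - int f for f = (sum v_j x_j)^2, a non-negative test function
    vanishing at 1. *)
Lemma diffusion_ge0 (v : 'I_d -> R) :
  0 <= \sum_(j < d) \sum_(k < d) v j * v k * diffusion j k.
Proof.
pose f g := \sum_(j < d) \sum_(k < d) (v j * v k) * (x j g * x k g).
have fE g : f g = (\sum_(j < d) v j * x j g) ^+ 2.
  rewrite expr2 mulr_suml; apply: eq_bigr => j _; rewrite mulr_sumr.
  by apply: eq_bigr => k _; ring.
have tjk j k : test (fun g => (v j * v k) * (x j g * x k g)).
  by apply: testZ; exact: test_coordM.
have tj j : test (fun g => \sum_(k < d) (v j * v k) * (x j g * x k g)).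
  exact: (test_sum (index_enum 'I_d) (tjk j)).
have tf : test f by exact: (test_sum (index_enum 'I_d) tj).
have Lf : L f = \sum_(j < d) \sum_(k < d) v j * v k * L (fun g => x j g * x k g).
  rewrite /f (functional_sum (index_enum 'I_d) tj); apply: eq_bigr => j _.
  rewrite (functional_sum (index_enum 'I_d) (tjk j)); apply: eq_bigr => k _.
  by rewrite LZ//; exact: test_coordM.
have If : has_integral mu f (\sum_(j < d) \sum_(k < d) v j * v k * coord_moment j k).
  apply: has_integral_sum => j; apply: has_integral_sum => k.
  by apply: has_integralZ; exact: has_integral_coord.
have f0 g : 0 <= f g by rewrite fE sqr_ge0.
have f1 : f 1%g = 0.
  by rewrite fE big1 ?expr0n// => j _; rewrite (coord1 hx) mulr0.
have [w Iw wL] := has_integral_at1 tf f0 f1.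
have E : w = \sum_(j < d) \sum_(k < d) v j * v k * coord_moment j k.
  by have [_ Ew] := Iw; have [_] := If; rewrite Ew => -[].
have -> : \sum_(j < d) \sum_(k < d) v j * v k * diffusion j k = (L f - w) / 2.
  rewrite Lf E -sumrB mulr_suml; apply: eq_bigr => j _.
  rewrite -sumrB mulr_suml; apply: eq_bigr => k _.
  by rewrite /diffusion; ring.
by rewrite divr_ge0// subr_ge0.
Qed.

Lemma smooth_coordM j k : smooth (fun g => x j g * x k g).
Proof. by case: (test_coordM j k). Qed.

Lemma hcoord_coordM l m j k :
  hc l m (fun g => x j g * x k g) =
  (j == l)%:R * (k == m)%:R + (k == l)%:R * (j == m)%:R.
Proof.
rewrite hcoordM ?(coord1 hx)//; [|by case: (test_testFun (x j))|by case: (test_testFun (x k))].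
by rewrite !dcoord_coord.
Qed.

Lemma sum_delta (F : 'I_d -> R) (m : 'I_d) :
  \sum_(k < d) (k == m)%:R * F k = F m.
Proof.
rewrite (bigD1 m) //= eqxx mul1r big1 ?addr0 // => k km.
by rewrite (negbTE km) mul0r.
Qed.

Lemma functional_decomposition : exists (c : R) (b : 'I_d -> R), 0 <= c /\
  forall f, test f ->
    ((L f)%:E = (- c * f 1%g + \sum_(i < d) b i * left_field (X i) f 1%g
      + \sum_(j < d) \sum_(k < d)
          diffusion j k * left_field (X j) (left_field (X k) f) 1%g)%:E
     + \int[mu]_g
         (f g - f 1%g - \sum_(i < d) x i g * left_field (X i) f 1%g)%:E)%E.
Proof.
(* Identities on plain real variables, applied below with iterated sums in their place. *)
have aux1 (u v : R) : u - (u + v) / 2 = (u - v) / 2 by field.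
have aux2 (u v : R) : (u - v) / 2 + (v - u) / 2 = 0 by field.
have aux3 (u v w : R) : (u - v) / 2 * w = w / 2 * u - w / 2 * v by field.
have aux4 (lq lqu ll lz f1 p b m : R) : lq + lqu + ll + f1 * lz =
    - - (lz + p) * f1 + (ll - b) + (lqu - m + b) + (lq + m + - f1 * p) by ring.
have aux5 (u f1 z l qu : R) :
    u - f1 * z - l - qu + qu + - f1 * (1 - z) = u - f1 - l by ring.
have aux6 (l a b c : R) : l = l - a - b - c + c + b + a by ring.
have [zeta [tz z01 z1 _]] := plateau_exists (@filterT _ (nbhs (1%g : G)) _).
have sz : smooth zeta by case: tz.
have z11 : zeta 1%g = 1 by exact: nbhs_singleton z1.
have cz0 g : 0 <= 1 - zeta g by rewrite subr_ge0; have /andP[] := z01 g.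
have mcz : measurable_fun [set: borelType G] (fun g => 1 - zeta g).
  by apply: measurable_funB => //; exact: test_measurable.
have [p Ip pL] := has_integral_bounded mcz cz0
  (integral_le_bound cz0 (upper_bound_plateau tz z01 z1)).
pose B i j k := left_field (X j) (left_field (X k) (x i)) 1%g.
exists (- (L zeta + p)).
(* The subtracted sum compensates the first order part of X_j X_k found in [left_field2]. *)
exists (fun i => L (x i) - \sum_(j < d) \sum_(k < d) diffusion j k * B i j k).
split; first by rewrite oppr_ge0 addrC -lerBrDr sub0r.
move=> f tf; have sf : smooth f by case: tf.
have tx i : test (x i) by exact: test_testFun.
have sx i : smooth (x i) by case: (tx i).
have [h hE] : exists h : 'I_d -> 'I_d -> R, forall j k, hc j k f = h j k.
  by exists (fun j k => hc j k f).
pose lin g := \sum_(i < d) dc i f * x i g.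
pose quad g := \sum_(j < d) \sum_(k < d) (h j k / 2) * (x j g * x k g).
pose q g := f g - f 1%g * zeta g - lin g - quad g.
have t2 j k : test (fun g => (h j k / 2) * (x j g * x k g)).
  by apply: testZ; exact: test_coordM.
have t1 j : test (fun g => \sum_(k < d) (h j k / 2) * (x j g * x k g)).
  exact: (test_sum (index_enum 'I_d) (t2 j)).
have tquad : test quad by exact: (test_sum (index_enum 'I_d) t1).
have tli i : test (fun g => dc i f * x i g) by apply: testZ.
have tlin : test lin by exact: (test_sum (index_enum 'I_d) tli).
have tfz : test (fun g => f 1%g * zeta g) by exact: testZ.
have tq1 : test (fun g => f g - f 1%g * zeta g) by exact: testB.
have tq2 : test (fun g => f g - f 1%g * zeta g - lin g) by exact: testB.
have tq : test q by exact: testB.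
have q1 : q 1%g = 0.
  rewrite /q z11 mulr1 subrr sub0r /lin /quad.
  rewrite !big1 ?subr0 ?oppr0// => i _; last by rewrite (coord1 hx) mulr0.
  by apply: big1 => k _; rewrite (coord1 hx) mul0r mulr0.
have Dlin i : dc i lin = dc i f.
  rewrite /lin (dcoord_sum hx (index_enum 'I_d) i (fun l => (tli l).1)).
  rewrite (bigD1 i)//= big1 ?addr0.
    by rewrite dcoordZ// dcoord_coord eqxx mulr1.
  by move=> l li; rewrite dcoordZ// dcoord_coord (negbTE li) mulr0.
have Dquad i : dc i quad = 0.
  rewrite /quad (dcoord_sum hx (index_enum 'I_d) i (fun j => (t1 j).1)).
  apply: big1 => j _; rewrite (dcoord_sum hx (index_enum 'I_d) i (fun k => (t2 j k).1)).
  apply: big1 => k _; rewrite dcoordZ; last exact: smooth_coordM.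
  by rewrite dcoordM// !(coord1 hx) !mul0r addr0 mulr0.
have Dz i : dc i (fun g => f 1%g * zeta g) = 0.
  by rewrite dcoordZ// (dcoord_near_cst hx i z1) mulr0.
have Dq i : dc i q = 0.
  have /= E1 := dcoordB hx i tq2.1 tquad.1.
  have /= E2 := dcoordB hx i tq1.1 tlin.1.
  have /= E3 := dcoordB hx i sf tfz.1.
  by rewrite /q E1 E2 E3 Dz Dlin Dquad !subr0 subrr.
have Hlin l m : hc l m lin = 0.
  rewrite /lin (hcoord_sum hx (index_enum 'I_d) l m (fun i => (tli i).1)).
  by apply: big1 => i _; rewrite hcoordZ// hcoord_coord mulr0.
have Hz l m : hc l m (fun g => f 1%g * zeta g) = 0.
  by rewrite hcoordZ// (hcoord_near_cst hx l m z1) mulr0.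
have Hquad l m : hc l m quad = (h l m + h m l) / 2.
  rewrite /quad (hcoord_sum hx (index_enum 'I_d) l m (fun j => (t1 j).1)).
  transitivity (\sum_(j < d) ((j == l)%:R * (h j m / 2) + (j == m)%:R * (h j l / 2))).
    apply: eq_bigr => j _.
    rewrite (hcoord_sum hx (index_enum 'I_d) l m (fun k => (t2 j k).1)).
    transitivity (\sum_(k < d) ((k == m)%:R * ((j == l)%:R * (h j k / 2)) +
        (k == l)%:R * ((j == m)%:R * (h j k / 2)))).
      apply: eq_bigr => k _; rewrite hcoordZ; last exact: smooth_coordM.
      by rewrite hcoord_coordM; ring.
    by rewrite big_split !sum_delta.
  by rewrite big_split !sum_delta mulrDl.
(* The Hessian of q is antisymmetric, so its symmetrisation vanishes as [coord_taylor] requires. *)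
have Hq l m : hc l m q = (h l m - h m l) / 2.
  have /= E1 := hcoordB hx l m tq2.1 tquad.1.
  have /= E2 := hcoordB hx l m tq1.1 tlin.1.
  have /= E3 := hcoordB hx l m sf tfz.1.
  rewrite /q E1 E2 E3 Hz Hlin Hquad hE !subr0.
  exact: aux1.
have Iq : has_integral mu q (L q).
  have Hq2 : forall l m, hc l m q + hc m l q = 0.
    by move=> l m; rewrite !Hq; exact: aux2.
  exact: integral_small tq (coord_taylor tq.1 q1 Dq Hq2).
have Iquad : has_integral mu quad
    (\sum_(j < d) \sum_(k < d) (h j k / 2) * coord_moment j k).
  apply: has_integral_sum => j; apply: has_integral_sum => k.
  by apply: has_integralZ; exact: has_integral_coord.
have Lquad : L quad = \sum_(j < d) \sum_(k < d) (h j k / 2) * L (fun g => x j g * x k g).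
  rewrite /quad (functional_sum (index_enum 'I_d) t1); apply: eq_bigr => j _.
  rewrite (functional_sum (index_enum 'I_d) (t2 j)); apply: eq_bigr => k _.
  by rewrite LZ//; exact: test_coordM.
have Llin : L lin = \sum_(i < d) dc i f * L (x i).
  rewrite /lin (functional_sum (index_enum 'I_d) tli); apply: eq_bigr => i _.
  by rewrite LZ.
have Lf : L f = L q + L quad + L lin + f 1%g * L zeta.
  have -> : L q = L f - f 1%g * L zeta - L lin - L quad.
    by rewrite /q functionalB// functionalB// functionalB// LZ.
  exact: aux6.
(* The integrand is q + quad - f(1) (1 - zeta): the compensator cancels [lin], and the last term is
   the difference between the constant f(1) and f(1) zeta. *)
have [_ IF] : has_integral mu
    (fun g => f g - f 1%g - \sum_(i < d) x i g * left_field (X i) f 1%g)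
    (L q + (\sum_(j < d) \sum_(k < d) (h j k / 2) * coord_moment j k) + (- f 1%g) * p).
  have := has_integralD (has_integralD Iq Iquad) (has_integralZ (- f 1%g) Ip).
  congr has_integral; apply/funext => g.
  have -> : \sum_(i < d) x i g * left_field (X i) f 1%g = lin g.
    by apply: eq_bigr => i _; rewrite (left_field1 hx)// mulrC.
  exact: aux5.
rewrite IF -EFinD; congr (_%:E).
have E1 : \sum_(j < d) \sum_(k < d)
      diffusion j k * left_field (X j) (left_field (X k) f) 1%g =
    \sum_(j < d) \sum_(k < d) diffusion j k * h j k +
    \sum_(i < d) dc i f * \sum_(j < d) \sum_(k < d) diffusion j k * B i j k.
  under [X in _ = _ + X]eq_bigr => i _ do rewrite mulr_sumr.
  rewrite [X in _ = _ + X]exchange_big -big_split; apply: eq_bigr => j _ /=.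
  under [X in _ = _ + X]eq_bigr => i _ do rewrite mulr_sumr.
  rewrite [X in _ = _ + X]exchange_big -big_split; apply: eq_bigr => k _ /=.
  rewrite (left_field2 hx j k sf) hE mulrDr mulr_sumr; congr (_ + _).
  by apply: eq_bigr => i _; rewrite mulrCA.
have E2 : \sum_(i < d) (L (x i) - \sum_(j < d) \sum_(k < d) diffusion j k * B i j k) *
      left_field (X i) f 1%g =
    L lin - \sum_(i < d) dc i f * \sum_(j < d) \sum_(k < d) diffusion j k * B i j k.
  rewrite Llin -sumrB; apply: eq_bigr => i _.
  by rewrite (left_field1 hx)// mulrC mulrBr.
have E3 : \sum_(j < d) \sum_(k < d) diffusion j k * h j k = L quad -
    \sum_(j < d) \sum_(k < d) (h j k / 2) * coord_moment j k.
  rewrite Lquad -sumrB; apply: eq_bigr => j _; rewrite -sumrB; apply: eq_bigr => k _.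
  by rewrite /diffusion; exact: aux3.
rewrite [X in _ = _ + X + _]E1 [X in _ = _ + X + _ + _]E2 E3 Lf; exact: aux4.
Qed.

End Decomposition.

End Functional.

(** * The equivalence *)

Section PSD.
Context {R : realType} {d : nat}.
Implicit Types a h : 'I_d -> 'I_d -> R.

Definition psd a : Prop := (forall j k, a j k = a k j) /\
  forall v : 'I_d -> R, 0 <= \sum_(j < d) \sum_(k < d) v j * v k * a j k.

Lemma sum2_delta a (v : 'I_d -> R) j k : j != k ->
  \sum_(l < d) \sum_(m < d) ((l == j)%:R * v j + (l == k)%:R * v k) *
    ((m == j)%:R * v j + (m == k)%:R * v k) * a l m =
  v j * v j * a j j + v j * v k * a j k + (v k * v j * a k j + v k * v k * a k k).
Proof.
move=> jk.
have E l : \sum_(m < d) ((l == j)%:R * v j + (l == k)%:R * v k) *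
    ((m == j)%:R * v j + (m == k)%:R * v k) * a l m =
    ((l == j)%:R * v j + (l == k)%:R * v k) * (v j * a l j + v k * a l k).
  transitivity (\sum_(m < d)
    ((m == j)%:R * (((l == j)%:R * v j + (l == k)%:R * v k) * v j * a l m) +
    (m == k)%:R * (((l == j)%:R * v j + (l == k)%:R * v k) * v k * a l m))).
    by apply: eq_bigr => m _; ring.
  by rewrite big_split !sum_delta /=; ring.
transitivity (\sum_(l < d) ((l == j)%:R * (v j * (v j * a l j + v k * a l k)) +
   (l == k)%:R * (v k * (v j * a l j + v k * a l k)))).
  by apply: eq_bigr => l _; rewrite E; ring.
by rewrite big_split !sum_delta /=; ring.
Qed.

Lemma psd_diag_ge0 a j : psd a -> 0 <= a j j.
Proof.
move=> [_ /(_ (fun l => (l == j)%:R))]; congr (_ <= _).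
transitivity (\sum_(l < d) (l == j)%:R * a l j); last exact: sum_delta.
apply: eq_bigr => l _.
transitivity (\sum_(m < d) (m == j)%:R * ((l == j)%:R * a l m)); last exact: sum_delta.
by apply: eq_bigr => m _; ring.
Qed.

Lemma psd_diag0 a j k : psd a -> a j j = 0 -> a j k = 0.
Proof.
move=> pa a0; have [<-//|jk] := eqVneq j k.
have [as_ pos] := pa; have akk := psd_diag_ge0 k pa.
(* With a j j = 0 the form at v j e_j + v k e_k is -(a k k + 2) (a j k)^2, and it must be
   non-negative. *)
pose v l := if l == j then - (a k k + 1) else a j k.
have vj : v j = - (a k k + 1) by rewrite /v eqxx.
have vk : v k = a j k by rewrite /v eq_sym (negbTE jk).
have := pos (fun l => (l == j)%:R * v j + (l == k)%:R * v k).
rewrite sum2_delta// vj vk a0 (as_ k j) => H.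
apply/eqP; rewrite -sqrf_eq0 eq_le sqr_ge0 andbT.
have : 0 <= - (a k k + 2) * a j k ^+ 2.
  by apply: le_trans H _; rewrite le_eqVlt; apply/orP; left; apply/eqP; ring.
rewrite mulNr oppr_ge0 pmulr_rle0//; lra.
Qed.

(* Gaussian elimination: subtracting the rank-one part carried by a positive
   pivot kills one diagonal entry and creates none. *)
Lemma psd_trace_le0 a h : psd a ->
  (forall v : 'I_d -> R, \sum_(j < d) \sum_(k < d) v j * v k * h j k <= 0) ->
  \sum_(j < d) \sum_(k < d) a j k * h j k <= 0.
Proof.
move=> + hneg; have [n] := ubnP #|[pred j | a j j != 0]|.
elim: n a => // n IH a; rewrite ltnS => an pa.
have [as_ pos] := pa.
have [a0|[p ap]] : (forall j, a j j = 0) \/ exists p, a p p != 0.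
- have [/forallP H|/forallPn[p ap]] := boolP [forall j, a j j == 0].
    by left=> j; exact/eqP.
  by right; exists p.
- rewrite big1// => j _; rewrite big1// => k _.
  by rewrite (psd_diag0 k pa (a0 j)) mul0r.
have app : 0 < a p p by rewrite lt_neqAle eq_sym ap psd_diag_ge0.
pose w j := a j p.
pose a' j k := a j k - w j * w k / a p p.
have E : \sum_(j < d) \sum_(k < d) a j k * h j k =
    \sum_(j < d) \sum_(k < d) a' j k * h j k +
    (a p p)^-1 * \sum_(j < d) \sum_(k < d) w j * w k * h j k.
  rewrite mulr_sumr -big_split; apply: eq_bigr => j _.
  rewrite mulr_sumr -big_split; apply: eq_bigr => k _ /=.
  by rewrite /a'; ring.
have pa' : psd a'.
  split=> [j k|v]; first by rewrite /a' as_ [w k * w j]mulrC.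
  pose s := \sum_(l < d) v l * w l.
  (* Completing the square: a' at v is a at the vector v moved along e_p until it is a-orthogonal to
     e_p. *)
  have := pos (fun l => v l - (l == p)%:R * (s / a p p)).
  congr (_ <= _).
  have sE : \sum_(j < d) \sum_(k < d) v j * v k * (w j * w k) = s * s.
    rewrite /s mulr_suml; apply: eq_bigr => j _; rewrite mulr_sumr.
    by apply: eq_bigr => k _; ring.
  pose t := s / a p p.
  have inner j : \sum_(k < d) (v j - (j == p)%:R * t) * (v k - (k == p)%:R * t) * a j k =
      (v j - (j == p)%:R * t) * (\sum_(k < d) v k * a j k - t * a j p).
    transitivity ((v j - (j == p)%:R * t) * (\sum_(k < d) (v k * a j k) -
       \sum_(k < d) (k == p)%:R * (t * a j k))); last by rewrite sum_delta.
    rewrite -sumrB mulr_sumr; apply: eq_bigr => k _; ring.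
  transitivity (\sum_(j < d) (v j * \sum_(k < d) v k * a j k - t * (v j * w j) -
     (j == p)%:R * (t * (\sum_(k < d) v k * a j k - t * a j p)))).
    by apply: eq_bigr => j _; rewrite inner /w; ring.
  rewrite !sumrB sum_delta -mulr_sumr -/s.
  have -> : \sum_(k < d) v k * a p k = s by apply: eq_bigr => k _; rewrite as_.
  have -> : t * a p p = s by rewrite /t divfK.
  rewrite subrr mulr0 subr0.
  transitivity (\sum_(j < d) \sum_(k < d) v j * v k * a j k - s * s / a p p).
    congr (_ - _); last by rewrite /t; ring.
    by apply: eq_bigr => j _; rewrite mulr_sumr; apply: eq_bigr => k _; ring.
  rewrite -sE mulr_suml -sumrB; apply: eq_bigr => j _.
  rewrite mulr_suml -sumrB; apply: eq_bigr => k _.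
  by rewrite /a'; ring.
rewrite E -[leRHS]addr0; apply: lerD.
  apply: IH pa'; apply: leq_trans an; apply: proper_card.
  apply/properP; split; last first.
    exists p; rewrite !inE//= negbK /a' /w mulfK// subrr//.
  apply/fintype.subsetP => j; rewrite !inE; apply: contra_neq => aj0.
  by rewrite /a' /w aj0 (psd_diag0 p pa aj0) mul0r mul0r subr0.
by rewrite mulr_ge0_le0// invr_ge0 ltW.
Qed.

End PSD.

Lemma integral_le0 (disp : measure_display) (T : measurableType disp)
    (R : realType) (mu : {measure set T -> \bar R}) (f : T -> R) :
  (forall x, f x <= 0) -> (\int[mu]_x (f x)%:E <= 0)%E.
Proof.
move=> f0; have fN0 x : setT x -> (0 <= (- f x)%:E)%E by rewrite lee_fin oppr_ge0.
have -> : (\int[mu]_x (f x)%:E)%E = (\int[mu]_x - (- f x)%:E)%E.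
  by apply: eq_integral => x _; rewrite -EFinN opprK.
by rewrite integral_ge0N// oppe_le0; exact: integral_ge0.
Qed.

(** * Passage from the neutral element to arbitrary points *)

Section Courrege.
Context {R : realType} {d : nat} {G : lieGroupType R d}.
Variables (X : 'I_d -> lieAlgebra G) (U : set G) (x : 'I_d -> testFun G).
Hypothesis hx : canonical_coordinates X U x.

(** One tuple holds all the data, ready for a choice over base points. The derivatives enter under
    the names D and H, so that they can be supplied as fields of f at s instead of fields of its
    translate at 1. *)
Lemma functional_form (L : (G -> R) -> R) :
  (forall f g, test f -> test g -> L (fun h => f h + g h) = L f + L g) ->
  (forall a f, test f -> L (fun h => a * f h) = a * L f) ->
  (forall f, test f -> (forall g, f g <= f 1%g) -> 0 <= f 1%g -> L f <= 0) ->
  exists p : (R * ('I_d -> R)) * (('I_d -> 'I_d -> R) *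
      {measure set (borelType G) -> \bar R}),
    [/\ 0 <= p.1.1, psd p.2.1, levy_measure X p.2.2 & forall f D H, test f ->
    (forall i, left_field (X i) f 1%g = D i) ->
    (forall j k, left_field (X j) (left_field (X k) f) 1%g = H j k) ->
    ((L f)%:E = (- p.1.1 * f 1%g + \sum_(i < d) p.1.2 i * D i
      + \sum_(j < d) \sum_(k < d) p.2.1 j k * H j k)%:E
     + \int[p.2.2]_g (f g - f 1%g - \sum_(i < d) x i g * D i)%:E)%E].
Proof.
move=> LD LZ L_max; have [c [b [c0 E]]] := functional_decomposition LD LZ L_max hx.
exists ((c, b), (diffusion LD LZ L_max hx, jump_measure LD LZ L_max)); split => //=.
- split; first exact: diffusion_sym.
  exact: diffusion_ge0.
- exact: jump_measure_levy.
- move=> f D H tf fD fH.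
  have <- : (fun i => left_field (X i) f 1%g) = D by apply/funext.
  have <- : (fun j k => left_field (X j) (left_field (X k) f) 1%g) = H.
    by apply/funext => j; apply/funext => k.
  exact: E.
Qed.

Lemma left_field_at k (f : G -> R) s :
  left_field (X k) f s = left_field (X k) (fun g => f (s * g)%g) 1%g.
Proof. by rewrite left_field_translate mulg1. Qed.

Lemma left_field2_at j k (f : G -> R) s :
  left_field (X j) (left_field (X k) f) s =
  left_field (X j) (left_field (X k) (fun g => f (s * g)%g)) 1%g.
Proof.
apply: (etrans (left_field_at j _ s)).
apply: (congr1 (fun F => left_field (X j) F 1%g)); apply/funext => g.
exact/esym/left_field_translate.
Qed.

Lemma test_le_sup (f : testFun G) g : f g <= sup (range f).
Proof.
have [M M0 fM] := test_bounded (test_testFun f).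
apply: sup_upper_bound; last by exists g.
split; first by exists (f g); exists g.
by exists M => _ [h _ <-]; apply: le_trans (fM h); exact: ler_norm.
Qed.

Lemma sup_attained (f : testFun G) s : (forall g, f g <= f s) ->
  sup (range f) = f s.
Proof.
move=> fs; apply/eqP; rewrite eq_le test_le_sup andbT.
by apply: ge_sup; [exists (f s); exists s|move=> _ [g _ <-]].
Qed.

(** After translation the maximum is at 1; there the first order derivatives vanish, and with them
    the discrepancy between X_j X_k and the Hessian. *)
Lemma local_form_pmp (a : 'I_d -> 'I_d -> R) (b : 'I_d -> R) (f : testFun G) s :
  psd a -> (forall g, f g <= f s) ->
  (forall i, left_field (X i) f s = 0) /\
  \sum_(j < d) \sum_(k < d) a j k * left_field (X j) (left_field (X k) f) s <= 0.
Proof.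
move=> pa fs; pose h g := f (s * g)%g.
have sh : smooth h by apply: smooth_translate; case: (test_testFun f).
have hmax g : h g <= h 1%g by rewrite /h mulg1.
have [Dh Hh] := coord_max hx sh hmax.
split=> [i|]; first by rewrite left_field_at (left_field1 hx i sh).
apply: le_trans (psd_trace_le0 pa Hh); rewrite le_eqVlt; apply/orP; left; apply/eqP.
apply: eq_bigr => j _; apply: eq_bigr => k _.
rewrite left_field2_at (left_field2 hx j k sh) big1 ?addr0// => i _.
by rewrite Dh mul0r.
Qed.

End Courrege.

Theorem theorem3p6 (R : realType) (d : nat) (G : lieGroupType R d)
    (X : 'I_d -> lieAlgebra G) (hX : lie_basis X)
    (U : set G) (x : 'I_d -> testFun G) (hx : canonical_coordinates X U x)
    (A : {linear testFun G -> (G -> R)}) :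
  positive_maximum_principle A <->
  exists (c : G -> R) (b : 'I_d -> G -> R) (a : 'I_d -> 'I_d -> G -> R)
         (mu : G -> {measure set (borelType G) -> \bar R}),
    [/\ forall sigma, 0 <= c sigma,
        forall sigma, let M := \matrix_(j < d, k < d) a j k sigma in
          M^T = M /\ forall v : 'rV[R]_d, 0 <= (v *m M *m v^T) 0 0,
        levy_kernel X mu &
        forall (f : testFun G) (sigma : G),
          ((A f sigma)%:E =
           (- c sigma * f sigma
            + \sum_(i < d) b i sigma * left_field (X i) f sigma
            + \sum_(j < d) \sum_(k < d)
                a j k sigma * left_field (X j) (left_field (X k) f) sigma)%:E
           + \int[mu sigma]_tau
               (f (sigma * tau)%g - f sigma
                - \sum_(i < d) x i tau * left_field (X i) f sigma)%:E)%E].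
Proof.
split=> [pmp|[c [b [a [mu [c0 apsd lmu E]]]]]]; last first.
  move=> f rho fsup sup0; rewrite -lee_fin E.
  have fmax g : f g <= f rho by rewrite fsup; exact: test_le_sup.
  have pa : psd (fun j k => a j k rho).
    have [/matrixP asym apos] := apsd rho; split.
      by move=> j k; have := asym k j; rewrite !mxE.
    move=> v; have := apos (\row_j v j); congr (_ <= _).
    rewrite mxE exchange_big; apply: eq_bigr => k _.
    rewrite !mxE mulr_suml; apply: eq_bigr => j _; rewrite !mxE.
    by rewrite mulrAC.
  have [D0 H0] := local_form_pmp hx (fun=> 0) pa fmax.
  rewrite -[leRHS]adde0; apply: leeD.
    rewrite lee_fin [X in _ + X + _]big1 => [|i _]; last by rewrite D0 mulr0.
    rewrite addr0 -[leRHS]addr0; apply: lerD => //.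
    by rewrite mulNr oppr_le0 mulr_ge0// fsup.
  apply: integral_le0 => g; rewrite big1 => [|i _]; last by rewrite D0 mulr0.
  by rewrite subr0 subr_le0.
pose shift s (f : G -> R) (g : G) := f (s^-1 * g)%g.
(* Translating by s^-1 makes L s, applied to the function g |-> f (s g), return A f s. The default 0
   is taken only where the translate is not a test function. *)
pose L s (f : G -> R) : R :=
  if pselect (shift s f \in @test_pred _ _ G) is left p then A (TestFun p) s else 0.
have LE s f (tf : shift s f \in @test_pred _ _ G) : L s f = A (TestFun tf) s.
  rewrite /L; case: pselect => // p; congr (A _ s); exact: val_inj.
have tshift s f : test f -> shift s f \in @test_pred _ _ G.
  by move=> tf; apply/testP; exact: test_translate.
have /choice[P HP] : forall s, exists p : (R * ('I_d -> R)) * (('I_d -> 'I_d -> R) *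
      {measure set (borelType G) -> \bar R}),
    [/\ 0 <= p.1.1, psd p.2.1, levy_measure X p.2.2 & forall f D H, test f ->
    (forall i, left_field (X i) f 1%g = D i) ->
    (forall j k, left_field (X j) (left_field (X k) f) 1%g = H j k) ->
    ((L s f)%:E = (- p.1.1 * f 1%g + \sum_(i < d) p.1.2 i * D i
      + \sum_(j < d) \sum_(k < d) p.2.1 j k * H j k)%:E
     + \int[p.2.2]_g (f g - f 1%g - \sum_(i < d) x i g * D i)%:E)%E].
  move=> s; apply: (functional_form hx).
  - move=> f g tf tg; rewrite (LE _ _ (tshift s _ tf)) (LE _ _ (tshift s _ tg)).
    rewrite (LE _ _ (tshift s _ (testD tf tg))).
    have -> : TestFun (tshift s _ (testD tf tg)) =
        TestFun (tshift s _ tf) + TestFun (tshift s _ tg) by exact: val_inj.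
    by rewrite linearD.
  - move=> k f tf; rewrite (LE _ _ (tshift s _ tf)) (LE _ _ (tshift s _ (testZ k tf))).
    have -> : TestFun (tshift s _ (testZ k tf)) = k *: TestFun (tshift s _ tf).
      exact: val_inj.
    by rewrite linearZ.
  - move=> f tf fmax f1; rewrite (LE _ _ (tshift s _ tf)).
    have fs : TestFun (tshift s _ tf) s = f 1%g by rewrite /= /shift mulVg.
    have sE := @sup_attained _ _ _ (TestFun (tshift s _ tf)) s.
    have {}sE : sup (range (TestFun (tshift s _ tf))) = f 1%g.
      by rewrite sE fs// => g; exact: fmax.
    by apply: pmp; rewrite sE.
exists (fun s => (P s).1.1), (fun i s => (P s).1.2 i), (fun j k s => (P s).2.1 j k).
exists (fun s => (P s).2.2); split.
- by move=> s; have [] := HP s.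
- move=> s /=; have [_ [asym apos] _ _] := HP s; split.
    by apply/matrixP => j k; rewrite !mxE asym.
  move=> v; have := apos (fun j => v 0 j); congr (_ <= _).
  rewrite mxE exchange_big; apply: eq_bigr => k _.
  rewrite !mxE mulr_suml; apply: eq_bigr => j _; rewrite !mxE.
  by rewrite mulrAC.
- by move=> s; have [] := HP s.
- move=> f s; have [_ _ _ /(_ (fun g => f (s * g)%g) (fun i => left_field (X i) f s)
    (fun j k => left_field (X j) (left_field (X k) f) s)
    (test_translate s (test_testFun f)) (fun i => esym (left_field_at _ i _ s))
    (fun j k => esym (left_field2_at _ j k _ s)))] := HP s.
  rewrite (LE _ _ (tshift s _ (test_translate s (test_testFun f)))).
  have -> : TestFun (tshift s _ (test_translate s (test_testFun f))) = f.
    by apply: val_inj; apply/funext => g; rewrite /= /shift mulVKg.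
  by rewrite mulg1.
Qed.
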